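(* Fix $d$. There exist constants $C_{gap}>0$, $C,c>0$ and $C_d>0$ (depending only on $d$) such that the following holds. Let $\boldsymbol{\mathcal Y}=\boldsymbol{\mathcal X}+\boldsymbol{\mathcal Z}$ with tensors in $\mathbb{R}^{p_1\times\cdots\times p_d}$, where $\boldsymbol{\mathcal X}$ is fixed and admits a tensor-train (TT) decomposition with ranks $(r_1,\dots,r_{d-1})$ and the entries $\boldsymbol{\mathcal Z}_{i_1,\dots,i_d}$ are independent, mean-zero, $\sigma$-sub-Gaussian random variables. Let $p=\min\{p_1,\dots,p_d\}$, and suppose $$\lambda_k:=s_{r_k}([\boldsymbol{\mathcal X}]_k)\ge C_{gap}\Bigl(\bigl(\textstyle\sum_{i=1}^dp_ir_{i-1}r_i\bigr)^{1/2}+(p_{k+1}\cdots p_d)^{1/2}\Bigr)\sigma,\qquad1\le k\le d-1.$$ Let $\widehat{\boldsymbol{\mathcal X}}^{(t)}$ be the iterates of TTOI run on $\boldsymbol{\mathcal Y}$ with input ranks $(r_1,\dots,r_{d-1})$. Then with probability at least $1-Ce^{-cp}$, for all $t\ge1$, $$\|\widehat{\boldsymbol{\mathcal X}}^{(t)}-\boldsymbol{\mathcal X}\|_{\mathrm F}^2\le C_d\,\sigma^2\sum_{i=1}^dp_ir_ir_{i-1}.$$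
   Context: Throughout $d\ge2$, $p_1,\dots,p_d$ and $r_1,\dots,r_{d-1}$ are positive integers, $r_0=r_d=1$. A random variable $z$ is $\sigma$-sub-Gaussian if $\mathbb{E}e^{t(z-\mathbb{E}z)}\le e^{\sigma^2t^2/2}$ for all $t\in\mathbb{R}$. $s_1(A)\ge s_2(A)\ge\cdots\ge0$ are the singular values of a matrix $A$; $\|\cdot\|_{\mathrm F}$ is the Frobenius norm (entrywise, for matrices and tensors). $\mathrm{SVD}^L_r(A)$ and $\mathrm{SVD}^R_r(A)$ are the matrices with orthonormal columns consisting of the leading $r$ left, respectively right, singular vectors of $A$ (any choice in case of ties). $U\otimes V$ is the usual Kronecker product, with blocks $U_{ij}V$. The sequential unfolding $[\boldsymbol{\mathcal X}]_k\in\mathbb{R}^{(p_1\cdots p_k)\times(p_{k+1}\cdots p_d)}$ has entry $\boldsymbol{\mathcal X}_{i_1,\dots,i_d}$ at row $i_1+(i_2-1)p_1+\cdots+(i_k-1)p_1\cdots p_{k-1}$ and column $i_{k+1}+(i_{k+2}-1)p_{k+1}+\cdots+(i_d-1)p_{k+1}\cdots p_{d-1}$. $\mathrm{Reshape}$ of matrices is column-major: for $A\in\mathbb{R}^{q_1\times q_2q_3}$ and $\widetilde A\in\mathbb{R}^{q_1q_2\times q_3}$, $\widetilde A=\mathrm{Reshape}(A,q_1q_2,q_3)$ and $A=\mathrm{Reshape}(\widetilde A,q_1,q_2q_3)$ iff $\widetilde A_{(i_2-1)q_1+i_1,i_3}=A_{i_1,(i_3-1)q_2+i_2}$ for all indices.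 $\boldsymbol{\mathcal X}$ admits a TT decomposition with ranks $(r_1,\dots,r_{d-1})$ if there are $G_1\in\mathbb{R}^{p_1\times r_1}$, $\boldsymbol{\mathcal G}_k\in\mathbb{R}^{r_{k-1}\times p_k\times r_k}$ ($2\le k\le d-1$), $G_d\in\mathbb{R}^{p_d\times r_{d-1}}$ with $\boldsymbol{\mathcal X}_{i_1,\dots,i_d}=\sum_{\alpha_1=1}^{r_1}\cdots\sum_{\alpha_{d-1}=1}^{r_{d-1}}G_{1,[i_1,\alpha_1]}\boldsymbol{\mathcal G}_{2,[\alpha_1,i_2,\alpha_2]}\cdots\boldsymbol{\mathcal G}_{d-1,[\alpha_{d-2},i_{d-1},\alpha_{d-1}]}G_{d,[i_d,\alpha_{d-1}]}$. It is understood that $r_k\le r_{k-1}p_k$ and $r_{k-1}\le p_kr_k$ for all $k$, so that all matrices of singular vectors below exist. Sequential products. For $M_i\in\mathbb{R}^{(p_ir_{i-1})\times r_i}$ ($1\le i\le d-1$): $M_{\mathrm{prod},1}^{(L)}=M_1$, $M_{\mathrm{prod},k+1}^{(L)}=(I_{p_{k+1}}\otimes M_{\mathrm{prod},k}^{(L)})M_{k+1}$. For $B_j\in\mathbb{R}^{(p_jr_j)\times r_{j-1}}$ ($2\le j\le d$): $B_{\mathrm{prod},d}^{(R)}=B_d$, $B_{\mathrm{prod},k}^{(R)}=(B_{\mathrm{prod},k+1}^{(R)}\otimes I_{p_k})B_k$. TTOI (tensor-train orthogonal iteration) with input $\boldsymbol{\mathcal Y}\in\mathbb{R}^{p_1\times\cdots\times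 p_d}$ and ranks $r_1,\dots,r_{d-1}$ produces iterates $\widehat{\boldsymbol{\mathcal X}}^{(t)}$, $t=0,1,2,\dots$: Initialization ($t=0$): $R_1^{(0)}=[\boldsymbol{\mathcal Y}]_1$; for $k=1,\dots,d-1$, $\widehat U_k^{(0)}=\mathrm{SVD}^L_{r_k}(R_k^{(0)})$, $\widetilde R_k^{(0)}=\widehat U_k^{(0)\top}R_k^{(0)}$, and if $k<d-1$, $R_{k+1}^{(0)}=\mathrm{Reshape}(\widetilde R_k^{(0)},r_kp_{k+1},p_{k+2}\cdots p_d)$. Then $[\widehat{\boldsymbol{\mathcal X}}^{(0)}]_{d-1}=(\widehat U^{(0)})_{\mathrm{prod},d-1}^{(L)}\widetilde R_{d-1}^{(0)}$. Backward update ($t$ odd): $\widehat V_d^{(t)}=\mathrm{SVD}^R_{r_{d-1}}(\widetilde R_{d-1}^{(t-1)})$; for $k=d-1,\dots,2$, $\widehat V_k^{(t)}=\mathrm{SVD}^R_{r_{k-1}}\bigl(\widetilde R_{k-1}^{(t-1)}((\widehat V^{(t)})_{\mathrm{prod},k+1}^{(R)}\otimes I_{p_k})\bigr)$. Then $[\widehat{\boldsymbol{\mathcal X}}^{(t)}]_1=[\boldsymbol{\mathcal Y}]_1(\widehat V^{(t)})_{\mathrm{prod},2}^{(R)}(\widehat V^{(t)})_{\mathrm{prod},2}^{(R)\top}$. Forward update ($t\ge2$ even): $R_1^{(t)}=[\boldsymbol{\mathcal Y}]_1$; for $k=1,\dots,d-1$, $\widehat U_k^{(t)}=\mathrm{SVD}^L_{r_k}\bigl(R_k^{(t)}(\widehat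 V^{(t-1)})_{\mathrm{prod},k+1}^{(R)}\bigr)$, $\widetilde R_k^{(t)}=\widehat U_k^{(t)\top}R_k^{(t)}$, and if $k<d-1$, $R_{k+1}^{(t)}=\mathrm{Reshape}(\widetilde R_k^{(t)},r_kp_{k+1},p_{k+2}\cdots p_d)$. Then $[\widehat{\boldsymbol{\mathcal X}}^{(t)}]_{d-1}=(\widehat U^{(t)})_{\mathrm{prod},d-1}^{(L)}\widetilde R_{d-1}^{(t)}$. *)

(* Defs.v *)
From HB Require Import structures.
From mathcomp Require Import all_boot all_order all_algebra.
From mathcomp Require Import all_classical all_reals all_analysis.
From mathcomp Require Import mxtens ring.

Set Implicit Arguments.
Unset Strict Implicit.
Unset Printing Implicit Defensive.

Import Order.TTheory GRing.Theory Num.Theory.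

Local Open Scope classical_set_scope.
Local Open Scope ring_scope.

(* Dimensions and ranks are functions [p r : nat -> nat] of which only
   [p 1, ..., p d] and [r 0, ..., r d] are used. Entries of vectors, matrices
   and tensors are numbered from 0. *)

Definition dimprod (p : nat -> nat) (a b : nat) : nat :=
  (\prod_(a <= i < b.+1) p i)%N.

(* The component [i k], with [k : 'I_d], is the index along mode [k.+1]. *)
Definition tindex (d : nat) (p : nat -> nat) : finType :=
  {dffun forall k : 'I_d, 'I_(p k.+1)}.

Definition tensor (R : realType) (d : nat) (p : nat -> nat) : Type :=
  {ffun tindex d p -> R}.

Definition sqfrob (R : realType) (d : nat) (p : nat -> nat)
    (X : tensor R d p) : R :=
  \sum_(i : tindex d p) X i ^+ 2.

Definition unfold_row (d : nat) (p : nat -> nat) (k : nat)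
    (i : tindex d p) : nat :=
  (\sum_(j < d | j < k) i j * dimprod p 1 j)%N.

Definition unfold_col (d : nat) (p : nat -> nat) (k : nat)
    (i : tindex d p) : nat :=
  (\sum_(j < d | k <= j) i j * dimprod p k.+1 j)%N.

(* For 1 <= k <= d - 1, exactly one multi-index is sent to a given position,
   so that the sum has a single term: see [unfoldingE] below. *)
Definition unfolding (R : realType) (d : nat) (p : nat -> nat) (k : nat)
    (X : tensor R d p) : 'M[R]_(dimprod p 1 k, dimprod p k.+1 d) :=
  \matrix_(a, b)
    \sum_(i : tindex d p | (unfold_row k i == a) && (unfold_col k i == b)) X i.

Lemma digits_inj (q a b a' b' : nat) : (a < q)%N -> (a' < q)%N ->
  (a + b * q == a' + b' * q)%N = (a == a') && (b == b').
Proof.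
move=> aq a'q; apply/eqP/andP => [e|[/eqP -> /eqP ->] //].
have q0 : (0 < q)%N by exact: leq_ltn_trans aq.
split; apply/eqP.
  by move: (congr1 (modn^~ q) e); rewrite !(addnC _ (_ * q)) !modnMDl !modn_small.
by move: (congr1 (divn^~ q) e);
  rewrite !(addnC _ (_ * q)) !divnMDl // !divn_small // !addn0.
Qed.

Lemma radix_lt (p f : nat -> nat) (a b : nat) : (a <= b)%N ->
  (forall j, (a <= j < b)%N -> (f j < p j.+1)%N) ->
  (\sum_(a <= j < b) f j * dimprod p a.+1 j < dimprod p a.+1 b)%N.
Proof.
elim: b => [|b IH]; first by rewrite leqn0 => /eqP -> _; rewrite /dimprod !big_geq.
rewrite leq_eqVlt => /predU1P[<- _|]; first by rewrite /dimprod !big_geq.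
rewrite ltnS => ab fp.
rewrite big_nat_recr //= [X in (_ < X)%N]/dimprod [X in (_ < X)%N]big_nat_recr //=.
have fb : (f b < p b.+1)%N by rewrite fp // ab ltnSn.
have {}IH := IH ab (fun j h => fp j (ltac:(by case/andP: h => -> /ltnW; rewrite ltnS))).
apply: leq_trans (_ : (f b).+1 * dimprod p a.+1 b <= _)%N.
  by rewrite mulSn ltn_add2r.
by rewrite mulnC leq_mul2l fb orbT.
Qed.

Lemma radix_inj (p f g : nat -> nat) (a b : nat) :
  (forall j, (a <= j < b)%N -> (f j < p j.+1)%N) ->
  (forall j, (a <= j < b)%N -> (g j < p j.+1)%N) ->
  (\sum_(a <= j < b) f j * dimprod p a.+1 j =
     \sum_(a <= j < b) g j * dimprod p a.+1 j)%N ->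
  forall j, (a <= j < b)%N -> f j = g j.
Proof.
elim: b => [|b IH] fp gp; first by move=> _ j; rewrite ltn0 andbF.
have [ab|ba] := leqP a b; last first.
  by move=> _ j /andP[aj]; rewrite ltnNge (leq_trans ba aj).
have w j : (a <= j < b)%N -> (a <= j < b.+1)%N.
  by case/andP=> -> /ltnW; rewrite ltnS.
rewrite !big_nat_recr //= => /eqP.
rewrite digits_inj ?radix_lt //; try by move=> j /w; auto.
move=> /andP[/eqP e /eqP eb] j /andP[aj].
rewrite ltnS leq_eqVlt => /predU1P[-> //|jb].
by apply: IH e _ _ => [k /w/fp|k /w/gp|] //; rewrite aj.
Qed.

Lemma unfoldingE (R : realType) (d : nat) (p : nat -> nat) (k : nat)
    (X : tensor R d p) (i : tindex d p)
    (a : 'I_(dimprod p 1 k)) (b : 'I_(dimprod p k.+1 d)) : (k <= d)%N ->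
  unfold_row k i = a -> unfold_col k i = b -> unfolding k X a b = X i.
Proof.
move=> kd ia ib; rewrite mxE (big_pred1 i) // => i'.
apply/andP/eqP => [[/eqP ra /eqP cb]|->]; last by rewrite ia ib.
pose dig (u : tindex d p) (n : nat) : nat :=
  if insub n is Some j then u j else 0.
have digE u (j : 'I_d) : dig u j = u j by rewrite /dig valK.
have dig_lt u j : (j < d)%N -> (dig u j < p j.+1)%N.
  by move=> jd; rewrite (digE u (Ordinal jd)) (ltn_ord (u (Ordinal jd))).
have rowE u : unfold_row k u = (\sum_(0 <= j < k) dig u j * dimprod p 1 j)%N.
  rewrite /unfold_row (big_nat_widen _ _ d) // big_mkord.
  by apply: eq_bigr => j _; rewrite digE.
have colE u : unfold_col k u = (\sum_(k <= j < d) dig u j * dimprod p k.+1 j)%N.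
  rewrite /unfold_col big_geq_mkord.
  by apply: eq_bigr => j _; rewrite digE.
apply/ffunP => j; apply: val_inj; rewrite /= -!digE.
have [jk|kj] := ltnP j k.
  apply: (@radix_inj p _ _ 0 k) => [l /andP[_ /leq_trans]|l /andP[_ /leq_trans]||] //.
  - by move=> /(_ _ kd)/dig_lt.
  - by move=> /(_ _ kd)/dig_lt.
  - by rewrite -!rowE ia ra.
apply: (@radix_inj p _ _ k d) => [l /andP[_ /dig_lt]|l /andP[_ /dig_lt]||] //.
- by rewrite -!colE ib cb.
- by rewrite kj ltn_ord.
Qed.

(* Column-major Reshape, for m * n = m' * n': the entry in position (a, b) of
   an m x n matrix has rank a + b * m in the column-major order, and the sum
   has a single term. When m = m' and n = n', this is the identity, and it is
   used below as a cast between provably equal dimensions. *)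
Definition mxreshape (R : realType) (m n m' n' : nat)
    (A : 'M[R]_(m, n)) : 'M[R]_(m', n') :=
  \matrix_(a, b)
    \sum_(u : 'I_m * 'I_n | (u.1 + u.2 * m == a + b * m')%N) A u.1 u.2.
Arguments mxreshape {R m n m' n'} A.

Lemma mxreshape_split (R : realType) (q1 q2 q3 : nat)
    (A : 'M[R]_(q1, q3 * q2)) (i1 : 'I_q1) (i2 : 'I_q2) (i3 : 'I_q3) :
  (mxreshape A : 'M[R]_(q2 * q1, q3)) (mxtens_index (i2, i1)) i3 =
  A i1 (mxtens_index (i3, i2)).
Proof.
rewrite mxE (big_pred1 (i1, mxtens_index (i3, i2))) // => -[a b] /=.
rewrite xpair_eqE -!(inj_eq val_inj) /= -(@digits_inj q1) //.
by apply: congr1; ring.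
Qed.

Lemma mxreshape_join (R : realType) (q1 q2 q3 : nat)
    (A : 'M[R]_(q2 * q1, q3)) (i1 : 'I_q1) (i2 : 'I_q2) (i3 : 'I_q3) :
  (mxreshape A : 'M[R]_(q1, q3 * q2)) i1 (mxtens_index (i3, i2)) =
  A (mxtens_index (i2, i1)) i3.
Proof.
rewrite mxE (big_pred1 (mxtens_index (i2, i1), i3)) // => -[a b] /=.
rewrite xpair_eqE -!(inj_eq val_inj) /= -(@digits_inj (q2 * q1)) ?ltn_ord //.
  by apply: congr1; ring.
exact: (ltn_ord (mxtens_index (i2, i1))).
Qed.

Lemma mxreshape_id (R : realType) (m n : nat) (A : 'M[R]_(m, n)) :
  mxreshape A = A.
Proof.
apply/matrixP => a b; rewrite mxE (big_pred1 (a, b)) // => -[u v] /=.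
by rewrite digits_inj // xpair_eqE -!(inj_eq val_inj).
Qed.

(* G_1 and G_d are seen as order-3 tensors with r 0 = 1 and r d = 1 as first
   and last dimension respectively. *)
Definition tt_decomposable (R : realType) (d : nat) (p r : nat -> nat)
    (X : tensor R d p) : Prop :=
  exists G : forall k : 'I_d, 'I_(r k) -> 'I_(p k.+1) -> 'I_(r k.+1) -> R,
    forall i : tindex d p,
      X i = \sum_(alpha : {dffun forall k : 'I_d.+1, 'I_(r k)})
              \prod_(k < d)
                G k (alpha (widen_ord (leqnSn d) k)) (i k)
                    (alpha (lift ord0 k)).

(* Full singular value decomposition; [s j] is the (j+1)-st singular value,
   and the sequence is padded with zeros. *)
Definition is_svd (R : realType) (m n : nat) (A : 'M[R]_(m, n))
    (U : 'M[R]_m) (s : nat -> R) (V : 'M[R]_n) : Prop :=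
  [/\ U^T *m U = 1%:M /\ V^T *m V = 1%:M,
      forall i j : nat, (i <= j)%N -> s j <= s i,
      forall i : nat, 0 <= s i,
      forall i : nat, (minn m n <= i)%N -> s i = 0
    & A = U *m (\matrix_(i < m, j < n) (s i *+ (i == j :> nat))) *m V^T].

(* [singval A k] is s_k(A), for k >= 1. The sequence of singular values is
   uniquely determined by A. *)
Definition singval (R : realType) (m n : nat) (A : 'M[R]_(m, n)) (k : nat) : R :=
  xget (fun=> 0) [set s | exists U V, is_svd A U s V] k.-1.

(* W is a possible value of SVD^L_r(A), resp. SVD^R_r(A), for r <= min(m, n):
   [pid_mx r] selects the first r columns. *)
Definition is_SVDL (R : realType) (m n r : nat) (A : 'M[R]_(m, n))
    (W : 'M[R]_(m, r)) : Prop :=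
  exists U s V, is_svd A U s V /\ W = U *m pid_mx r.

Definition is_SVDR (R : realType) (m n r : nat) (A : 'M[R]_(m, n))
    (W : 'M[R]_(n, r)) : Prop :=
  exists U s V, is_svd A U s V /\ W = V *m pid_mx r.

Section TTOI.
Variables (R : realType) (d : nat) (p r : nat -> nat).

(* [A *t B] is the Kronecker product with blocks A i j *: B. The value at
   k = 0 is irrelevant. *)
Fixpoint seqprodL (M : forall k, 'M[R]_(p k * r k.-1, r k)) (k : nat) :
    'M[R]_(dimprod p 1 k, r k) :=
  match k with
  | 0 => 0
  | k'.+1 => if k' is 0 then mxreshape (M k'.+1)
             else mxreshape (((1%:M : 'M[R]_(p k'.+1)) *t seqprodL M k') *m M k'.+1)
  end.

Fixpoint seqprodR_rec (B : forall k, 'M[R]_(r k * p k, r k.-1)) (k n : nat) :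
    'M[R]_(dimprod p k d, r k.-1) :=
  match n with
  | 0 => mxreshape (B k)
  | n'.+1 => mxreshape ((seqprodR_rec B k.+1 n' *t (1%:M : 'M[R]_(p k))) *m B k)
  end.

Definition seqprodR (B : forall k, 'M[R]_(r k * p k, r k.-1)) (k : nat) :
    'M[R]_(dimprod p k d, r k.-1) := seqprodR_rec B k (d - k).

(* The matrices R_k of an initialization or forward pass with singular vectors
   U_1, U_2, ...; the value at k = 0 is irrelevant. *)
Fixpoint ttoi_R (Y : tensor R d p) (U : forall k, 'M[R]_(p k * r k.-1, r k))
    (k : nat) : 'M[R]_(p k * r k.-1, dimprod p k.+1 d) :=
  match k with
  | 0 => 0
  | k'.+1 => if k' is 0 then mxreshape (unfolding 1 Y)
             else mxreshape ((U k')^T *m ttoi_R Y U k')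
  end.

Definition ttoi_Rtilde (Y : tensor R d p)
    (U : forall k, 'M[R]_(p k * r k.-1, r k)) (k : nat) :
    'M[R]_(r k, dimprod p k.+1 d) :=
  (U k)^T *m ttoi_R Y U k.

(* [U t k] and [V t k] are the matrices of singular vectors computed at
   iteration t, for t even and t odd respectively. *)
Definition ttoi_svd (Y : tensor R d p)
    (U : nat -> forall k, 'M[R]_(p k * r k.-1, r k))
    (V : nat -> forall k, 'M[R]_(r k * p k, r k.-1)) : Prop :=
  [/\ forall k, (1 <= k <= d.-1)%N -> is_SVDL (ttoi_R Y (U 0%N) k) (U 0%N k),
      forall t, odd t ->
        is_SVDR (mxreshape (ttoi_Rtilde Y (U t.-1) d.-1) :
                   'M[R]_(r d.-1, r d * p d)) (V t d) /\
        (forall k, (2 <= k <= d.-1)%N ->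
           is_SVDR (ttoi_Rtilde Y (U t.-1) k.-1 *m
                      mxreshape (seqprodR (V t) k.+1 *t (1%:M : 'M[R]_(p k))))
                   (V t k))
    & forall t, (2 <= t)%N -> ~~ odd t ->
        forall k, (1 <= k <= d.-1)%N ->
          is_SVDL (ttoi_R Y (U t) k *m seqprodR (V t.-1) k.+1) (U t k)].

(* [Xhat] is a possible sequence of iterates of TTOI on [Y] (with some choice
   of the singular vectors in case of ties). *)
Definition ttoi_iterates (Y : tensor R d p) (Xhat : nat -> tensor R d p) :
    Prop :=
  exists U V,
    [/\ ttoi_svd Y U V,
        forall t, odd t ->
          unfolding 1 (Xhat t) =
            unfolding 1 Y *m seqprodR (V t) 2 *m (seqprodR (V t) 2)^T
      & forall t, ~~ odd t ->
          unfolding d.-1 (Xhat t) =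
            seqprodL (U t) d.-1 *m ttoi_Rtilde Y (U t) d.-1].

End TTOI.

Section Probability.
Local Open Scope ereal_scope.

Definition sub_gaussian (dT : measure_display) (T : measurableType dT)
    (R : realType) (P : probability T R) (sigma : R) (z : T -> R) : Prop :=
  P.-integrable setT (EFin \o z) /\
  forall t : R,
    'E_P[fun w => expR (t * (z w - fine 'E_P[z]))%R]
      <= (expR (sigma ^+ 2 * t ^+ 2 / 2))%:E.

Definition mutually_independent (dT : measure_display) (T : measurableType dT)
    (R : realType) (P : probability T R) (I : finType) (Z : I -> T -> R) :
    Prop :=
  forall (J : {set I}) (B : I -> set R), (forall i, measurable (B i)) ->
    P (\bigcap_(i in [set` J]) Z i @^-1` B i) =
    \prod_(i in J) P (Z i @^-1` B i).

End Probability.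

(* Main.v *)
From HB Require Import structures.
Require Import Defs.
From mathcomp Require Import all_boot all_order all_algebra.
From mathcomp Require Import all_classical all_reals all_analysis.
From mathcomp Require Import measurable_realfun mxtens ring lra zify.
Import Order.TTheory GRing.Theory Num.Theory.
Import numFieldNormedType.Exports HBNNSimple.
Local Open Scope classical_set_scope.
Local Open Scope ring_scope.

(** Why the theorem holds.

    Write X_k, Z_k for the k-th unfoldings of the signal and of the noise, L_k
    for the left basis of modes 1, ..., k built by a forward pass and Q_k for
    the right basis of modes k+1, ..., d built by a backward pass, both with
    orthonormal columns.

    Deterministic part. A pass chooses one factor at a time: in a forward pass
    U_k consists of the leading left singular vectors of
    (1 (x) L_(k-1))^T (X_k + Z_k) Q_k. This matrix has exactly r_k columns, so
    U_k reproduces it exactly ([SVDL_exact]), and the part of the signal missed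
    by U_k is minus the missed part of the noise (1 (x) L_(k-1))^T Z_k Q_k. If
    Q_k makes an angle bounded away from 90 degrees with the row space of X_k,
    the right factor Q_k can be removed from the signal at the cost of a
    constant ([exact_svd_residual]). Hence every factor loses at most a
    constant times the Frobenius norm of a contraction of the noise with all
    factors but one, and the losses of a pass are mutually orthogonal
    ([proj_err_step], [fwd_err], [bwd_err]). The same bound, divided by the
    singular values of X_k, shows that the new bases again make a controlled
    angle with the signal ([captures_step]), so that forward and backward
    passes certify each other for ever ([good]). For the initialization there
    is no Q_k, and the angle is obtained from an operator norm bound on the
    noise through Weyl's inequality ([svd_weyl], [init_svd_residual]); this is
    where the products p_(k+1) ... p_d enter the assumption. All
    statements are uniform in the bases, so that the dependence of the iterates
    on the noise is harmless and one event serves all iterations.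

    Probabilistic part. The Frobenius norm of a contraction of the noise with
    all factors but one is the supremum of the inner products of the noise with
    tensors of TT form of norm at most 1, a functional that is linear in each
    factor. Each factor ranges over the unit ball of an operator or Frobenius
    norm, which is contained in 4 times the convex hull of at most 8^n of its
    points, n being the number of entries ([net_linear]); replacing the factors
    one by one by points of these nets costs 4^d ([slots_net]). The nets come
    from a maximal separated subset of a fine lattice, whose cardinal is
    bounded by counting lattice points instead of comparing volumes
    ([count_dilate], [count_packing]). With D = sum_i p_i r_(i-1) r_i there are
    at most 8^D tensors in the end, each inner product has a sub-Gaussian tail
    ([tail], which rests on the factorization [expect_prod_le] of expectations
    of products), and a union bound at level sigma sqrt(8 D) leaves a
    probability of at most exp(-D) ([net_event]). *)

Set Implicit Arguments.
Unset Strict Implicit.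
Unset Printing Implicit Defensive.

Local Notation upd := eqtype.dfwith.

(** * Geometry of the Frobenius norm *)

Section Frobenius.
Variable R : realType.

Definition dotF m n (A B : 'M[R]_(m, n)) : R := \sum_i \sum_j A i j * B i j.

(** Norms are handled through their squares, which keeps square roots out of the
    linear algebra. *)
Definition sqF m n (A : 'M[R]_(m, n)) : R := dotF A A.

Lemma dotF_tr m n (A B : 'M[R]_(m, n)) : dotF A B = \tr (A^T *m B).
Proof.
rewrite /mxtrace /dotF exchange_big; apply: eq_bigr => j _.
by rewrite mxE; apply: eq_bigr => i _; rewrite mxE.
Qed.

Lemma sqFE m n (A : 'M[R]_(m, n)) : sqF A = \sum_i \sum_j A i j ^+ 2.
Proof. by rewrite /sqF /dotF. Qed.

Lemma dotFC m n (A B : 'M[R]_(m, n)) : dotF A B = dotF B A.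
Proof. by apply: eq_bigr => i _; apply: eq_bigr => j _; rewrite mulrC. Qed.

Lemma dotFDr m n (A B C : 'M[R]_(m, n)) : dotF A (B + C) = dotF A B + dotF A C.
Proof. by rewrite !dotF_tr mulmxDr mxtraceD. Qed.

Lemma dotFZr m n (A B : 'M[R]_(m, n)) (a : R) : dotF A (a *: B) = a * dotF A B.
Proof. by rewrite !dotF_tr -scalemxAr mxtraceZ. Qed.

Lemma dotFZl m n (A B : 'M[R]_(m, n)) (a : R) : dotF (a *: A) B = a * dotF A B.
Proof. by rewrite dotFC dotFZr dotFC. Qed.

Lemma dotFDl m n (A B C : 'M[R]_(m, n)) : dotF (A + B) C = dotF A C + dotF B C.
Proof. by rewrite ![dotF _ C]dotFC dotFDr. Qed.

Lemma dotFNr m n (A B : 'M[R]_(m, n)) : dotF A (- B) = - dotF A B.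
Proof. by rewrite -scaleN1r dotFZr mulN1r. Qed.

Lemma dotF_mull m n k (A : 'M[R]_(m, n)) (B : 'M[R]_(n, k)) C :
  dotF (A *m B) C = dotF B (A^T *m C).
Proof. by rewrite !dotF_tr trmx_mul mulmxA. Qed.

Lemma dotF_mulr m n k (A : 'M[R]_(m, n)) (B : 'M[R]_(n, k)) C :
  dotF (A *m B) C = dotF A (C *m B^T).
Proof.
by rewrite !dotF_tr trmx_mul -mulmxA mxtrace_mulC mulmxA.
Qed.

Lemma sqF_ge0 m n (A : 'M[R]_(m, n)) : 0 <= sqF A.
Proof. by apply: sumr_ge0 => i _; apply: sumr_ge0 => j _; rewrite -expr2 sqr_ge0. Qed.

Lemma sqF0 m n : sqF (0 : 'M[R]_(m, n)) = 0.
Proof. by rewrite /sqF dotF_tr mulmx0 mxtrace0. Qed.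

Lemma sqF_eq0 m n (A : 'M[R]_(m, n)) : sqF A = 0 -> A = 0.
Proof.
move=> A0; apply/matrixP => i j; rewrite mxE; apply/eqP.
have p1 (i' : 'I_m) (_ : true) : 0 <= \sum_j A i' j * A i' j.
  by apply: sumr_ge0 => k _; rewrite -expr2 sqr_ge0.
have Ai0 : \sum_j A i j * A i j = 0 by apply: (psumr_eq0P p1 A0).
have p2 (k : 'I_n) (_ : true) : 0 <= A i k * A i k by rewrite -expr2 sqr_ge0.
have /eqP : A i j * A i j = 0 by apply: (psumr_eq0P p2 Ai0).
by rewrite -expr2 sqrf_eq0.
Qed.

Lemma sqFZ m n (A : 'M[R]_(m, n)) (a : R) : sqF (a *: A) = a ^+ 2 * sqF A.
Proof. by rewrite /sqF dotFZl dotFZr mulrA. Qed.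

Lemma sqFN m n (A : 'M[R]_(m, n)) : sqF (- A) = sqF A.
Proof. by rewrite -scaleN1r sqFZ sqrrN expr1n mul1r. Qed.

Lemma sqF_trmx m n (A : 'M[R]_(m, n)) : sqF A^T = sqF A.
Proof. by rewrite /sqF !dotF_tr trmxK mxtrace_mulC. Qed.

Lemma sqFD m n (A B : 'M[R]_(m, n)) :
  sqF (A + B) = sqF A + 2 * dotF A B + sqF B.
Proof. by rewrite /sqF dotFDl !dotFDr (dotFC B A); ring. Qed.

Lemma sqFB_le m n (A B : 'M[R]_(m, n)) : sqF (A - B) <= 2 * sqF A + 2 * sqF B.
Proof.
have := sqF_ge0 (A + B); rewrite !sqFD sqFN dotFNr => h; lra.
Qed.

Lemma dotF_CS m n (A B : 'M[R]_(m, n)) : dotF A B ^+ 2 <= sqF A * sqF B.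
Proof.
have [B0|B0] := eqVneq (sqF B) 0.
  by rewrite (sqF_eq0 B0) sqF0 dotF_tr mulmx0 mxtrace0 expr0n mulr0.
have Bp : 0 < sqF B by rewrite lt_def B0 sqF_ge0.
have := sqF_ge0 (sqF B *: A + (- dotF A B) *: B).
rewrite sqFD !sqFZ dotFZl dotFZr sqrrN => h.
rewrite -(ler_pM2l Bp) -subr_ge0; apply: le_trans h _.
by rewrite le_eqVlt; apply/orP; left; apply/eqP; ring.
Qed.

(** The common factor [s] is the squared norm of a vector when this serves as the
    triangle inequality for operator norms. *)
Lemma sqF_triangle m n (A B : 'M[R]_(m, n)) (a b s : R) :
  0 <= a -> 0 <= b -> 0 <= s ->
  sqF A <= a ^+ 2 * s -> sqF B <= b ^+ 2 * s -> sqF (A - B) <= (a + b) ^+ 2 * s.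
Proof.
move=> a0 b0 s0 hA hB; rewrite sqFD sqFN dotFNr.
suff : - dotF A B <= a * b * s by move=> h; lra.
have ab0 : 0 <= a * b * s by rewrite !mulr_ge0.
apply: le_trans (ler_norm _) _; rewrite normrN.
rewrite -(@ler_pXn2r _ 2) ?nnegrE // real_normK ?num_real //.
apply: le_trans (dotF_CS A B) _.
have -> : (a * b * s) ^+ 2 = (a ^+ 2 * s) * (b ^+ 2 * s) by ring.
by apply: ler_pM => //; exact: sqF_ge0.
Qed.

Lemma sqF_cols m n (A : 'M[R]_(m, n)) : sqF A = \sum_j sqF (col j A).
Proof.
rewrite sqFE exchange_big; apply: eq_bigr => j _; rewrite sqFE.
by apply: eq_bigr => i _; rewrite big_ord1 mxE.
Qed.

Lemma sqF_mul m n k (A : 'M[R]_(m, n)) (B : 'M[R]_(n, k)) :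
  sqF (A *m B) <= sqF A * sqF B.
Proof.
have ent i j : (A *m B) i j = dotF (row i A)^T (col j B).
  by rewrite mxE /dotF; apply: eq_bigr => l _; rewrite big_ord1 !mxE.
rewrite [X in X <= _]sqFE (sqF_cols B) -(sqF_trmx A) (sqF_cols A^T) mulr_suml.
apply: ler_sum => i _; rewrite mulr_sumr; apply: ler_sum => j _.
by rewrite ent; apply: le_trans (dotF_CS _ _) _; rewrite tr_row.
Qed.

Lemma sqF_iso m n k (U : 'M[R]_(m, n)) (A : 'M[R]_(n, k)) :
  U^T *m U = 1%:M -> sqF (U *m A) = sqF A.
Proof. by move=> hU; rewrite /sqF dotF_mull mulmxA hU mul1mx. Qed.

Lemma sqF_pythag m n k (U : 'M[R]_(m, n)) (A : 'M[R]_(m, k)) :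
  U^T *m U = 1%:M -> sqF A = sqF (A - U *m (U^T *m A)) + sqF (U^T *m A).
Proof.
move=> hU; have h0 : dotF (A - U *m (U^T *m A)) (U *m (U^T *m A)) = 0.
  rewrite dotFC dotF_mull mulmxBr [U^T *m (U *m _)]mulmxA hU mul1mx subrr.
  by rewrite dotF_tr mulmx0 mxtrace0.
rewrite -[X in sqF X = _](subrK (U *m (U^T *m A)) A) [LHS]sqFD h0 mulr0 addr0.
by rewrite sqF_iso.
Qed.

Lemma sqF_orthC m n k (U : 'M[R]_(m, n)) (A : 'M[R]_(m, k)) :
  U^T *m U = 1%:M -> sqF (A - U *m (U^T *m A)) <= sqF A.
Proof. by move=> hU; rewrite [X in _ <= X](sqF_pythag A hU) lerDl sqF_ge0. Qed.

(** When [L] has orthonormal columns, [a] is a lower bound for the squared cosine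
    of the angle between its span and the column space of [F]. Quantifying over
    the vectors [F *m x], and not over the coordinates in a basis of the column
    space, keeps the notion meaningful when [F] has a smaller rank than expected,
    which happens when the noise level is zero. *)
Definition captures m n r (a : R) (F : 'M[R]_(m, n)) (L : 'M[R]_(m, r)) : Prop :=
  forall x : 'M[R]_(n, 1), a * sqF (F *m x) <= sqF (L^T *m F *m x).

Lemma captures_mx m n r k (a : R) (F : 'M[R]_(m, n)) (L : 'M[R]_(m, r))
    (B : 'M[R]_(n, k)) :
  captures a F L -> a * sqF (F *m B) <= sqF (L^T *m F *m B).
Proof.
move=> h; rewrite !(sqF_cols (_ *m B)) mulr_sumr; apply: ler_sum => j _.
by have := h (B *m delta_mx j 0); rewrite !colE -!mulmxA.
Qed.

Lemma capturesW m n r (a b : R) (F : 'M[R]_(m, n)) (L : 'M[R]_(m, r)) :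
  a <= b -> captures b F L -> captures a F L.
Proof.
by move=> ab h x; apply: le_trans (h x); rewrite ler_wpM2r ?sqF_ge0.
Qed.

(** Pythagoras, three times: what [K *m U] misses is what [K] misses, plus the
    orthogonal part that [U] misses inside the span of [K]. *)
Lemma proj_err_step m n r s (F : 'M[R]_(m, n)) (K : 'M[R]_(m, r)) (U : 'M[R]_(r, s)) :
  K^T *m K = 1%:M -> U^T *m U = 1%:M ->
  sqF (F - (K *m U) *m ((K *m U)^T *m F)) =
  sqF (F - K *m (K^T *m F)) + sqF (K^T *m F - U *m (U^T *m (K^T *m F))).
Proof.
move=> hK hU.
have hKU : (K *m U)^T *m (K *m U) = 1%:M.
  by rewrite trmx_mul mulmxA -(mulmxA U^T) hK mulmx1 hU.
have e1 := sqF_pythag F hKU; have e2 := sqF_pythag F hK.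
have e3 := sqF_pythag (K^T *m F) hU.
have e4 : U^T *m (K^T *m F) = (K *m U)^T *m F by rewrite trmx_mul mulmxA.
by rewrite e4 in e3 *; lra.
Qed.

(** The squared norm of [K^T *m F *m x] splits into the part along [U] and the
    residual. The residual is small with respect to [x], hence with respect to
    [F *m x] once [x] is exchanged for a preimage on which [F] expands. *)
Lemma captures_step m n r s (a lam2 delta : R) (F : 'M[R]_(m, n))
    (K : 'M[R]_(m, r)) (U : 'M[R]_(r, s)) :
  0 <= delta ->
  U^T *m U = 1%:M -> captures a F K ->
  (forall x : 'M[R]_(n, 1), exists2 x', F *m x' = F *m x &
     lam2 * sqF x' <= sqF (F *m x')) ->
  (forall x : 'M[R]_(n, 1),
     sqF ((K^T *m F - U *m (U^T *m (K^T *m F))) *m x) <= delta * lam2 * sqF x) ->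
  captures (a - delta) F (K *m U).
Proof.
move=> d0 hU hK hG hE x; have [x' ex' lx'] := hG x.
rewrite -mulmxA -ex' mulmxA.
have := sqF_pythag (K^T *m F *m x') hU.
have := hE x'; have := hK x'.
rewrite mulmxBl !mulmxA trmx_mul => h1 h2 h3.
have := ler_wpM2l d0 lx'; rewrite -?mulmxA in h1 h2 h3 *; rewrite mulrA; lra.
Qed.

End Frobenius.

(** * Singular value decompositions *)

Section SVD.
Variable R : realType.

Definition diagmx m n (t : nat -> R) : 'M[R]_(m, n) :=
  \matrix_(i < m, j < n) (t i *+ (i == j :> nat)).

Lemma sqr_sum_delta n (i : nat) (f : R) (y : 'I_n -> R) :
  (\sum_(j < n) (f *+ (i == j :> nat)) * y j) ^+ 2 =
  \sum_(j < n) (f ^+ 2 *+ (i == j :> nat)) * y j ^+ 2.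
Proof.
have [ltin|] := ltnP i n; last first.
  move=> ni.
  have z (j : 'I_n) : (i == j :> nat) = false.
    by apply/negbTE; rewrite neq_ltn (leq_trans (ltn_ord j) ni) orbT.
  by rewrite !big1 ?expr0n // => j _; rewrite z mulr0n mul0r.
rewrite (bigD1 (Ordinal ltin)) //= big1 ?addr0; last first.
  by move=> j; rewrite -(inj_eq val_inj) /= eq_sym => /negbTE ->; rewrite mulr0n mul0r.
rewrite (bigD1 (Ordinal ltin)) //= big1 ?addr0; last first.
  by move=> j; rewrite -(inj_eq val_inj) /= eq_sym => /negbTE ->; rewrite mulr0n mul0r.
by rewrite !eqxx !mulr1n exprMn.
Qed.

(** Stated for a sequence [t] that vanishes beyond the number of rows, so that
    the sum may run over all columns whichever dimension is larger. *)
Lemma sqF_diagmx m n (t : nat -> R) (y : 'M[R]_(n, 1)) :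
  (forall i, (m <= i)%N -> t i = 0) ->
  sqF (diagmx m n t *m y) = \sum_(j < n) t j ^+ 2 * y j 0 ^+ 2.
Proof.
move=> t0; rewrite sqFE.
under eq_bigr => i _.
  rewrite big_ord1 mxE.
  under eq_bigr => j _ do rewrite mxE.
  rewrite sqr_sum_delta; over.
rewrite exchange_big; apply: eq_bigr => j _ /=.
rewrite -mulr_suml; congr (_ * _).
have [jm|mj] := ltnP j m; last first.
  rewrite t0 // expr0n big1 // => i _.
  by rewrite (_ : (i == j :> nat) =
    false) // -[LHS]negbK neq_ltn (leq_trans (ltn_ord i) mj).
rewrite (bigD1 (Ordinal jm)) //= eqxx mulr1n big1 ?addr0 //.
by move=> i; rewrite -(inj_eq val_inj) /= => /negbTE ->.
Qed.

Lemma sqFE1 n (y : 'M[R]_(n, 1)) : sqF y = \sum_(j < n) y j 0 ^+ 2.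
Proof. by rewrite sqFE; apply: eq_bigr => i _; rewrite big_ord1. Qed.

Lemma is_svd_tr m n (A : 'M[R]_(m, n)) U s V :
  is_svd A U s V -> is_svd A^T V s U.
Proof.
move=> [[hU hV] h1 h2 h3 hA]; split => //; first by rewrite minnC.
rewrite [in LHS]hA !trmx_mul trmxK mulmxA; congr (mulmx (mulmx _ _) _).
apply/matrixP => i j; rewrite !mxE eq_sym.
by case: eqP => // ->.
Qed.

Lemma pid_orth m r (U : 'M[R]_m) : (r <= m)%N ->
  U^T *m U = 1%:M -> (U *m (pid_mx r : 'M[R]_(m, r)))^T *m (U *m pid_mx r) = 1%:M.
Proof.
move=> rm hU; rewrite trmx_mul mulmxA -(mulmxA _ U^T) hU mulmx1 tr_pid_mx.
by rewrite mul_pid_mx minnn (minn_idPr rm) pid_mx_1.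
Qed.

Lemma SVDL_orth m n r (A : 'M[R]_(m, n)) (W : 'M[R]_(m, r)) :
  (r <= m)%N -> is_SVDL A W -> W^T *m W = 1%:M.
Proof. by move=> rm [U [s [V [[[hU _] _ _ _ _] ->]]]]; exact: pid_orth. Qed.

Lemma SVDR_SVDL m n r (A : 'M[R]_(m, n)) (W : 'M[R]_(n, r)) :
  is_SVDR A W -> is_SVDL A^T W.
Proof. by move=> [U [s [V [h ->]]]]; exists V, s, U; split => //; exact: is_svd_tr. Qed.

(** Singular values are numbered from 0, so that [s r] is the largest one left
    after removing the [r] leading directions. *)
Lemma svd_tail m n r (A : 'M[R]_(m, n)) U s V (x : 'M[R]_(n, 1)) :
  is_svd A U s V ->
  let W := U *m (pid_mx r : 'M[R]_(m, r)) in
  sqF ((A - W *m (W^T *m A)) *m x) <= s r ^+ 2 * sqF x.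
Proof.
move=> [[hU hV] smon s0 sz hA] /=.
pose t i : R := if (i < r)%N then 0 else s i.
have tz i : (m <= i)%N -> t i = 0.
  by rewrite /t; case: ifP => // _ mi; apply: sz; rewrite geq_min mi.
have E : A - U *m (pid_mx r : 'M[R]_(m, r)) *m
      ((U *m (pid_mx r : 'M[R]_(m, r)))^T *m A) =
    U *m (diagmx m n t *m V^T).
  rewrite trmx_mul tr_pid_mx [in X in _ - X]hA !mulmxA.
  rewrite -(mulmxA _ U^T U) hU mulmx1 -(mulmxA U (pid_mx r)) mul_pid_mx minnn.
  rewrite [in LHS]hA -!mulmxA -mulmxBr mulmxA -mulmxBl; congr (mulmx _ (mulmx _ _)).
  apply/matrixP => i j; rewrite !mxE (bigD1 i) //= big1 ?addr0; last first.
    move=> k ki; rewrite [pid_mx _ _ _]mxE (_ : (i == k :> nat) = false) ?mul0r //.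
    by apply/negbTE; rewrite eq_sym.
  rewrite !mxE eqxx /= /t; rewrite minnn; case: ifP => _; last by rewrite mul0r subr0.
  by rewrite mul1r subrr mul0rn.
rewrite E -mulmxA sqF_iso // -mulmxA sqF_diagmx //.
have hVV : V *m V^T = 1%:M by apply: mulmx1C.
have -> : sqF x = sqF (V^T *m x) by rewrite sqF_iso // trmxK.
rewrite sqFE1 mulr_sumr; apply: ler_sum => j _.
apply: ler_wpM2r; first exact: sqr_ge0.
rewrite /t; case: ltnP => rj; first by rewrite expr0n sqr_ge0.
by rewrite ler_sqr ?nnegrE //; exact: smon.
Qed.

(** From the first backward update on, each matrix decomposed by the algorithm
    has as many columns as singular vectors are kept. The projected data
    therefore leave no residual at all. *)
Lemma SVDL_exact m r (A : 'M[R]_(m, r)) (W : 'M[R]_(m, r)) :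
  is_SVDL A W -> A - W *m (W^T *m A) = 0.
Proof.
move=> [U [s [V [h ->]]]]; apply: sqF_eq0; apply/eqP; rewrite eq_le sqF_ge0 andbT.
rewrite sqF_cols big1 // => j _; apply/eqP; rewrite eq_le sqF_ge0 andbT colE.
apply: le_trans (svd_tail r _ h) _.
by case: h => _ _ _ -> //; rewrite ?expr0n ?mul0r // geq_min leqnn orbT.
Qed.

Lemma ker_vec m k (B : 'M[R]_(m, k)) : (\rank B < k)%N ->
  exists2 y : 'M[R]_(k, 1), y != 0 & B *m y = 0.
Proof.
move=> rk; have : kermx B^T != 0.
  rewrite -mxrank_eq0 mxrank_ker mxrank_tr -lt0n; lia.
case/rowV0Pn => v /sub_kermxP hv v0; exists v^T; last first.
  by apply: trmx_inj; rewrite trmx_mul trmxK hv trmx0.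
by apply: contra v0 => /eqP/(congr1 trmx); rewrite trmxK trmx0 => ->.
Qed.

(** For dimension reasons some combination of the [r.+1] leading right singular
    vectors of [M] lies in the kernel of [A]; [M] expands it by at least [s r],
    while [M - A] acts on it as [M]. *)
Lemma svd_weyl m n r (M A : 'M[R]_(m, n)) U s V (eta2 : R) :
  is_svd M U s V -> (\rank A <= r)%N -> 0 <= eta2 ->
  (forall x : 'M[R]_(n, 1), sqF ((M - A) *m x) <= eta2 * sqF x) ->
  s r ^+ 2 <= eta2.
Proof.
move=> [[hU hV] smon s0 sz hM] rA e0 hE.
have [le|] := leqP (minn m n) r; first by rewrite sz // expr0n.
rewrite leq_min => /andP[rm rn].
pose W := V *m (pid_mx r.+1 : 'M[R]_(n, r.+1)).
have hW : W^T *m W = 1%:M by exact: pid_orth.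
have [|y y0 hy] := @ker_vec m r.+1 (A *m W).
  by rewrite ltnS (leq_trans (mxrankM_maxl _ _)).
have yp : 0 < sqF y.
  rewrite lt_def sqF_ge0 andbT; apply: contra y0 => /eqP h; apply/eqP.
  exact: sqF_eq0.
rewrite -(ler_pM2r yp) -[X in _ <= _ * X](@sqF_iso _ _ _ _ W) //.
apply: le_trans (hE _); rewrite mulmxBl [A *m _]mulmxA hy subr0 hM -!mulmxA sqF_iso //.
rewrite [V^T *m _]mulmxA hV mul1mx sqF_diagmx; last first.
  by move=> i mi; apply: sz; rewrite geq_min mi.
have yE (j : 'I_r.+1) : (pid_mx r.+1 *m y : 'M[R]_(n, 1)) (widen_ord rn j) 0 = y j 0.
  rewrite mxE (bigD1 j) //= [pid_mx _ _ _]mxE /= eqxx ltn_ord mul1r big1 ?addr0 //.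
  move=> k ki; rewrite [pid_mx _ _ _]mxE /= (_ : (j == k :> nat) = false) ?mul0r //.
  by apply/negbTE; rewrite eq_sym.
rewrite sqFE1 mulr_sumr.
pose G k : R := if insub k is Some j then s k ^+ 2 * (pid_mx r.+1 *m y : 'M[R]_(n,1)) j
  0 ^+ 2 else 0.
have -> : \sum_(j < n) s j ^+ 2 * (pid_mx r.+1 *m y : 'M[R]_(n, 1)) j 0 ^+ 2 =
    \sum_(j < n) G j.
  by apply: eq_bigr => j _; rewrite /G valK.
rewrite -(big_mkord xpredT G) (big_cat_nat (n := r.+1)) //= big_mkord.
apply: ler_wpDr.
  apply: sumr_ge0 => k _; rewrite /G; case: insubP => // j _ _.
  by rewrite mulr_ge0 ?sqr_ge0.
apply: ler_sum => j _; have -> : G j = s j ^+ 2 * y j 0 ^+ 2.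
  by rewrite /G -(yE j) (_ : nat_of_ord j = widen_ord rn j) // valK.
by apply: ler_wpM2r; [exact: sqr_ge0|rewrite ler_sqr ?nnegrE // smon // -ltnS].
Qed.

(** By [svd_weyl] with [M = A = F] all singular values from the index [r] on
    vanish, so the components of [x] along the corresponding right singular
    vectors can be dropped without changing [F *m x]. *)
Lemma svd_gap m n r (F : 'M[R]_(m, n)) U s V :
  is_svd F U s V -> (0 < r)%N -> (\rank F <= r)%N ->
  forall x : 'M[R]_(n, 1), exists2 x', F *m x' = F *m x &
    s r.-1 ^+ 2 * sqF x' <= sqF (F *m x').
Proof.
move=> h r0 rF x.
have sr : s r = 0.
  have := @svd_weyl _ _ r F F U s V 0 h rF (lexx _).
  move=> /(_ (fun x => _)); rewrite subrr => H.
  have /H : forall x0 : 'M[R]_(n, 1), sqF ((0 : 'M[R]_(m,n)) *m x0) <= 0 * sqF x0.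
    by move=> x0; rewrite mul0mx sqF0 mul0r.
  by move=> h0; apply/eqP; rewrite -sqrf_eq0 eq_le h0 sqr_ge0.
case: h => [[hU hV] smon s0 sz hF].
have sz' i : (r <= i)%N -> s i = 0.
  by move=> /smon; rewrite sr => h0; apply/eqP; rewrite eq_le h0 s0.
have szm i : (m <= i)%N -> s i = 0 by move=> mi; apply: sz; rewrite geq_min mi.
pose y : 'M[R]_(n, 1) := \matrix_(i, j) (if (i < r)%N then (V^T *m x) i j else 0).
have Dy : diagmx m n s *m y = diagmx m n s *m (V^T *m x).
  apply/matrixP => i k; rewrite !mxE; apply: eq_bigr => j _.
  rewrite !mxE; case: eqP => [ij|_]; last by rewrite !mulr0n !mul0r.
  by case: ltnP => // rj; rewrite ij (sz' j rj) !mulr1n !mul0r.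
have hFy : F *m (V *m y) = U *m (diagmx m n s *m y).
  by rewrite [F in LHS]hF -!mulmxA [V^T *m _]mulmxA hV mul1mx.
exists (V *m y); first by rewrite hFy Dy [F in RHS]hF -!mulmxA.
rewrite hFy (sqF_iso _ hV) (sqF_iso _ hU) sqF_diagmx // sqFE1 mulr_sumr;
  apply: ler_sum => j _.
rewrite mxE; case: ltnP => jr; last by rewrite expr0n !mulr0.
apply: ler_wpM2r; first exact: sqr_ge0.
by rewrite ler_sqr ?nnegrE // smon // -ltnS prednK.
Qed.

End SVD.

(** * Reshapings and Kronecker products *)

Section Reshape.
Variable R : realType.

Lemma sum_mxtens (V : nmodType) m n (F : 'I_(m * n) -> V) :
  \sum_k F k = \sum_i \sum_j F (mxtens_index (i, j)).
Proof.
rewrite pair_bigA /= (reindex (@mxtens_index m n)) /=; last first.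
  exists (@mxtens_unindex m n) => k _; [exact: mxtens_indexK|exact: mxtens_unindexK].
by apply: eq_bigr => -[].
Qed.

(** Reshapings are exactly the operations that preserve this sequence, which
    turns identities between them into arithmetic on positions. *)
Definition mxcolmajor m n (A : 'M[R]_(m, n)) (l : nat) : R :=
  \sum_(u : 'I_m * 'I_n | (u.1 + u.2 * m == l)%N) A u.1 u.2.

Lemma mxcolmajorE m n (A : 'M[R]_(m, n)) (a : 'I_m) (b : 'I_n) :
  mxcolmajor A (a + b * m) = A a b.
Proof.
rewrite /mxcolmajor (big_pred1 (a, b)) // => -[u v] /=.
by rewrite digits_inj // xpair_eqE -!(inj_eq val_inj).
Qed.

Lemma mxreshapeE m n m' n' (A : 'M[R]_(m, n)) (a : 'I_m') (b : 'I_n') :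
  mxreshape A a b = mxcolmajor A (a + b * m').
Proof. by rewrite mxE. Qed.

Lemma digits_split m n l : (l < m * n)%N ->
  exists (a : 'I_m) (b : 'I_n), l = (a + b * m)%N.
Proof.
move=> lmn; have m0 : (0 < m)%N by case: m lmn => //; rewrite mul0n ltn0.
have h : (l %/ m < n)%N by rewrite ltn_divLR // mulnC.
by exists (Ordinal (ltn_pmod l m0)), (Ordinal h); rewrite /= addnC -divn_eq.
Qed.

Lemma mxcolmajor_reshape m n m' n' (A : 'M[R]_(m, n)) l : (l < m' * n')%N ->
  mxcolmajor (mxreshape A : 'M[R]_(m', n')) l = mxcolmajor A l.
Proof. by case/digits_split => a [b ->]; rewrite mxcolmajorE mxreshapeE. Qed.

Lemma mxreshape_comp m n m1 n1 m' n' (A : 'M[R]_(m, n)) :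
  (m1 * n1 = m' * n')%N ->
  mxreshape (mxreshape A : 'M[R]_(m1, n1)) = mxreshape A :> 'M[R]_(m', n').
Proof.
move=> e; apply/matrixP => a b; rewrite !mxreshapeE mxcolmajor_reshape // e.
by have := ltn_ord (mxtens_index (b, a)); rewrite /= mulnC addnC (mulnC n').
Qed.

Lemma sum_mxcolmajor m n (A : 'M[R]_(m, n)) (V : nmodType) (G : R -> V) :
  \sum_i \sum_j G (A i j) = \sum_(l < m * n) G (mxcolmajor A l).
Proof.
rewrite exchange_big -(big_mkord xpredT (fun l => G (mxcolmajor A l))) mulnC big_mkord.
rewrite sum_mxtens; apply: eq_bigr => j _; apply: eq_bigr => i _ /=.
by rewrite addnC mxcolmajorE.
Qed.

Lemma sqF_mxcolmajor m n (A : 'M[R]_(m, n)) :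
  sqF A = \sum_(l < m * n) mxcolmajor A l ^+ 2.
Proof. by rewrite sqFE -(sum_mxcolmajor A (fun x => x ^+ 2)). Qed.

Lemma sqF_reshape m n m' n' (A : 'M[R]_(m, n)) : (m * n = m' * n')%N ->
  sqF (mxreshape A : 'M[R]_(m', n')) = sqF A.
Proof.
move=> e; rewrite !sqF_mxcolmajor -(big_mkord xpredT (fun l =>
  mxcolmajor A l ^+ 2)) e big_mkord.
by apply: eq_bigr => l _; rewrite mxcolmajor_reshape.
Qed.

Lemma mxreshapeD m n m' n' (A B : 'M[R]_(m, n)) :
  mxreshape (A + B) = mxreshape A + mxreshape B :> 'M[R]_(m', n').
Proof.
by apply/matrixP => a b; rewrite !mxE -big_split; apply: eq_bigr => u _; rewrite mxE.
Qed.

Lemma mxreshapeZ m n m' n' (c : R) (A : 'M[R]_(m, n)) :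
  mxreshape (c *: A) = c *: mxreshape A :> 'M[R]_(m', n').
Proof.
by apply/matrixP => a b; rewrite !mxE mulr_sumr; apply: eq_bigr => u _; rewrite mxE.
Qed.

Lemma mxreshapeB m n m' n' (A B : 'M[R]_(m, n)) :
  mxreshape (A - B) = mxreshape A - mxreshape B :> 'M[R]_(m', n').
Proof. by rewrite mxreshapeD -scaleN1r mxreshapeZ scaleN1r. Qed.

(** Dimensions such as [dimprod p 1 k.+1] and [p k.+1 * dimprod p 1 k] are equal
    but not convertible. The lemmas below treat [mxreshape] between equal sizes
    as a cast; they are proved by substituting one size for the other. *)
Lemma cast_mull m m' n k (A : 'M[R]_(m, n)) (B : 'M[R]_(n, k)) : m = m' ->
  (mxreshape A : 'M[R]_(m', n)) *m B = mxreshape (A *m B).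
Proof. by move=> e; case: _ / e; rewrite !mxreshape_id. Qed.

Lemma cast_mulr m n n' k (A : 'M[R]_(m, n)) (B : 'M[R]_(k, m)) : n = n' ->
  B *m (mxreshape A : 'M[R]_(m, n')) = mxreshape (B *m A).
Proof. by move=> e; case: _ / e; rewrite !mxreshape_id. Qed.

Lemma cast_trmul m m' n k (A : 'M[R]_(m, n)) (B : 'M[R]_(m, k)) : m = m' ->
  (mxreshape A : 'M[R]_(m', n))^T *m (mxreshape B : 'M[R]_(m', k)) = A^T *m B.
Proof. by move=> e; case: _ / e; rewrite !mxreshape_id. Qed.

Lemma cast_tr m m' n n' (A : 'M[R]_(m, n)) : m = m' -> n = n' ->
  (mxreshape A : 'M[R]_(m', n'))^T = mxreshape A^T.
Proof. by move=> e e'; case: _ / e; case: _ / e'; rewrite !mxreshape_id. Qed.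

Lemma cast_rank m m' n n' (A : 'M[R]_(m, n)) : m = m' -> n = n' ->
  \rank (mxreshape A : 'M[R]_(m', n')) = \rank A.
Proof. by move=> e e'; case: _ / e; case: _ / e'; rewrite !mxreshape_id. Qed.

Lemma const1_mul m r n (B : 'M[R]_(m, n)) : m = 1%N -> r = 1%N ->
  (const_mx 1 : 'M[R]_(r, m)) *m B = mxreshape B.
Proof.
move=> m1 r1; subst m r; rewrite mxreshape_id.
by apply/matrixP => i j; rewrite !mxE big_ord1 mxE mul1r !ord1.
Qed.

(** This is how compressing an unfolding on the left and then reshaping it
    amounts to compressing the next unfolding. *)
Lemma reshape_mull q m n r (A : 'M[R]_(r, m)) (B : 'M[R]_(m, n * q)) :
  (mxreshape (A *m B) : 'M[R]_(q * r, n)) =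
  ((1%:M : 'M[R]_q) *t A) *m (mxreshape B : 'M[R]_(q * m, n)).
Proof.
apply/matrixP => k c; case: (mxtens_indexP k) => i b.
rewrite mxreshape_split !mxE sum_mxtens (bigD1 i) //= [X in _ + X]big1 ?addr0.
  by apply: eq_bigr => a _; rewrite tensmxE mxreshape_split mxE eqxx mul1r.
move=> j ji; rewrite big1 // => a _.
by rewrite tensmxE mxE eq_sym (negbTE ji) !mul0r.
Qed.

Lemma reshape_mulr q m n s (H : 'M[R]_(m, n * q)) (Q : 'M[R]_(n, s)) :
  (mxreshape (H *m (Q *t (1%:M : 'M[R]_q))) : 'M[R]_(q * m, s)) =
  (mxreshape H : 'M[R]_(q * m, n)) *m Q.
Proof.
apply/matrixP => k c; case: (mxtens_indexP k) => i a.
rewrite mxreshape_split !mxE sum_mxtens; apply: eq_bigr => b _.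
rewrite (bigD1 i) //= [X in _ + X]big1 ?addr0.
  by rewrite tensmxE mxreshape_split mxE eqxx mulr1.
move=> j ji; by rewrite tensmxE mxE (negbTE ji) !mulr0.
Qed.

Lemma tens11 m n : (1%:M : 'M[R]_m) *t (1%:M : 'M[R]_n) = 1%:M.
Proof.
apply/matrixP => i j; case: (mxtens_indexP i) => a b; case: (mxtens_indexP j) => a' b'.
rewrite tensmxE !mxE (inj_eq (can_inj (@mxtens_indexK m n))) xpair_eqE.
by case: eqP => _; rewrite ?mul0r ?mul1r.
Qed.

Lemma tens1_orth q m r (L : 'M[R]_(m, r)) : L^T *m L = 1%:M ->
  ((1%:M : 'M[R]_q) *t L)^T *m ((1%:M : 'M[R]_q) *t L) = 1%:M.
Proof. by move=> hL; rewrite trmx_tens tensmx_mul hL trmx1 mulmx1 tens11. Qed.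

Lemma tensr1_orth q m r (L : 'M[R]_(m, r)) : L^T *m L = 1%:M ->
  (L *t (1%:M : 'M[R]_q))^T *m (L *t (1%:M : 'M[R]_q)) = 1%:M.
Proof. by move=> hL; rewrite trmx_tens tensmx_mul hL trmx1 mulmx1 tens11. Qed.

Lemma sqF_reshape_mulr q m n s (H : 'M[R]_(m, n * q)) (Q : 'M[R]_(n, s)) :
  sqF ((mxreshape H : 'M[R]_(q * m, n)) *m Q) = sqF (H *m (Q *t (1%:M : 'M[R]_q))).
Proof. by rewrite -reshape_mulr sqF_reshape //; ring. Qed.

Lemma sqF_reshape_mull q m n r (A : 'M[R]_(r, m)) (B : 'M[R]_(m, n * q)) :
  sqF (((1%:M : 'M[R]_q) *t A) *m (mxreshape B : 'M[R]_(q * m, n))) = sqF (A *m B).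
Proof. by rewrite -reshape_mull sqF_reshape //; ring. Qed.

(** A column of the reshaped matrix is a stack of [q] vectors of the column
    space of [F], on which the Kronecker product acts separately; by
    [reshape_mulr] this is the matrix form of the hypothesis. *)
Lemma captures_reshape q m n r a (F : 'M[R]_(m, n * q)) (L : 'M[R]_(m, r)) :
  captures a F L ->
  captures a (mxreshape F : 'M[R]_(q * m, n)) ((1%:M : 'M[R]_q) *t L).
Proof.
move=> h x; have := captures_mx (x *t (1%:M : 'M[R]_q)) h.
by rewrite -!sqF_reshape_mulr reshape_mull trmx_tens trmx1.
Qed.

Lemma captures_reshapeT q m n s a (H : 'M[R]_(q * m, n)) (Q : 'M[R]_(n, s)) :
  captures a H^T Q ->
  captures a (mxreshape H : 'M[R]_(m, n * q))^T (Q *t (1%:M : 'M[R]_q)).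
Proof.
move=> h x; set H' := mxreshape H.
have HH : mxreshape H' = H by rewrite mxreshape_comp ?mxreshape_id //; ring.
have e1 : sqF (H'^T *m x) = sqF (H^T *m ((1%:M : 'M[R]_q) *t x^T)^T).
  rewrite -sqF_trmx trmx_mul trmxK -(sqF_reshape_mull x^T H') HH.
  by rewrite -sqF_trmx trmx_mul.
have e2 : sqF ((Q *t (1%:M : 'M[R]_q))^T *m H'^T *m x) =
    sqF (Q^T *m H^T *m ((1%:M : 'M[R]_q) *t x^T)^T).
  rewrite -sqF_trmx !trmx_mul !trmxK mulmxA -sqF_reshape_mulr reshape_mull HH.
  by rewrite -sqF_trmx !trmx_mul mulmxA.
by rewrite e1 e2; exact: captures_mx.
Qed.

Lemma captures_cast m m' n n' r a (F : 'M[R]_(m, n)) (L : 'M[R]_(m, r)) :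
  m = m' -> n = n' -> captures a F L ->
  captures a (mxreshape F : 'M[R]_(m', n')) (mxreshape L : 'M[R]_(m', r)).
Proof.
by move=> e e' h; subst m' n'; rewrite !mxreshape_id.
Qed.

Lemma captures_castF m n n' r a (F : 'M[R]_(m, n)) (L : 'M[R]_(m, r)) :
  n = n' -> captures a F L -> captures a (mxreshape F : 'M[R]_(m, n')) L.
Proof. by move=> e' h; subst n'; rewrite mxreshape_id. Qed.

End Reshape.

(** * Unfoldings in column-major order *)

Section Unfold.
Variables (R : realType) (d : nat) (p : nat -> nat).
Implicit Types X Y : tensor R d p.

(** The common position of an entry in all unfoldings: by [colmajor_indexE],
    unfoldings differ only in where this number is cut into row and column. *)
Definition colmajor_index (i : tindex d p) : nat := unfold_row d i.

Lemma dimprod_recr a b : (a <= b.+1)%N -> dimprod p a b.+1 = (p b.+1 * dimprod p a b)%N.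
Proof. by move=> ab; rewrite /dimprod big_nat_recr //= mulnC. Qed.

Lemma dimprod_recl a b : (a <= b)%N -> dimprod p a b = (dimprod p a.+1 b * p a)%N.
Proof. by move=> ab; rewrite /dimprod big_nat_recl //= mulnC big_add1. Qed.

Lemma dimprod_cat k b : (k <= b)%N ->
  (dimprod p 1 k * dimprod p k.+1 b)%N = dimprod p 1 b.
Proof. by move=> kb; rewrite /dimprod -big_cat_nat. Qed.

Let dig (u : tindex d p) (n : nat) : nat :=
  if insub n is Some j then u j else 0%N.

Let digE u (j : 'I_d) : dig u j = u j.
Proof. by rewrite /dig valK. Qed.

Let dig_lt u j : (j < d)%N -> (dig u j < p j.+1)%N.
Proof. by move=> jd; rewrite (digE u (Ordinal jd)) (ltn_ord (u (Ordinal jd))). Qed.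

Let rowE k u : (k <= d)%N ->
  unfold_row k u = (\sum_(0 <= j < k) dig u j * dimprod p 1 j)%N.
Proof.
move=> kd; rewrite /unfold_row (big_nat_widen _ _ d) // big_mkord.
by apply: eq_bigr => j _; rewrite digE.
Qed.

Let colE k u : (k <= d)%N ->
  unfold_col k u = (\sum_(k <= j < d) dig u j * dimprod p k.+1 j)%N.
Proof.
move=> kd; rewrite /unfold_col big_geq_mkord.
by apply: eq_bigr => j _; rewrite digE.
Qed.

Lemma colmajor_indexE k (i : tindex d p) : (k <= d)%N ->
  colmajor_index i = (unfold_row k i + unfold_col k i * dimprod p 1 k)%N.
Proof.
move=> kd; rewrite /colmajor_index !rowE // colE // (big_cat_nat (n := k)) //=;
  congr addn.
rewrite big_distrl /= big_nat [RHS]big_nat; apply: eq_bigr => j /andP[kj _].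
by rewrite -mulnA (mulnC _ (dimprod p 1 k)) dimprod_cat.
Qed.

Lemma row_lt k (i : tindex d p) : (k <= d)%N -> (unfold_row k i < dimprod p 1 k)%N.
Proof.
move=> kd; rewrite rowE //; apply: radix_lt => // j /andP[_ jk].
by apply: dig_lt; exact: leq_trans jk kd.
Qed.

Lemma colmajor_index_lt i : (colmajor_index i < dimprod p 1 d)%N.
Proof. exact: row_lt. Qed.

Lemma colmajor_index_inj : injective colmajor_index.
Proof.
move=> i i' e; apply/ffunP => j; apply: val_inj; rewrite /= -!digE.
apply: (@radix_inj p _ _ 0 d) => [l /andP[_ /dig_lt]|l /andP[_ /dig_lt]||] //.
  by rewrite -!rowE.
by rewrite ltn_ord.
Qed.

Definition colmajor X (l : nat) : R := \sum_(i | colmajor_index i == l) X i.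

Lemma unfolding_colmajor k X a b : (k <= d)%N ->
  unfolding k X a b = colmajor X (a + b * dimprod p 1 k).
Proof.
move=> kd; rewrite mxE; apply: eq_bigl => i.
by rewrite (colmajor_indexE i kd) digits_inj // row_lt.
Qed.

Lemma mxcolmajor_unfolding k X l : (k <= d)%N -> (l < dimprod p 1 d)%N ->
  mxcolmajor (unfolding k X) l = colmajor X l.
Proof.
move=> kd; rewrite -(dimprod_cat kd) => /digits_split[a [b ->]].
by rewrite mxcolmajorE unfolding_colmajor.
Qed.

Lemma reshape_unfolding_colmajor k X m n a b : (k <= d)%N ->
  (m * n = dimprod p 1 d)%N ->
  (mxreshape (unfolding k X) : 'M[R]_(m, n)) a b = colmajor X (a + b * m).
Proof.
move=> kd e; rewrite mxreshapeE mxcolmajor_unfolding // -e.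
by have := ltn_ord (mxtens_index (b, a)); rewrite /= mulnC addnC (mulnC n).
Qed.

Lemma reshape_unfolding k k' X m n : (k <= d)%N -> (k' <= d)%N ->
  (m * n = dimprod p 1 d)%N ->
  mxreshape (unfolding k X) = mxreshape (unfolding k' X) :> 'M[R]_(m, n).
Proof.
by move=> kd kd' e; apply/matrixP => a b; rewrite !reshape_unfolding_colmajor.
Qed.

Lemma colmajorD X Y l : colmajor (X + Y) l = colmajor X l + colmajor Y l.
Proof. by rewrite /colmajor -big_split; apply: eq_bigr => i _; rewrite ffunE. Qed.

Lemma colmajorN X l : colmajor (- X) l = - colmajor X l.
Proof. by rewrite /colmajor -sumrN; apply: eq_bigr => i _; rewrite ffunE. Qed.

Lemma unfoldingD k X Y : (k <= d)%N ->
  unfolding k (X + Y) = unfolding k X + unfolding k Y.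
Proof.
by move=> kd; apply/matrixP => a b; rewrite [RHS]mxE !unfolding_colmajor // colmajorD.
Qed.

Lemma unfoldingB k X Y : (k <= d)%N ->
  unfolding k (X - Y) = unfolding k X - unfolding k Y.
Proof.
move=> kd; rewrite unfoldingD //; congr (_ + _).
by apply/matrixP => a b; rewrite [RHS]mxE !unfolding_colmajor // colmajorN.
Qed.

Lemma sum_colmajor_index (V : nmodType) (G : tindex d p -> V) :
  \sum_i G i = \sum_(l < dimprod p 1 d) \sum_(i | colmajor_index i == l) G i.
Proof.
rewrite (partition_big (fun i => Ordinal (colmajor_index_lt i)) xpredT) //=.
Qed.

Lemma sum_colmajor_index_le (G : nat -> R) : (forall l, 0 <= G l) ->
  \sum_(i : tindex d p) G (colmajor_index i) <= \sum_(l < dimprod p 1 d) G l.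
Proof.
move=> G0; rewrite sum_colmajor_index; apply: ler_sum => l _.
case: (pickP (fun i : tindex d p => colmajor_index i == l)) => [i /eqP il|no];
  last first.
  by rewrite big_pred0 //; exact: G0.
rewrite (big_pred1 i) ?il // => i'; rewrite -il (inj_eq colmajor_index_inj).
by [].
Qed.

Lemma colmajorE X i : colmajor X (colmajor_index i) = X i.
Proof.
by rewrite /colmajor (big_pred1 i) // => i'; rewrite (inj_eq colmajor_index_inj).
Qed.

Lemma sqfrob_le k X : (k <= d)%N -> sqfrob X <= sqF (unfolding k X).
Proof.
move=> kd; rewrite sqF_mxcolmajor /sqfrob.
under eq_bigr => i _ do rewrite -(colmajorE X i).
apply: le_trans (sum_colmajor_index_le (G := fun l => colmajor X l ^+ 2) _) _.
  by move=> l; exact: sqr_ge0.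
rewrite -(big_mkord xpredT (fun l => colmajor X l ^+ 2)) -(dimprod_cat kd) big_mkord.
apply: ler_sum => l _; rewrite mxcolmajor_unfolding //.
by rewrite -(dimprod_cat kd).
Qed.

(** The adjoint of the unfolding, as [tensor_of_mx_dot] shows: it turns inner
    products with an unfolding of the noise into linear combinations of entries. *)
Definition tensor_of_mx m n (M : 'M[R]_(m, n)) : tindex d p -> R :=
  fun i => mxcolmajor M (colmajor_index i).

Lemma tensor_of_mx_dot k X m n (M : 'M[R]_(m, n)) :
  (k <= d)%N -> (m * n = dimprod p 1 d)%N ->
  \sum_i X i * tensor_of_mx M i = dotF (mxreshape (unfolding k X)) M.
Proof.
move=> kd e; rewrite sum_colmajor_index.
have -> : dotF (mxreshape (unfolding k X)) M =
    \sum_(a < m) \sum_(b < n) (colmajor X (a + b * m) * mxcolmajor M (a + b * m)).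
  by apply: eq_bigr => a _; apply: eq_bigr => b _;
    rewrite reshape_unfolding_colmajor // mxcolmajorE.
rewrite exchange_big /=.
have -> : \sum_(j < n) \sum_(i < m) (colmajor X (i + j * m) * mxcolmajor M (i +
  j * m)) =
   \sum_(l < n * m) (colmajor X l * mxcolmajor M l).
  by rewrite sum_mxtens; apply: eq_bigr => j _; apply: eq_bigr => i _ /=; rewrite addnC.
rewrite -(big_mkord xpredT (fun l =>
  \sum_(i | colmajor_index i == l) X i * tensor_of_mx M i)).
rewrite -(big_mkord xpredT (fun l => colmajor X l * mxcolmajor M l)) mulnC e.
apply: eq_bigr => l _; rewrite mulr_suml; apply: eq_bigr => i /eqP il.
by rewrite /tensor_of_mx il.
Qed.

Lemma tensor_of_mx_sq m n (M : 'M[R]_(m, n)) : (m * n = dimprod p 1 d)%N ->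
  \sum_i tensor_of_mx M i ^+ 2 <= sqF M.
Proof.
move=> e; rewrite sqF_mxcolmajor -(big_mkord xpredT (fun l =>
  mxcolmajor M l ^+ 2)) e big_mkord.
by apply: (sum_colmajor_index_le (G := fun l => mxcolmajor M l ^+ 2)) => l;
  exact: sqr_ge0.
Qed.

End Unfold.

Section Dimensions.
Variables (p : nat -> nat) (d : nat).

Lemma dimprod_row j : dimprod p 1 j.+1 = (p j.+1 * dimprod p 1 j)%N.
Proof. exact: dimprod_recr. Qed.

Lemma dimprod_col j : (j < d)%N ->
  dimprod p j.+1 d = (dimprod p j.+2 d * p j.+1)%N.
Proof. exact: dimprod_recl. Qed.

Lemma dimprod_row0 : dimprod p 1 0 = 1%N.
Proof. by rewrite /dimprod big_geq. Qed.

Lemma dimprod_col0 : dimprod p d.+1 d = 1%N.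
Proof. by rewrite /dimprod big_geq. Qed.

Lemma dimprod_total j : (j < d)%N ->
  (p j.+1 * dimprod p 1 j * dimprod p j.+2 d = dimprod p 1 d)%N.
Proof. by move=> jd; rewrite -dimprod_row dimprod_cat. Qed.

End Dimensions.
Arguments dimprod_row {p} j.
Arguments dimprod_col {p d j} _.
Arguments dimprod_row0 {p}.
Arguments dimprod_col0 {p d}.
Arguments dimprod_total {p d j} _.

(** * Sequential products and the matrices of the algorithm *)

Section Gap.
Variable R : realType.

(** A lower bound on the nonzero singular values of [F]. In this form it holds
    trivially for [lam2 = 0], which covers a vanishing noise level. *)
Definition spectral_gap m n (lam2 : R) (F : 'M[R]_(m, n)) : Prop :=
  forall x : 'M[R]_(n, 1), exists2 x', F *m x' = F *m x &
    lam2 * sqF x' <= sqF (F *m x').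

Lemma spectral_gap_castT m n m' n' (lam2 : R) (F : 'M[R]_(m, n)) : m = m' -> n = n' ->
  spectral_gap lam2 F^T -> spectral_gap lam2 (mxreshape F : 'M[R]_(m', n'))^T.
Proof. by move=> e e' h; subst m' n'; rewrite mxreshape_id. Qed.

Lemma spectral_gap_cast m n m' n' (lam2 : R) (F : 'M[R]_(m, n)) : m = m' -> n = n' ->
  spectral_gap lam2 F -> spectral_gap lam2 (mxreshape F : 'M[R]_(m', n')).
Proof. by move=> e e' h; subst m' n'; rewrite mxreshape_id. Qed.

Lemma cast_mul_swap m n n' k (A : 'M[R]_(m, n)) (B : 'M[R]_(n', k)) : n = n' ->
  A *m (mxreshape B : 'M[R]_(n, k)) = (mxreshape A : 'M[R]_(m, n')) *m B.
Proof. by move=> e; subst n'; rewrite !mxreshape_id. Qed.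

Lemma captures_castT m m' n n' r a (F : 'M[R]_(m, n)) (Q : 'M[R]_(n, r)) :
  m = m' -> n = n' -> captures a F^T Q ->
  captures a (mxreshape F : 'M[R]_(m', n'))^T (mxreshape Q : 'M[R]_(n', r)).
Proof. by move=> e e' h; subst m' n'; rewrite !mxreshape_id. Qed.

Lemma captures_castFT m m' n r a (F : 'M[R]_(m, n)) (Q : 'M[R]_(n, r)) :
  m = m' -> captures a F^T Q ->
  captures a (mxreshape F : 'M[R]_(m', n))^T Q.
Proof. by move=> e h; subst m'; rewrite !mxreshape_id. Qed.

Lemma proj_err_cast m m' n r (F : 'M[R]_(m, n)) (L : 'M[R]_(m, r)) : m = m' ->
  sqF ((mxreshape F : 'M[R]_(m', n)) -
    (mxreshape L : 'M[R]_(m', r)) *m ((mxreshape L : 'M[R]_(m', r))^T *m mxreshape F)) =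
  sqF (F - L *m (L^T *m F)).
Proof. by move=> e; subst m'; rewrite !mxreshape_id. Qed.

Lemma reshape_orth m m' r (L : 'M[R]_(m, r)) : m = m' -> L^T *m L = 1%:M ->
  (mxreshape L : 'M[R]_(m', r))^T *m mxreshape L = 1%:M.
Proof. by move=> e; subst m'; rewrite mxreshape_id. Qed.

Lemma const1_orth m r : m = 1%N -> r = 1%N ->
  (const_mx 1 : 'M[R]_(m, r))^T *m const_mx 1 = 1%:M.
Proof.
move=> m1 r1; subst m r; apply/matrixP => i j.
by rewrite !mxE big_ord1 !mxE mulr1 !ord1 eqxx.
Qed.
End Gap.

Section Seq.
Variables (R : realType) (d : nat) (p r : nat -> nat).
Implicit Types X Y Z : tensor R d p.
Implicit Types (U : forall k, 'M[R]_(p k * r k.-1, r k))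
               (V : forall k, 'M[R]_(r k * p k, r k.-1)).

(** Agrees with [seqprodL] for positive [j]; the value at 0 is chosen such that
    the first step of a pass is like all others. *)
Fixpoint left_basis U (j : nat) : 'M[R]_(dimprod p 1 j, r j) :=
  if j is j'.+1 then mxreshape (((1%:M : 'M[R]_(p j'.+1)) *t left_basis U j') *m U
    j'.+1)
  else const_mx 1.

(** Basis for the modes after [j], with [n = d - j] factors. It is [seqprodR] with
    the index shifted by one, extended by an empty product. *)
Fixpoint right_basis V (j n : nat) : 'M[R]_(dimprod p j.+1 d, r j) :=
  if n is n'.+1 then mxreshape ((right_basis V j.+1 n' *t (1%:M : 'M[R]_(p j.+1))) *m V
    j.+1)
  else const_mx 1.

(** The next factor of a forward pass is sought in the span of this matrix. *)
Definition left_lift U j : 'M[R]_(p j.+1 * dimprod p 1 j, p j.+1 * r j) :=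
  (1%:M : 'M[R]_(p j.+1)) *t left_basis U j.
Definition right_lift V j n : 'M[R]_(dimprod p j.+2 d * p j.+1, r j.+1 * p j.+1) :=
  right_basis V j.+1 n *t (1%:M : 'M[R]_(p j.+1)).

(** The next unfolding with its new mode as outer row index; [colsplit] is the
    same data with that mode as inner column index. A forward step works on the
    former, a backward step on the transpose of the latter. *)
Definition rowsplit j X : 'M[R]_(p j.+1 * dimprod p 1 j, dimprod p j.+2 d) :=
  mxreshape (unfolding j.+1 X).
Definition colsplit j X : 'M[R]_(dimprod p 1 j, dimprod p j.+2 d * p j.+1) :=
  mxreshape (unfolding j X).

Lemma rowsplitE j X : (j < d)%N -> rowsplit j X = mxreshape (colsplit j X).
Proof.
move=> jd; rewrite /rowsplit /colsplit mxreshape_comp; last by ring.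
by apply: reshape_unfolding => //; [exact: ltnW|exact: dimprod_total].
Qed.

Lemma colsplitE j X : (j < d)%N -> colsplit j X = mxreshape (rowsplit j X).
Proof.
move=> jd; rewrite /rowsplit /colsplit mxreshape_comp; last by ring.
apply: reshape_unfolding => //; first exact: ltnW.
by rewrite -(dimprod_total jd); ring.
Qed.

Lemma rowsplitD j X Y : (j < d)%N -> rowsplit j (X + Y) = rowsplit j X + rowsplit j Y.
Proof. by move=> jd; rewrite /rowsplit unfoldingD // mxreshapeD. Qed.

Lemma colsplitD j X Y : (j < d)%N -> colsplit j (X + Y) = colsplit j X + colsplit j Y.
Proof. by move=> jd; rewrite /colsplit unfoldingD ?mxreshapeD // ltnW. Qed.

Lemma left_basisS U j : left_basis U j.+1 = mxreshape (left_lift U j *m U j.+1).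
Proof. by []. Qed.

Lemma right_basisS V j n : right_basis V j n.+1 =
  mxreshape (right_lift V j n *m V j.+1).
Proof. by []. Qed.

Definition orthU U := forall k, (1 <= k < d)%N -> (U k)^T *m U k = 1%:M.
Definition orthV V := forall k, (2 <= k <= d)%N -> (V k)^T *m V k = 1%:M.

Lemma left_basis_orth U j : r 0 = 1%N -> orthU U -> (j < d)%N ->
  (left_basis U j)^T *m left_basis U j = 1%:M.
Proof.
move=> r0 hU; elim: j => [|j IH] jd; first exact: const1_orth dimprod_row0 r0.
rewrite left_basisS; apply: reshape_orth; first exact/esym/dimprod_row.
rewrite trmx_mul mulmxA -(mulmxA _ (left_lift U j)^T) tens1_orth;
  last exact: IH (ltnW jd).
by rewrite mulmx1 hU.
Qed.

Lemma left_lift_orth U j : r 0 = 1%N -> orthU U -> (j < d)%N ->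
  (left_lift U j)^T *m left_lift U j = 1%:M.
Proof. by move=> r0 hU jd; apply: tens1_orth; exact: left_basis_orth. Qed.

Lemma right_basis_orth V j n : r d = 1%N -> orthV V -> (j + n = d)%N -> (0 < j)%N ->
  (right_basis V j n)^T *m right_basis V j n = 1%:M.
Proof.
move=> rd hV; elim: n j => [|n IH] j jd j0.
  by have e : j = d by [rewrite -jd addn0]; subst j; exact: const1_orth dimprod_col0 rd.
have jltd : (j < d)%N by rewrite -jd -addSnnS ltnS leq_addr.
rewrite right_basisS; apply: reshape_orth; first exact/esym/dimprod_col.
rewrite trmx_mul mulmxA -(mulmxA _ (right_lift V j n)^T) tensr1_orth; last first.
  by apply: IH; rewrite ?addSnnS.
by rewrite mulmx1; apply: (hV j.+1); lia.
Qed.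

Lemma right_lift_orth V j n : r d = 1%N -> orthV V -> (j.+1 + n = d)%N ->
  (right_lift V j n)^T *m right_lift V j n = 1%:M.
Proof. by move=> rd hV jd; apply: tensr1_orth; exact: right_basis_orth. Qed.

(** At [j = 1] this uses that a Kronecker product with the 1 x 1 matrix 1 is a cast. *)
Lemma seqprodLE U j : r 0 = 1%N -> (0 < j)%N -> seqprodL U j = left_basis U j.
Proof.
move=> r0; case: j => // j _; elim: j => [|j IH];
  last by rewrite left_basisS /left_lift -IH.
apply/esym; rewrite left_basisS /= /left_lift.
have -> : (1%:M : 'M[R]_(p 1)) *t left_basis U 0 =
    mxreshape (1%:M : 'M[R]_(p 1 * r 0)) :> 'M[R]_(p 1 * dimprod p 1 0, p 1 * r 0).
  rewrite /left_basis; have : dimprod p 1 0 = r 0 by rewrite dimprod_row0 r0.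
  move: (dimprod p 1 0) => m e; subst m; rewrite mxreshape_id r0.
  rewrite (_ : const_mx 1 = 1%:M) ?tens11 //.
  by apply/matrixP => i j; rewrite !mxE !ord1.
rewrite cast_mull ?mul1mx; last by rewrite dimprod_row0 r0.
by rewrite mxreshape_comp // dimprod_row.
Qed.

Lemma left_lift_reshape Y U j : (j < d)%N ->
  (left_lift U j)^T *m rowsplit j Y = mxreshape ((left_basis U j)^T *m colsplit j Y).
Proof. by move=> jd; rewrite rowsplitE // /left_lift trmx_tens trmx1 -reshape_mull. Qed.

Lemma left_basis_unfolding Y U j :
  (left_basis U j.+1)^T *m unfolding j.+1 Y =
  (U j.+1)^T *m ((left_lift U j)^T *m rowsplit j Y).
Proof.
rewrite left_basisS mulmxA -trmx_mul.
rewrite -[in LHS](mxreshape_id (unfolding j.+1 Y)) -[in RHS](cast_trmul _ _ (esym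
  (dimprod_row j))).
by rewrite mxreshape_comp // dimprod_row.
Qed.

Lemma ttoi_RE Y U j : r 0 = 1%N -> (j < d)%N ->
  ttoi_R Y U j.+1 = (left_lift U j)^T *m rowsplit j Y.
Proof.
move=> r0; elim: j => [|j IH] jd.
  rewrite left_lift_reshape // /= trmx_const (const1_mul _ dimprod_row0 r0).
  rewrite /colsplit !mxreshape_comp; [|by rewrite dimprod_row0 r0; ring|by ring].
  apply: reshape_unfolding => //.
  by rewrite -(dimprod_total jd) dimprod_row0 r0.
have -> : ttoi_R Y U j.+2 = mxreshape ((U j.+1)^T *m ttoi_R Y U j.+1) by [].
rewrite IH ?(ltnW jd) // [RHS]left_lift_reshape // -left_basis_unfolding /colsplit
  cast_mulr; last exact: dimprod_col.
by rewrite mxreshape_comp //=; ring.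
Qed.

Lemma ttoi_RtildeE Y U j : r 0 = 1%N -> (j < d)%N ->
  ttoi_Rtilde Y U j.+1 = (left_basis U j.+1)^T *m unfolding j.+1 Y.
Proof.
by move=> r0 jd; rewrite /ttoi_Rtilde ttoi_RE // left_basis_unfolding.
Qed.

Lemma seqprodRE V j n : r d = 1%N -> (j.+1 + n = d)%N ->
  seqprodR d V j.+1 = right_basis V j n.+1.
Proof.
move=> rd jd; have -> : seqprodR d V j.+1 = seqprodR_rec d V j.+1 n.
  by rewrite /seqprodR -jd addKn.
elim: n j jd => [|n IH] j jd; last first.
  by rewrite /= IH //; lia.
rewrite addn0 in jd.
apply/esym; rewrite right_basisS /= /right_lift.
have e1 : dimprod p j.+2 d = 1%N by rewrite jd dimprod_col0.
have e2 : r j.+1 = 1%N by rewrite jd.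
have -> : right_basis V j.+1 0 *t (1%:M : 'M[R]_(p j.+1)) =
    mxreshape (1%:M : 'M[R]_(r j.+1 * p j.+1)) :> 'M[R]_(dimprod p j.+2 d * p j.+1,
      r j.+1 * p j.+1).
  rewrite /right_basis; move: e1 (e2); move: (dimprod p j.+2 d) (r j.+1) => m r' -> ->.
  rewrite mxreshape_id (_ : const_mx 1 = 1%:M) ?tens11 //.
  by apply/matrixP => a b; rewrite !mxE !ord1.
rewrite cast_mull ?mul1mx; last by rewrite e1 e2.
have jltd : (j < d)%N by rewrite -jd.
by rewrite mxreshape_comp // -(dimprod_col jltd).
Qed.

(** Both matrices rearrange the contraction of the noise with all factors but
    the one of mode [j.+1], so a single family of noise bounds serves forward and
    backward updates. *)
Lemma noise_left_right Z U V j n : (j < d)%N ->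
  sqF ((left_basis U j)^T *m colsplit j Z *m right_lift V j n) =
  sqF ((left_lift U j)^T *m rowsplit j Z *m right_basis V j.+1 n).
Proof.
move=> jd; rewrite /right_lift -sqF_reshape_mulr reshape_mull -rowsplitE //.
by rewrite /left_lift trmx_tens trmx1.
Qed.

End Seq.

(** * One step and one pass of the algorithm *)

Section Steps.
Variable R : realType.

(** By [SVDL_exact], [U] misses the same part of [K^T *m F *m Q] and of
    [- (K^T *m Z *m Q)]. The hypothesis on [Q] then allows to remove it from the
    former, row by row. *)
Lemma exact_svd_residual m n r s (b : R) (K : 'M[R]_(m, r)) (F Z : 'M[R]_(m, n))
    (Q : 'M[R]_(n, s)) (U : 'M[R]_(r, s)) :
  U^T *m U = 1%:M -> is_SVDL (K^T *m (F + Z) *m Q) U -> captures b F^T Q ->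
  b * sqF (K^T *m F - U *m (U^T *m (K^T *m F))) <= sqF (K^T *m Z *m Q).
Proof.
move=> hU /SVDL_exact h0 hQ.
pose C := K^T - U *m (U^T *m K^T).
have CE k (A : 'M[R]_(m, k)) : C *m A = K^T *m A - U *m (U^T *m (K^T *m A)).
  by rewrite /C mulmxBl !mulmxA.
have h : b * sqF (C *m F) <= sqF (C *m F *m Q).
  by have := captures_mx C^T hQ; rewrite -!trmx_mul !sqF_trmx mulmxA.
have e : C *m F *m Q = - (C *m Z *m Q).
  apply/eqP; rewrite -addr_eq0 -mulmxDl -mulmxDr -mulmxA CE; apply/eqP.
  by rewrite -[RHS]h0 !mulmxA.
rewrite -CE; apply: le_trans h _.
rewrite e sqFN -[C *m Z *m Q]mulmxA CE -[_ *m Z *m Q]mulmxA.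
exact: sqF_orthC.
Qed.

Lemma sub_cancel_mx m n (a b c d : 'M[R]_(m, n)) :
  a - c = (a + b) - (c + d) - (b - d).
Proof. by apply/matrixP => i j; rewrite !mxE; ring. Qed.

(** Without a factor on the right the data are not reproduced exactly; their
    residual has operator norm at most that of the noise because [F] has rank at
    most [s], and the missed part of the noise is added to it. *)
Lemma init_svd_residual m n r s (eta2 : R) (K : 'M[R]_(m, r)) (F Z : 'M[R]_(m, n))
    (U : 'M[R]_(r, s)) (x : 'M[R]_(n, 1)) :
  U^T *m U = 1%:M -> is_SVDL (K^T *m (F + Z)) U -> (\rank F <= s)%N ->
  0 <= eta2 -> (forall x : 'M[R]_(n, 1), sqF (K^T *m Z *m x) <= eta2 * sqF x) ->
  sqF ((K^T *m F - U *m (U^T *m (K^T *m F))) *m x) <= 4 * eta2 * sqF x.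
Proof.
move=> hU [U' [sv [V' [hsvd hUE]]]] rF e0 hZ.
have hs : sv s ^+ 2 <= eta2.
  apply: (svd_weyl hsvd (A := K^T *m F)) => //.
    by apply: leq_trans rF; exact: mxrankM_maxr.
  by move=> y; rewrite mulmxDr addrC addKr.
have := svd_tail s x hsvd; rewrite /= -hUE => hT.
have -> : (K^T *m F - U *m (U^T *m (K^T *m F))) *m x =
    (K^T *m (F + Z) - U *m (U^T *m (K^T *m (F + Z)))) *m x -
    (K^T *m Z *m x - U *m (U^T *m (K^T *m Z *m x))).
  by rewrite !mulmxDr !mulmxBl !mulmxDl !mulmxA; exact: sub_cancel_mx.
apply: le_trans (sqFB_le _ _) _.
have h1 := ler_wpM2r (sqF_ge0 x) hs.
have h2 := le_trans (sqF_orthC (K^T *m Z *m x) hU) (hZ x).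
by lra.
Qed.
End Steps.

Section Pass.
Variables (R : realType) (d : nat) (p r : nat -> nat).
Implicit Types X Y Z : tensor R d p.
Implicit Types (U : forall k, 'M[R]_(p k * r k.-1, r k))
               (V : forall k, 'M[R]_(r k * p k, r k.-1)).

Definition proj_err m n k (F : 'M[R]_(m, n)) (L : 'M[R]_(m, k)) :=
  sqF (F - L *m (L^T *m F)).

(** The part of the signal that is lost when [U j.+1] is chosen. *)
Definition left_residual U j X := (left_lift U j)^T *m rowsplit j X -
  U j.+1 *m ((U j.+1)^T *m ((left_lift U j)^T *m rowsplit j X)).
Definition right_residual V j n X := (right_lift d V j n)^T *m (colsplit j X)^T -
  V j.+1 *m ((V j.+1)^T *m ((right_lift d V j n)^T *m (colsplit j X)^T)).

Lemma const1_square m k n (F : 'M[R]_(m, n)) : m = 1%N -> k = 1%N ->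
  (const_mx 1 : 'M[R]_(m, k)) *m ((const_mx 1 : 'M[R]_(m, k))^T *m F) = F.
Proof.
move=> m1 k1; subst m k; rewrite (_ : const_mx 1 = 1%:M) ?trmx1 ?mul1mx //.
by apply/matrixP => i j; rewrite !mxE !ord1.
Qed.

Lemma captures_const1 m k n (F : 'M[R]_(m, n)) : m = 1%N -> k = 1%N ->
  captures 1 F (const_mx 1 : 'M[R]_(m, k)).
Proof.
move=> m1 k1 x; rewrite mul1r -[X in sqF X <= _](const1_square (F *m x) m1 k1).
by rewrite sqF_iso ?mulmxA //; exact: const1_orth.
Qed.

(** Each of the steps costs at most [delta]. *)
Lemma fwd_lower X U (delta : R) (lam2 : nat -> R) : r 0 = 1%N ->
  orthU d U -> 0 <= delta ->
  (forall j, (j.+1 < d)%N -> spectral_gap (lam2 j.+1) (unfolding j.+1 X)) ->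
  (forall j, (j.+1 < d)%N -> forall x : 'M[R]_(_, 1),
     sqF (left_residual U j X *m x) <= delta * lam2 j.+1 * sqF x) ->
  forall j, (j < d)%N -> captures (1 - j%:R * delta) (unfolding j X) (left_basis U j).
Proof.
move=> r0 hU del0 hG hE; elim=> [|j IH] jd.
  by rewrite mul0r subr0; exact: captures_const1 dimprod_row0 r0.
have jd' := ltnW jd.
have h1 : captures (1 - j%:R * delta) (rowsplit j X) (left_lift U j).
  by rewrite rowsplitE //; apply/captures_reshape/captures_castF;
    [exact: dimprod_col|exact: IH].
have h2 : captures (1 - j%:R * delta - delta) (rowsplit j X) (left_lift U j *m U j.+1).
  apply: (captures_step del0 _ h1 _ (hE j jd)); first exact: hU.
  by apply: spectral_gap_cast (hG j jd); [exact: dimprod_row|].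
rewrite -natr1 mulrDl mul1r opprD addrA left_basisS.
have -> : unfolding j.+1 X = mxreshape (rowsplit j X).
  by rewrite /rowsplit mxreshape_comp ?mxreshape_id // dimprod_row.
by apply: captures_cast h2; [exact/esym/dimprod_row|].
Qed.

Lemma bwd_lower X V (delta : R) (lam2 : nat -> R) : r d = 1%N ->
  orthV d V -> 0 <= delta ->
  (forall j, (0 < j < d)%N -> spectral_gap (lam2 j) (unfolding j X)^T) ->
  (forall j n, (0 < j)%N -> (j.+1 + n = d)%N -> forall x : 'M[R]_(_, 1),
     sqF (right_residual V j n X *m x) <= delta * lam2 j * sqF x) ->
  forall n j, (0 < j)%N -> (j + n = d)%N ->
    captures (1 - n%:R * delta) (unfolding j X)^T (right_basis d V j n).
Proof.
move=> rd hV del0 hG hE; elim=> [|n IH] j j0 jn.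
  have jE : j = d by rewrite -jn addn0.
  by subst j; rewrite mul0r subr0; exact: captures_const1 dimprod_col0 rd.
have jd : (j < d)%N by lia.
have jn' : (j.+1 + n = d)%N by lia.
have h1 : captures (1 - n%:R * delta) (colsplit j X)^T (right_lift d V j n).
  rewrite colsplitE //; apply/captures_reshapeT/captures_castFT;
    first exact: dimprod_row.
  exact: IH.
have h2 : captures (1 - n%:R * delta - delta) (colsplit j X)^T (right_lift d V j n *m V
  j.+1).
  apply: (captures_step del0 _ h1 _ (hE j n j0 jn')); first by apply: hV; lia.
  by apply: spectral_gap_castT (hG j _); [|exact: dimprod_col|lia].
rewrite -natr1 mulrDl mul1r opprD addrA right_basisS.
have -> : unfolding j X = mxreshape (colsplit j X).
  by rewrite /colsplit mxreshape_comp ?mxreshape_id // -(dimprod_col jd).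
by apply: captures_castT h2; [|exact/esym/dimprod_col].
Qed.

(** Losses of successive steps are orthogonal, and projecting commutes with the
    reshaping that leads to the next step. *)
Lemma fwd_err X U (eps : R) : r 0 = 1%N -> orthU d U ->
  (forall j, (j.+1 < d)%N -> sqF (left_residual U j X) <= eps) ->
  forall j, (j < d)%N -> proj_err (unfolding j X) (left_basis U j) <= j%:R * eps.
Proof.
move=> r0 hU hE; elim=> [|j IH] jd.
  by rewrite mul0r /proj_err (const1_square _ dimprod_row0 r0) subrr sqF0.
have jd' := ltnW jd.
have -> : unfolding j.+1 X = mxreshape (rowsplit j X).
  by rewrite /rowsplit mxreshape_comp ?mxreshape_id // dimprod_row.
rewrite /proj_err left_basisS proj_err_cast; last exact/esym/dimprod_row.
rewrite proj_err_step; [|exact: (left_lift_orth r0 hU jd')|exact: hU].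
rewrite -natr1 mulrDl mul1r; apply: lerD; last exact: hE.
apply: le_trans (IH jd'); rewrite rowsplitE // /left_lift trmx_tens trmx1
  -!reshape_mull -mxreshapeB.
rewrite sqF_reshape; last by ring.
rewrite /colsplit cast_mulr ?cast_mulr -?mxreshapeB; try exact: dimprod_col.
by rewrite sqF_reshape // -(dimprod_col jd').
Qed.

Lemma bwd_err X V (eps : R) : r d = 1%N -> orthV d V ->
  (forall j n, (0 < j)%N -> (j.+1 + n = d)%N -> sqF (right_residual V j n X) <= eps) ->
  forall n j, (0 < j)%N -> (j + n = d)%N ->
    proj_err (unfolding j X)^T (right_basis d V j n) <= n%:R * eps.
Proof.
move=> rd hV hE; elim=> [|n IH] j j0 jn.
  have jE : j = d by rewrite -jn addn0.
  by subst j; rewrite mul0r /proj_err (const1_square _ dimprod_col0 rd) subrr sqF0.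
have jd : (j < d)%N by lia.
have jn' : (j.+1 + n = d)%N by lia.
have -> : unfolding j X = mxreshape (colsplit j X).
  by rewrite /colsplit mxreshape_comp ?mxreshape_id // -(dimprod_col jd).
have eT := @cast_tr R _ (dimprod p 1 j) _ (dimprod p j.+1 d) (colsplit j X) erefl (esym
  (dimprod_col jd)).
rewrite eT /proj_err right_basisS proj_err_cast; last exact/esym/dimprod_col.
rewrite proj_err_step.
- rewrite -natr1 mulrDl mul1r; apply: lerD; last exact: hE.
  apply: le_trans (IH j.+1 isT jn'); rewrite le_eqVlt; apply/orP; left; apply/eqP.
  rewrite /proj_err -sqF_trmx -[in RHS]sqF_trmx !raddfB /= !trmx_mul !trmxK.
  rewrite -(@sqF_reshape _ _ _ (p j.+1 * dimprod p 1 j) (dimprod p j.+2 d));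
    last by ring.
  rewrite mxreshapeB /right_lift trmx_tens trmx1 -[_ *m _ *m _]mulmxA tensmx_mul mulmx1.
  rewrite reshape_mulr -rowsplitE // /rowsplit -[in RHS]mulmxA cast_mull ?dimprod_row
    // -mxreshapeB.
  by rewrite sqF_reshape // -dimprod_row.
- exact: (right_lift_orth rd hV jn').
- by apply: (hV j.+1); lia.
Qed.

End Pass.

(** * Error of all iterates under bounds on the noise *)

Section Det.
Variables (R : realType) (d' : nat) (p r : nat -> nat).
Let d := d'.+1.
Hypotheses (d'0 : (0 < d')%N) (r0 : r 0 = 1%N) (rd : r d = 1%N).
Hypothesis rp : forall k, (1 <= k <= d)%N ->
  (r k <= r k.-1 * p k)%N /\ (r k.-1 <= p k * r k)%N.
Variables (X Z : tensor R d p).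
Let Y : tensor R d p := X + Z.

Lemma const_tens_mul q m D s (A : 'M[R]_(m, D * q)) : D = 1%N -> s = 1%N ->
  A *m ((const_mx 1 : 'M[R]_(D, s)) *t (1%:M : 'M[R]_q)) = mxreshape A.
Proof.
move=> D1 s1; subst D s; rewrite mxreshape_id (_ : const_mx 1 =
  1%:M) ?tens11 ?mulmx1 //.
by apply/matrixP => i j; rewrite !mxE !ord1.
Qed.

Section Svd.
Variables (U : nat -> forall k, 'M[R]_(p k * r k.-1, r k))
          (V : nat -> forall k, 'M[R]_(r k * p k, r k.-1)).
Hypothesis hsvd : ttoi_svd Y U V.

Lemma svd0 j : (j < d')%N ->
  is_SVDL ((left_lift (U 0%N) j)^T *m rowsplit j Y) (U 0%N j.+1).
Proof.
move=> jd; case: hsvd => h _ _.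
by have := h j.+1; rewrite ttoi_RE //; [apply; rewrite jd|rewrite /d; lia].
Qed.

Lemma svd_even t j : (2 <= t)%N -> ~~ odd t -> (j < d')%N ->
  is_SVDL ((left_lift (U t) j)^T *m rowsplit j Y *m right_basis d (V t.-1) j.+1 (d' -
    j)) (U t j.+1).
Proof.
move=> t2 ot jd; case: hsvd => _ _ h.
have := h t t2 ot j.+1; rewrite ttoi_RE //; last by rewrite /d; lia.
have -> : (d' - j = (d' - j.+1).+1)%N by lia.
rewrite -(@seqprodRE _ d p r (V t.-1) j.+1 (d' - j.+1)) //; last by rewrite /d; lia.
by apply; rewrite jd.
Qed.

Lemma svd_odd t j : odd t -> (0 < j <= d')%N ->
  is_SVDR ((left_basis (U t.-1) j)^T *m colsplit j Y *m right_lift d (V t) j (d' - j))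
    (V t j.+1).
Proof.
move=> ot /andP[j0 jd]; case: hsvd => _ h _.
case: (h t ot) => hA hB {h}; case: j j0 jd => // j _ jd.
have jltd : (j.+1 < d)%N by rewrite /d; lia.
have colsplit_tilde : (left_basis (U t.-1) j.+1)^T *m colsplit j.+1 Y =
    mxreshape (ttoi_Rtilde Y (U t.-1) j.+1).
  by rewrite ttoi_RtildeE ?(ltnW jltd) // /colsplit cast_mulr //; exact: dimprod_recl.
rewrite colsplit_tilde; move: jd; rewrite leq_eqVlt => /predU1P[jE|jd].
  subst d'; rewrite subnn /right_lift [right_basis _ _ _ _]/= const_tens_mul //;
    last first.
    by rewrite /dimprod big_geq.
  rewrite mxreshape_comp; last by rewrite /dimprod rd big_geq //;
    rewrite (big_geq (leqnn _)) ; ring.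
  exact: hA.
have := hB j.+2; rewrite -cast_mul_swap; last exact: dimprod_recl.
have -> : (d' - j.+1 = (d' - j.+2).+1)%N by lia.
rewrite /right_lift -(@seqprodRE _ d p r (V t) j.+2 (d' - j.+2)) //;
  last by rewrite /d; lia.
by apply; rewrite jd.
Qed.

Lemma U0_orth : orthU d (U 0%N).
Proof.
move=> [|k] // kd; have /svd0 h : (k < d')%N by move: kd; rewrite /d; lia.
by apply: SVDL_orth h; have [|+ _] := rp (k := k.+1); [lia|rewrite mulnC].
Qed.

Lemma Ut_orth t : (2 <= t)%N -> ~~ odd t -> orthU d (U t).
Proof.
move=> t2 ot [|k] // kd.
have /(svd_even t2 ot) h : (k < d')%N by move: kd; rewrite /d; lia.
by apply: SVDL_orth h; have [|+ _] := rp (k := k.+1); [lia|rewrite mulnC].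
Qed.

Lemma Vt_orth t : odd t -> orthV d (V t).
Proof.
move=> ot [|k] // kd.
have /(svd_odd ot)/SVDR_SVDL h : (0 < k <= d')%N by move: kd; rewrite /d; lia.
by apply: SVDL_orth h; have [|_] := rp (k := k.+1); [move: kd; rewrite /d;
  lia|rewrite mulnC].
Qed.

Variables (tau2 : R) (eta2 lam2 : nat -> R).
Let delta : R := (2 * d%:R)^-1.
Hypothesis tau0 : 0 <= tau2.
Hypothesis eta0 : forall k, 0 <= eta2 k.
Hypothesis noise_tau : forall (U : forall k, 'M[R]_(p k * r k.-1, r k))
    (V : forall k, 'M[R]_(r k * p k, r k.-1)), orthU d U -> orthV d V ->
  forall j n, (j.+1 + n = d)%N ->
    sqF ((left_lift U j)^T *m rowsplit j Z *m right_basis d V j.+1 n) <= tau2.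
Hypothesis noise_eta : forall (U : forall k, 'M[R]_(p k * r k.-1, r k)), orthU d U ->
  forall j, (j.+1 < d)%N ->
  forall x : 'M[R]_(_, 1), sqF ((left_lift U j)^T *m rowsplit j Z *m x) <=
    eta2 j.+1 * sqF x.
Hypothesis gapX : forall k, (0 < k < d)%N -> spectral_gap (lam2 k) (unfolding k X).
Hypothesis gapXT : forall k, (0 < k < d)%N -> spectral_gap (lam2 k) (unfolding k X)^T.
Hypothesis rankX : forall k, (0 < k < d)%N -> (\rank (unfolding k X) <= r k)%N.
Hypothesis lam_tau : forall k, (0 < k < d)%N -> 2 * tau2 <= delta * lam2 k.
Hypothesis lam_eta : forall k, (0 < k < d)%N -> 4 * eta2 k <= delta * lam2 k.

Let delta0 : 0 <= delta.
Proof. by rewrite invr_ge0 mulr_ge0. Qed.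

Let delta_le n : (n <= d)%N -> 2^-1 <= 1 - n%:R * delta.
Proof.
move=> nd; have dp : 0 < d%:R :> R by rewrite ltr0n.
have -> : 1 - n%:R * delta = 2^-1 + (d%:R - n%:R) * delta.
  by rewrite /delta; field; rewrite lt0r_neq0.
by rewrite lerDl mulr_ge0 // subr_ge0 ler_nat.
Qed.

Definition good_left (U : forall k, 'M[R]_(p k * r k.-1, r k)) :=
  forall j, (j < d)%N -> captures 2^-1 (unfolding j X) (left_basis U j).
Definition good_right (V : forall k, 'M[R]_(r k * p k, r k.-1)) :=
  forall n j, (0 < j)%N -> (j + n = d)%N ->
    captures 2^-1 (unfolding j X)^T (right_basis d V j n).

(** Here only the operator norm of the noise matters: a Frobenius bound would
    lose a factor depending on the ranks. *)
Lemma good_init : good_left (U 0%N).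
Proof.
move=> j jd; apply: capturesW (delta_le (ltnW jd)) _.
apply: (fwd_lower r0 U0_orth delta0 (lam2 := lam2)) => // {j jd} [j jd|j jd x].
  by apply: gapX; rewrite jd.
apply: le_trans (init_svd_residual (eta2 := eta2 j.+1) (Z := rowsplit j Z) _ _ _ _ _ _)
  _.
- by apply: U0_orth; rewrite jd.
- by rewrite -rowsplitD ?(ltnW jd) //; exact: svd0.
- by rewrite /rowsplit cast_rank ?rankX ?jd //; exact: dimprod_recr.
- exact: eta0.
- by move=> y; apply: noise_eta jd y; exact: U0_orth.
by rewrite ler_wpM2r ?sqF_ge0 // lam_eta ?jd.
Qed.

Let half_le (a b : R) : 2^-1 * a <= b -> a <= 2 * b.
Proof. by move=> h; lra. Qed.

(** Besides controlling the angle, this Frobenius bound is the final error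
    estimate: the noise occurs in it only contracted with factors of the
    prescribed sizes, so that no product of all remaining dimensions is left. *)
Lemma odd_err t : odd t -> orthU d (U t.-1) -> good_left (U t.-1) ->
  forall j n, (0 < j)%N -> (j.+1 + n = d)%N ->
    sqF (right_residual (V t) j n X) <= 2 * tau2.
Proof.
move=> ot oU gU j n j0 jn; have jd : (j < d)%N by lia.
have nE : n = (d' - j)%N by rewrite /d in jn; lia.
have hs : is_SVDL ((right_lift d (V t) j n)^T *m ((colsplit j X)^T +
  (colsplit j Z)^T) *m left_basis (U t.-1) j)
    (V t j.+1).
  have jd1 : (0 < j <= d')%N by rewrite j0; rewrite /d in jd.
  have := SVDR_SVDL (svd_odd ot jd1); rewrite -nE colsplitD //.
  by rewrite !trmx_mul trmxK raddfD /= mulmxA.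
apply: half_le; apply: le_trans (exact_svd_residual _ hs _) _.
- by apply: (Vt_orth ot (k := j.+1)); rewrite /d in jd *; lia.
- by rewrite trmxK /colsplit; apply: captures_castF (gU j jd); exact: dimprod_recl.
rewrite -sqF_trmx !trmx_mul !trmxK mulmxA noise_left_right //.
exact: noise_tau oU (Vt_orth ot) _ _ jn.
Qed.

Lemma odd_good t : odd t -> orthU d (U t.-1) -> good_left (U t.-1) -> good_right (V t).
Proof.
move=> ot oU gU n j j0 jn; apply: capturesW (delta_le (n := n) _) _; first by lia.
apply: (bwd_lower rd (Vt_orth ot) delta0 (lam2 := lam2)) => // {n j j0 jn} j n j0 jn x.
have jd : (0 < j < d)%N by lia.
apply: le_trans (sqF_mul _ _) _; rewrite ler_wpM2r ?sqF_ge0 //.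
by apply: le_trans (odd_err ot oU gU j0 jn) _; exact: lam_tau.
Qed.

Lemma even_err t : (2 <= t)%N -> ~~ odd t -> orthV d (V t.-1) -> good_right (V t.-1) ->
  forall j, (j.+1 < d)%N -> sqF (left_residual (U t) j X) <= 2 * tau2.
Proof.
move=> t2 ot oV gV j jd; have jd' : (j < d')%N by [].
have jn : (j.+1 + (d' - j) = d)%N by rewrite /d; lia.
have := svd_even t2 ot jd'; rewrite rowsplitD ?(ltnW jd) // => hs.
apply: half_le; apply: le_trans (exact_svd_residual _ hs _) _.
- by apply: (Ut_orth t2 ot); rewrite jd.
- by apply: captures_castFT (gV _ j.+1 isT jn); exact: dimprod_recr.
exact: noise_tau (Ut_orth t2 ot) oV _ _ jn.
Qed.

Lemma even_good t : (2 <= t)%N -> ~~ odd t -> orthV d (V t.-1) ->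
  good_right (V t.-1) -> good_left (U t).
Proof.
move=> t2 ot oV gV j jd; apply: capturesW (delta_le (ltnW jd)) _.
apply: (fwd_lower r0 (Ut_orth t2 ot) delta0 (lam2 := lam2)) => // {j jd} [j jd|j jd x].
  by apply: gapX; rewrite jd.
apply: le_trans (sqF_mul _ _) _; rewrite ler_wpM2r ?sqF_ge0 //.
by apply: le_trans (even_err t2 ot oV gV jd) _; apply: lam_tau; rewrite jd.
Qed.

(** The invariant of the iteration. Even iterates have good left bases, odd ones
    good right bases, and each is derived from its predecessor. *)
Lemma good t : if odd t then good_right (V t) else orthU d (U t) /\ good_left (U t).
Proof.
elim: t => [|t IH] /=; first by split; [exact: U0_orth|exact: good_init].
case: ifPn IH => ot /= IH; last by have [oU gU] := IH; exact: odd_good.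
have t1 : (2 <= t.+1)%N by case: (t) ot.
have ot1 : ~~ odd t.+1 by rewrite /= ot.
by split; [exact: Ut_orth|apply: even_good => //; exact: Vt_orth].
Qed.

(** The error is the projected noise minus the part of the signal outside the
    projection; the former is also a contraction of the noise, with [j = 0] and a
    square left basis. *)
Lemma odd_final t (Xh : tensor R d p) : odd t ->
  unfolding 1 Xh = unfolding 1 Y *m seqprodR d (V t) 2 *m (seqprodR d (V t) 2)^T ->
  sqfrob (Xh - X) <= (2 + 4 * d%:R) * tau2.
Proof.
move=> ot hX.
have t1E : t = t.-1.+1 by case: t ot {hX}.
have [oU gU] : orthU d (U t.-1) /\ good_left (U t.-1).
  have := good t.-1; rewrite t1E /= in ot; by rewrite (negbTE ot).
have oV := Vt_orth ot.
have n1 : (1 + d' = d)%N by [].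
have hQ := right_basis_orth rd oV n1 isT.
have QE : seqprodR d (V t) 2 = right_basis d (V t) 1 d'.
  rewrite (@seqprodRE _ d p r (V t) 1 d'.-1) ?prednK // /d; lia.
rewrite QE in hX; set Q := right_basis d (V t) 1 d' in hX hQ.
apply: le_trans (sqfrob_le (k := 1) _ _) _; first by rewrite /d.
rewrite unfoldingB; last by rewrite /d.
rewrite hX unfoldingD; last by rewrite /d.
set A := unfolding 1 X; set B := unfolding 1 Z.
have -> : (A + B) *m Q *m Q^T - A = B *m Q *m Q^T - (A - A *m Q *m Q^T).
  by rewrite !mulmxDl; apply/matrixP => a b; rewrite !mxE; ring.
apply: le_trans (sqFB_le _ _) _.
have h1 : sqF (B *m Q *m Q^T) <= tau2.
  rewrite -sqF_trmx trmx_mul trmxK sqF_iso // sqF_trmx.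
  apply: le_trans (noise_tau oU oV (j := 0) n1).
  (* the left basis of no mode is the 1 x 1 matrix 1, so its lift is unitary *)
  have K0 : (left_lift (U t.-1) 0)^T^T *m (left_lift (U t.-1) 0)^T = 1%:M.
    rewrite trmxK /left_lift trmx_tens tensmx_mul trmx1 mulmx1 [left_basis _ _]/=.
    have c1 : (const_mx 1 : 'M[R]_(dimprod p 1 0, r 0)) *m (const_mx 1)^T = 1%:M.
      by have := const1_square (k := r 0) (1%:M : 'M[R]_(dimprod p 1 0));
        rewrite mulmx1; apply => //; rewrite /dimprod big_geq.
    by rewrite c1 tens11.
  rewrite -[X in _ <= sqF X]mulmxA (sqF_iso _ K0) /rowsplit cast_mull;
    last exact: dimprod_recr.
  by rewrite sqF_reshape // -dimprod_recr.
have h2 : sqF (A - A *m Q *m Q^T) <= d'%:R * (2 * tau2).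
  have := bwd_err rd oV (eps := 2 * tau2) (odd_err ot oU gU) (n := d') (j := 1) isT n1.
  by rewrite /proj_err -sqF_trmx raddfB /= !trmx_mul !trmxK.
have : (d'%:R : R) <= d%:R by rewrite ler_nat.
move=> /(ler_wpM2r tau0); nra.
Qed.

Lemma even_final t (Xh : tensor R d p) : (2 <= t)%N -> ~~ odd t ->
  unfolding d' Xh = seqprodL (U t) d' *m ttoi_Rtilde Y (U t) d' ->
  sqfrob (Xh - X) <= (2 + 4 * d%:R) * tau2.
Proof.
move=> t2 ot hX.
have t1E : t = t.-1.+1 by case: t t2 {hX ot}.
have ot1 : odd t.-1 by rewrite t1E /= negbK in ot.
have gV : good_right (V t.-1) by have := good t.-1; rewrite ot1.
have oV := Vt_orth ot1; have oU := Ut_orth t2 ot.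
have d'd : (d' < d)%N by [].
have hL := left_basis_orth r0 oU d'd.
have RE k : (0 < k)%N -> (k < d)%N ->
    ttoi_Rtilde Y (U t) k = (left_basis (U t) k)^T *m unfolding k Y.
  by case: k => // k _ kd; apply: ttoi_RtildeE => //; exact: ltnW.
rewrite seqprodLE // RE // in hX.
apply: le_trans (sqfrob_le (k := d') _ _) _; first by rewrite /d.
rewrite unfoldingB; last by rewrite /d.
rewrite hX unfoldingD; last by rewrite /d.
set A := unfolding d' X; set B := unfolding d' Z; set L := left_basis (U t) d' in hL *.
have -> : L *m (L^T *m (A + B)) - A = L *m (L^T *m B) - (A - L *m (L^T *m A)).
  by rewrite !mulmxDr; apply/matrixP => a b; rewrite !mxE; ring.
apply: le_trans (sqFB_le _ _) _.
have h1 : sqF (L *m (L^T *m B)) <= tau2.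
  rewrite sqF_iso //.
  have jn : (d'.+1 + 0 = d)%N by rewrite addn0.
  have := noise_tau oU oV jn; rewrite -noise_left_right //; apply: le_trans.
  rewrite /right_lift [right_basis _ _ _ _]/= const_tens_mul //;
    last by rewrite /dimprod big_geq.
  rewrite sqF_reshape; last by rewrite /dimprod big_geq // rd.
  rewrite /colsplit cast_mulr; last exact: dimprod_recl.
  by rewrite sqF_reshape // -dimprod_recl.
have h2 : proj_err A L <= d'%:R * (2 * tau2).
  exact: (fwd_err r0 oU (eps := 2 * tau2) (even_err t2 ot oV gV) d'd).
rewrite /proj_err in h2.
have : (d'%:R : R) <= d%:R by rewrite ler_nat.
move=> /(ler_wpM2r tau0); nra.
Qed.

End Svd.
End Det.

(** * Nets of unit balls by lattice counting *)

(** Greedy choice along the list. *)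
Lemma maximal_separated (T : eqType) (close : rel T) (G : seq T) :
  uniq G -> reflexive close -> symmetric close ->
  exists S : seq T, [/\ uniq S, {subset S <= G},
    {in S &, forall s s', close s s' -> s = s'} &
    {in G, forall g, exists2 s, s \in S & close g s}].
Proof.
move=> uG cr cs; elim: G uG => [|g G IH] /=; first by exists [::].
case/andP=> gG /IH[S [uS SG sep cov]].
have [/hasP[s sS gs]|/hasPn nh] := boolP (has (close g) S).
  exists S; split => //; first by move=> x /SG xG; rewrite inE xG orbT.
  by move=> h; rewrite inE => /predU1P[->|/cov //]; exists s.
exists (g :: S); split.
- by rewrite /= uS andbT; apply: contra gG => /SG.
- by move=> x; rewrite !inE => /predU1P[->|/SG ->]; rewrite ?eqxx ?orbT.
- move=> s s'; rewrite !inE => /predU1P[->|sS] /predU1P[->|s'S] //.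
  + by move=> h; have := nh _ s'S; rewrite h.
  + by rewrite cs => h; have := nh _ sS; rewrite h.
  + exact: sep.
- move=> h; rewrite inE => /predU1P[->|/cov[s sS hs]].
    by exists g => //; rewrite inE eqxx.
  by exists s => //; rewrite inE sS orbT.
Qed.

Section Net.
Variables (R : realType) (m n : nat).
Local Notation V := 'M[R]_(m, n).
Variable B : R -> V -> Prop.

(** [B a x] stands for the inequality norm x <= a of some norm. The family of its
    balls replaces the norm, since the operator norm would be a supremum. *)
Definition norm_balls : Prop :=
  [/\ forall a b x, 0 <= a -> a <= b -> B a x -> B b x,
      forall a b x y, 0 <= a -> 0 <= b -> B a x -> B b y -> B (a + b) (x - y),
      forall a c x, 0 <= a -> 0 <= c -> B a x -> B (c * a) (c *: x),
      exists2 K, 0 < K & forall eta (x : V), 0 <= eta ->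
        (forall i j, `|x i j| <= eta) -> B (K * eta) x &
      forall a (x : V), B a x -> forall i j, `|x i j| <= a].

Hypothesis hB : norm_balls.

Let Bmono a b x : 0 <= a -> a <= b -> B a x -> B b x.
Proof. by case: hB => h _ _ _ _; exact: h. Qed.
Let Bsub a b x y : 0 <= a -> 0 <= b -> B a x -> B b y -> B (a + b) (x - y).
Proof. by case: hB => _ h _ _ _; exact: h. Qed.
Let BZ a c x : 0 <= a -> 0 <= c -> B a x -> B (c * a) (c *: x).
Proof. by case: hB => _ _ h _ _; exact: h. Qed.
Let Bcoord a x : B a x -> forall i j, `|x i j| <= a.
Proof. by case: hB => _ _ _ _; exact. Qed.
Let B0 : B 0 0.
Proof.
case: hB => _ _ _ [K _ hK] _; rewrite -[X in B X _](mulr0 K).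
by apply: hK => // i j; rewrite mxE normr0.
Qed.
Let BN a x : 0 <= a -> B a x -> B a (- x).
Proof. by move=> a0 hx; rewrite -[a]add0r -[- x]add0r; exact: Bsub. Qed.
Let BD a b x y : 0 <= a -> 0 <= b -> B a x -> B b y -> B (a + b) (x + y).
Proof. by move=> a0 b0 hx hy; rewrite -[y]opprK; apply: Bsub => //; exact: BN. Qed.

Section Lattice.
Variable K : R.
Hypothesis K0 : 0 < K.
Hypothesis hK : forall eta (x : V), 0 <= eta -> (forall i j, `|x i j| <= eta) ->
  B (K * eta) x.
Let delta := (16 * K)^-1.
Let delta0 : 0 < delta.
Proof. by rewrite invr_gt0 mulr_gt0. Qed.
Let Kdelta : K * delta = 16^-1.
Proof. by rewrite /delta; field; rewrite lt0r_neq0. Qed.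

Let emb (z : 'M[int]_(m, n)) : V := delta *: map_mx intr z.
Let embD z z' : emb (z + z') = emb z + emb z'.
Proof. by apply/matrixP => i j; rewrite !mxE intrD mulrDr. Qed.
Let embN z : emb (- z) = - emb z.
Proof. by apply/matrixP => i j; rewrite !mxE intrN mulrN. Qed.
Let embB z z' : emb (z - z') = emb z - emb z'.
Proof. by rewrite embD embN. Qed.

Let small (x : V) : (forall i j, `|x i j| <= delta) -> B 16^-1 x.
Proof. by move=> h; rewrite -Kdelta; apply: hK => //; exact: ltW. Qed.

Let round (x : V) : 'M[int]_(m, n) := \matrix_(i, j) Num.floor (x i j / delta).
Let roundP x : B 16^-1 (x - emb (round x)).
Proof.
apply: small => i j; rewrite !mxE.
have := floor_le (x i j / delta); have := floorD1_gt (x i j / delta).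
rewrite ltr_pdivrMr // ler_pdivlMr // intrD mulrDl mul1r => h1 h2.
by rewrite ger0_norm mulrC; lra.
Qed.

Let H : nat := Num.bound (20 * K).
Let box : seq 'M[int]_(m, n) :=
  undup [seq map_mx (fun a : 'I_(H + H).+1 => a%:Z - H%:Z) A
         | A : 'M['I_(H + H).+1]_(m, n)].

Let box_in z : B (5 / 4) (emb z) -> z \in box.
Proof.
move=> hz; rewrite mem_undup; apply/mapP.
have bd i j : `|z i j| <= H%:Z.
  have := Bcoord hz i j; rewrite !mxE normrM (gtr0_norm delta0) -intr_norm => h.
  have h20 : (`|z i j|)%:~R <= 20 * K.
    move: h; rewrite mulrC -ler_pdivlMr // /delta invrK; lra.
  rewrite -(ler_int R); apply: le_trans h20 _; rewrite -pmulrn.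
  by apply/ltW/archi_boundP; rewrite mulr_ge0 // ltW.
exists (\matrix_(i, j) inord (absz (z i j + H%:Z))); first by rewrite mem_enum.
apply/matrixP => i j; rewrite !mxE.
have := bd i j; rewrite ler_norml => /andP[b1 b2].
rewrite inordK; last by lia.
rewrite gez0_abs ?addrK //; lia.
Qed.

Let G a := [seq z <- box | `[< B a (emb z) >]].
Let GP a z : a <= 5 / 4 -> 0 <= a -> (z \in G a) = `[< B a (emb z) >].
Proof.
move=> a5 a0; rewrite mem_filter; case: asboolP => //= h.
by rewrite box_in //; exact: Bmono h.
Qed.
Let Guniq a : uniq (G a).
Proof. by rewrite filter_uniq // undup_uniq. Qed.

Let close (z z' : 'M[int]_(m, n)) := `[< B 2^-1 (emb (z - z')) >].
Let close_refl : reflexive close.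
Proof.
move=> z; apply/asboolP; rewrite subrr.
have -> : emb 0 = 0 by apply/matrixP => i j; rewrite !mxE mulr0.
exact: Bmono B0.
Qed.
Let close_sym : symmetric close.
Proof.
have h z z' : close z z' -> close z' z.
  move/asboolP => hz; apply/asboolP; rewrite -opprB embN; apply: BN => //.
by move=> z z'; apply/idP/idP; exact: h.
Qed.

(** Euclidean division of the lattice coordinates by 8 sends the larger ball
    into the smaller one, up to a rounding error, and the remainders tell apart
    the points with the same quotient. This replaces the comparison of volumes. *)
Let count_dilate : (size (G (5 / 4)) <= size (G (1 / 4)) * 8 ^ (m * n))%N.
Proof.
pose q (z : 'M[int]_(m, n)) : 'M[int]_(m, n) := map_mx (divz^~ 8) z.
pose re (z : 'M[int]_(m, n)) : 'M['I_8]_(m, n) :=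
  map_mx (fun a => inord `|(a %% 8)%Z|%N) z.
have zE (z : 'M[int]_(m, n)) i j : z i j = q z i j * 8 + (re z i j)%:Z.
  by rewrite !mxE inordK; lia.
have injqr : injective (fun z => (q z, re z)).
  move=> z z' e; have e1 : q z = q z' := congr1 fst e.
  have e2 : re z = re z' := congr1 snd e.
  by apply/matrixP => i j; rewrite (zE z) (zE z') e1 e2.
have -> : (8 ^ (m * n))%N = size (enum {: 'M['I_8]_(m, n)})
  by rewrite -cardE card_mx card_ord.
rewrite -(size_map (fun z => (q z, re z))) -(size_allpairs pair).
apply: uniq_leq_size; first by rewrite map_inj_uniq.
move=> w /mapP[z]; rewrite GP ?divr_ge0 // => /asboolP hz ->.
apply/allpairsP; exists (q z, re z); split => //; last by rewrite mem_enum.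
rewrite GP ?divr_ge0 //; last by lra.
apply/asboolP => /=.
have -> : emb (q z) = 8^-1 *: emb z -
    delta *: (8^-1 *: map_mx (fun a : 'I_8 => (a : nat)%:R) (re z)).
  apply/matrixP => i j; have := zE z i j.
  rewrite [emb _ _ _]mxE [map_mx intr _ _ _]mxE => zij.
  have -> : (8^-1 *: emb z -
      delta *: (8^-1 *: map_mx (fun a : 'I_8 => (a : nat)%:R) (re z)) : V) i j
     = 8^-1 * (delta * (z i j)%:~R) - delta * (8^-1 * (re z i j)%:R) by rewrite !mxE.
  by rewrite zij intrD intrM; field.
have h1 : B (8^-1 * (5 / 4)) (8^-1 *: emb z) by apply: BZ.
have h2 : B 16^-1 (delta *: (8^-1 *: map_mx (fun a : 'I_8 => (a : nat)%:R) (re z))).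
  apply: small => i j; rewrite !mxE normrM (gtr0_norm delta0) -[X in _ <= X]mulr1.
  rewrite ler_wpM2l ?(ltW delta0) // ger0_norm ?mulr_ge0 // mulrC ler_pdivrMr // mul1r
    ler_nat.
  exact: ltnW.
by apply: Bmono (Bsub _ _ h1 h2); lra.
Qed.

(** The translates of the ball of radius 1/4 by points at mutual distance more
    than 1/2 are disjoint and lie in the ball of radius 5/4. *)
Let count_packing (S : seq 'M[int]_(m, n)) : uniq S -> {subset S <= G 1} ->
  {in S &, forall s s', close s s' -> s = s'} -> (size S <= 8 ^ (m * n))%N.
Proof.
move=> uS SG sep.
have q0 : 0 <= 1 / 4 :> R by rewrite divr_ge0.
have q1 : 1 / 4 <= 5 / 4 :> R by lra.
have q2 : 1 <= 5 / 4 :> R by lra.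
have q3 : 1 / 4 + 1 / 4 <= 2^-1 :> R by lra.
have G0 : (0 < size (G (1 / 4)))%N.
  have : (0 : 'M[int]_(m, n)) \in G (1 / 4); last by case: (G _).
  rewrite GP //; apply/asboolP; have -> : emb 0 = 0 by apply/matrixP => i j;
    rewrite !mxE mulr0.
  exact: Bmono B0.
rewrite -(leq_pmul2r G0) [X in (_ <= X)%N]mulnC; apply: leq_trans count_dilate.
rewrite -(size_allpairs +%R); apply: uniq_leq_size.
  apply: allpairs_uniq => // -[s g] [s' g'] /allpairsP[[a b] /= [aS bG [-> ->]]].
  move=> /allpairsP[[a' b'] /= [a'S b'G [-> ->]]] e.
  move: bG b'G; rewrite !GP //.
  move=> /asboolP hb /asboolP hb'.
  have ea : a = a'.
    apply: sep => //; apply/asboolP.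
    have -> : a - a' = b' - b.
      by apply/eqP; rewrite subr_eq addrAC -subr_eq opprK e addrC.
    by rewrite embB; apply: Bmono q3 (Bsub _ _ hb' hb); rewrite ?addr_ge0.
  by move: e; rewrite ea => /addrI ->.
move=> w /allpairsP[[s g] /= [/SG + + ->]].
rewrite !GP //.
move=> /asboolP hs /asboolP hg; apply/asboolP.
by rewrite embD; apply: Bmono (BD _ _ hs hg); lra.
Qed.

Lemma net_approx_aux : exists (I : finType) (u : I -> V),
  [/\ (#|I| <= 8 ^ (m * n))%N, forall i, B 1 (u i) &
      forall x, B 1 x -> exists i, B (3 / 4) (x - u i)].
Proof.
have [S [uS SG sep cov]] := maximal_separated (Guniq 1) close_refl close_sym.
exists 'I_(size S), (fun i => emb (tnth (in_tuple S) i)); split.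
- by rewrite card_ord; exact: count_packing.
- move=> i; have := SG _ (mem_tnth i (in_tuple S)).
  by rewrite GP //; [move/asboolP|lra].
move=> x hx.
(* shrinking [x] leaves room for the rounding error inside the unit ball *)
pose y := (15 / 16) *: x.
have hy : B (15 / 16) y by rewrite -[X in B X _]mulr1; apply: BZ.
have hz : round y \in G 1.
  rewrite GP //; last by lra.
  apply/asboolP; have -> : emb (round y) = y - (y - emb (round y)) by rewrite subKr.
  by apply: Bmono (Bsub _ _ hy (roundP y)); lra.
have [s sS /asboolP hs] := cov _ hz.
have /tnthP[i0 si] : s \in in_tuple S by [].
exists i0.
have -> : x - emb (tnth (in_tuple S) i0) =
    ((x - y) + (y - emb (round y))) + emb (round y - s).
  by rewrite embB -si !subrKA.
have h0 : B (1 / 16) (x - y).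
  have -> : x - y = (1 / 16) *: x.
    by rewrite /y -[X in X - _]scale1r -scalerBl; congr (_ *: _); lra.
  by rewrite -[X in B X _]mulr1; apply: BZ.
by apply: Bmono (BD _ _ (BD _ _ h0 (roundP y)) hs); lra.
Qed.
End Lattice.

Lemma net_approx : exists (I : finType) (u : I -> V),
  [/\ (#|I| <= 8 ^ (m * n))%N, forall i, B 1 (u i) &
      forall x, B 1 x -> exists i, B (3 / 4) (x - u i)].
Proof. by case: (hB) => _ _ _ [K K0 hK] _; exact: net_approx_aux K0 hK. Qed.

(** A point of the unit ball is a point of the net plus 3/4 of another point of
    the unit ball, so the supremum of [f] is at most [c] plus 3/4 of itself. *)
Lemma net_linear : exists (I : finType) (u : I -> V),
  [/\ (#|I| <= 8 ^ (m * n))%N, forall i, B 1 (u i) &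
      forall (f : V -> R) c, scalar f -> (forall i, f (u i) <= c) ->
        forall x, B 1 x -> f x <= 4 * c].
Proof.
have [I [u [cI uB app]]] := net_approx.
exists I, u; split => // f c fl fc.
have f0 : f 0 = 0 by have := fl 1 0 0; rewrite scale1r addr0 mul1r => h; lra.
have fD : {morph f : x y / x + y} by move=> x y; have := fl 1 x y;
  rewrite scale1r mul1r.
have fZ a x : f (a *: x) = a * f x by have := fl a x 0; rewrite !addr0 f0 addr0.
pose A := [set f x | x in [set x | B 1 x]].
have hA : has_sup A.
  split; first by exists (f 0), 0 => //=; exact: Bmono B0.
  exists (\sum_i \sum_j `|f (delta_mx i j)|) => _ [x /= hx <-].
  rewrite [x]matrix_sum_delta (big_morph f fD f0); apply: ler_sum => i _.
  rewrite (big_morph f fD f0); apply: ler_sum => j _.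
  rewrite fZ; apply: le_trans (ler_norm _) _; rewrite normrM.
  by rewrite -[X in _ <= X]mul1r ler_wpM2r // Bcoord.
have hM x : B 1 x -> f x <= sup A by move=> hx; apply: ub_le_sup; [case: hA|exists x].
have : sup A <= c + 3 / 4 * sup A.
  apply: ge_sup; first by case: hA.
  move=> _ [x /= hx <-]; have [i hi] := app x hx.
  have -> : x = u i + (3 / 4) *: ((4 / 3) *: (x - u i)).
    by rewrite scalerA (_ : 3 / 4 * (4 / 3) = 1) ?scale1r ?subrKC //; lra.
  rewrite fD fZ; apply: lerD => //; rewrite ler_wpM2l //.
  by apply: hM; have := BZ (c := 4 / 3) _ _ hi; rewrite (_ : 4 / 3 * (3 / 4) = 1);
    [apply|lra].
by move=> h x /hM; lra.
Qed.

End Net.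

(** * Reduction of multilinear functionals to nets *)

Section Balls.
Variable R : realType.

(** Operator norm at most [a]. *)
Definition opball m n (a : R) (M : 'M[R]_(m, n)) : Prop :=
  0 <= a /\ forall x : 'M[R]_(n, 1), sqF (M *m x) <= a ^+ 2 * sqF x.

Definition frobball m n (a : R) (M : 'M[R]_(m, n)) : Prop := 0 <= a /\ sqF M <= a ^+ 2.

Lemma sqF_le_entries m n (M : 'M[R]_(m, n)) (eta : R) : 0 <= eta ->
  (forall i j, `|M i j| <= eta) -> sqF M <= ((m * n)%:R + 1) ^+ 2 * eta ^+ 2.
Proof.
move=> e0 h; apply: (@le_trans _ _ ((m * n)%:R * eta ^+ 2)).
  rewrite sqFE; apply: le_trans (_ : \sum_(i < m) \sum_(j < n) eta ^+ 2 <= _).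
    apply: ler_sum => i _; apply: ler_sum => j _.
    by rewrite -real_normK ?num_real // ler_sqr ?nnegrE.
  have -> : \sum_(i < m) \sum_(j < n) eta ^+ 2 = (m * n)%:R * eta ^+ 2; last by [].
  by rewrite !sumr_const !card_ord -mulrnA mulr_natl mulnC.
apply: ler_wpM2r; first exact: sqr_ge0.
have : 0 <= (m * n)%:R :> R by []. by move=> ?; nra.
Qed.

Lemma sqF_ge_entry m n (M : 'M[R]_(m, n)) i j : M i j ^+ 2 <= sqF M.
Proof.
rewrite sqFE (bigD1 i) //= (bigD1 j) //= -addrA lerDl addr_ge0 //.
  by apply: sumr_ge0 => k _; rewrite sqr_ge0.
by apply: sumr_ge0 => k _; apply: sumr_ge0 => l _; rewrite sqr_ge0.
Qed.

Lemma norm_balls_frobball m n : norm_balls (@frobball m n).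
Proof.
split.
- move=> a b x a0 ab [_ h]; split; first exact: le_trans ab.
  by apply: le_trans h _; rewrite ler_sqr ?nnegrE // (le_trans a0).
- move=> a b x y a0 b0 [_ hx] [_ hy]; split; first exact: addr_ge0.
  by rewrite -[X in _ <= X]mulr1; apply: sqF_triangle; rewrite ?mulr1.
- move=> a c x a0 c0 [_ h]; split; first exact: mulr_ge0.
  by rewrite sqFZ exprMn ler_wpM2l // sqr_ge0.
- exists ((m * n)%:R + 1); first by rewrite ltr_wpDl.
  move=> eta x e0 h; split; first by rewrite mulr_ge0 // addr_ge0.
  by rewrite exprMn; exact: sqF_le_entries.
- move=> a x [a0 h] i j; rewrite -(@ler_pXn2r _ 2) ?nnegrE // real_normK ?num_real //.
  exact: le_trans (sqF_ge_entry x i j) h.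
Qed.

Lemma norm_balls_opball m n : norm_balls (@opball m n).
Proof.
split.
- move=> a b M a0 ab [_ h]; split; first exact: le_trans ab.
  move=> x; apply: le_trans (h x) _; rewrite ler_wpM2r ?sqF_ge0 //.
  by rewrite ler_sqr ?nnegrE // (le_trans a0).
- move=> a b M N a0 b0 [_ hM] [_ hN]; split; first exact: addr_ge0.
  by move=> x; rewrite mulmxBl; apply: sqF_triangle; rewrite ?sqF_ge0.
- move=> a c M a0 c0 [_ h]; split; first exact: mulr_ge0.
  move=> x; rewrite -scalemxAl sqFZ exprMn -[X in _ <= X]mulrA; apply: ler_wpM2l (h x).
  exact: sqr_ge0.
- exists ((m * n)%:R + 1); first by rewrite ltr_wpDl.
  move=> eta M e0 h; split; first by rewrite mulr_ge0 // addr_ge0.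
  move=> x; apply: le_trans (sqF_mul _ _) _; rewrite ler_wpM2r ?sqF_ge0 //.
  by rewrite exprMn; exact: sqF_le_entries.
- move=> a M [a0 h] i j; rewrite -(@ler_pXn2r _ 2) ?nnegrE // real_normK ?num_real //.
  have := h (delta_mx j 0); rewrite -colE.
  have -> : sqF (delta_mx j 0 : 'M[R]_(n, 1)) = 1.
    rewrite sqFE (bigD1 j) //= big_ord1 mxE !eqxx big1 ?addr0 ?expr1n //.
    by move=> k kj; rewrite big_ord1 mxE (negbTE kj) expr0n.
  rewrite mulr1; apply: le_trans.
  by apply: le_trans (sqF_ge_entry _ i 0); rewrite mxE.
Qed.

Lemma opball_mx m n k (M : 'M[R]_(m, n)) (A : 'M[R]_(n, k)) :
  opball 1 M -> sqF (M *m A) <= sqF A.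
Proof.
move=> [_ h]; rewrite (sqF_cols (M *m A)) (sqF_cols A); apply: ler_sum => j _.
by have := h (col j A); rewrite expr1n mul1r !colE mulmxA.
Qed.

Lemma opball_orth m n (M : 'M[R]_(m, n)) : M^T *m M = 1%:M -> opball 1 M.
Proof. by move=> h; split => // x; rewrite sqF_iso // expr1n mul1r. Qed.

Lemma opball_mul m n k (M : 'M[R]_(m, n)) (N : 'M[R]_(n, k)) :
  opball 1 M -> opball 1 N -> opball 1 (M *m N).
Proof.
move=> hM hN; split => // x; rewrite expr1n mul1r -mulmxA.
exact: le_trans (opball_mx _ hM) (opball_mx _ hN).
Qed.

Lemma opball_cast m m' n (M : 'M[R]_(m, n)) : m = m' -> opball 1 M ->
  opball 1 (mxreshape M : 'M[R]_(m', n)).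
Proof. by move=> e; subst m'; rewrite mxreshape_id. Qed.

Lemma opball_tens1 q m n (M : 'M[R]_(m, n)) : opball 1 M ->
  opball 1 ((1%:M : 'M[R]_q) *t M).
Proof.
move=> hM; split => // x; rewrite expr1n mul1r.
have -> : x = mxreshape (mxreshape x : 'M[R]_(n, 1 * q)).
  by rewrite mxreshape_comp ?mxreshape_id //; ring.
rewrite sqF_reshape_mull; apply: le_trans (opball_mx _ hM) _.
by rewrite [X in _ <= X]sqF_reshape //; ring.
Qed.

Lemma opball_tensr1 q m n (M : 'M[R]_(m, n)) : opball 1 M ->
  opball 1 (M *t (1%:M : 'M[R]_q)).
Proof.
move=> hM; split => // x; rewrite expr1n mul1r.
rewrite -sqF_trmx trmx_mul trmx_tens trmx1 -sqF_reshape_mulr -sqF_trmx trmx_mul trmxK.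
apply: le_trans (opball_mx _ hM) _; rewrite sqF_trmx sqF_reshape; last by ring.
by rewrite sqF_trmx.
Qed.

End Balls.

Section Slots.
Variables (R : realType) (a b : nat -> nat).
Implicit Types W : forall k, 'M[R]_(a k, b k).

(** One factor at a time: as a function of that factor alone the functional is
    linear, and [net_linear] costs a factor 4. The functional may depend on the
    factors in [s] only, as nothing is known about the others. *)
Lemma slots_net (s : seq nat) : uniq s ->
  exists (I : finType) (w : I -> forall k, 'M[R]_(a k, b k)),
  [/\ (#|I| <= 8 ^ (\sum_(k <- s) a k * b k))%N,
      forall i k, opball 1 (w i k) &
      forall (S : (forall k, 'M[R]_(a k, b k)) -> R) (c : R),
        (forall W k, k \in s -> scalar (fun h => S (upd W (i := k) h))) ->
        (forall W W', (forall k, k \in s -> W k = W' k) -> S W = S W') ->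
        (forall i, S (w i) <= c) ->
        forall W, (forall k, k \in s -> opball 1 (W k)) -> S W <= 4 ^+ size s * c].
Proof.
elim: s => [_|k s IH] /=.
  exists unit, (fun _ _ => 0); split.
  - by rewrite card_unit big_nil.
  - by move=> i k; split => // x; rewrite mul0mx sqF0 mulr_ge0 ?sqr_ge0 ?sqF_ge0.
  - by move=> S c _ hd hc W _; rewrite mul1r -(hd (fun=> 0)) //; exact: hc tt.
case/andP=> ks /IH[I [w [cI wB wS]]].
have [J [u [cJ uB uS]]] := net_linear (norm_balls_opball R (a k) (b k)).
exists (I * J)%type, (fun ij => upd (w ij.1) (u ij.2)); split.
- by rewrite card_prod big_cons expnD mulnC leq_mul.
- move=> [i j] l /=; have [->|kl] := eqVneq l k; first by rewrite dfwith_in.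
  by rewrite dfwith_out // eq_sym.
move=> S c hl hd hc W hW.
pose S1 W' := S (upd W' (W k)).
have -> : S W = S1 W.
  by apply: hd => l _; case: (eqVneq k l) => [<-|kl]; rewrite ?dfwith_in ?dfwith_out.
rewrite exprSr -mulrA; apply: wS.
- move=> W' l ls h0 h1 h2.
  have E h : S1 (upd W' (i := l) h) = S (upd (upd W' (W k)) (i := l) h).
    apply: hd => x _; have [lx|lx] := eqVneq l x.
      subst x; rewrite dfwith_in dfwith_out ?dfwith_in //.
      by apply: contraNneq ks => ->.
    rewrite [RHS]dfwith_out //; case: (eqVneq k x) => [kx|kx].
      by subst x; rewrite !dfwith_in.
    by rewrite !dfwith_out.
  by rewrite !E; apply: hl; rewrite inE ls orbT.
- move=> W' W'' h; apply: hd => x; rewrite inE; case: (eqVneq k x) => [<- _|kx].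
    by rewrite !dfwith_in.
  by move=> /= /h e; rewrite !dfwith_out.
- move=> i; apply: (uS (fun h => S (upd (w i) h))).
  + by apply: hl; rewrite inE eqxx.
  + by move=> j; exact: (hc (i, j)).
  + by apply: hW; rewrite inE eqxx.
- by move=> l ls; apply: hW; rewrite inE ls orbT.
Qed.

End Slots.

Section Multilinear.
Variables (R : realType) (d : nat) (p r : nat -> nat).
Implicit Types (U : forall k, 'M[R]_(p k * r k.-1, r k))
               (V : forall k, 'M[R]_(r k * p k, r k.-1)).

Lemma left_basis_ext U U' j : (forall k, k \in iota 1 j -> U k = U' k) ->
  left_basis U j = left_basis U' j.
Proof.
elim: j => // j IH h; rewrite !left_basisS /left_lift IH ?h //;
  first by rewrite mem_iota; lia.
by move=> k hk; apply: h; move: hk; rewrite !mem_iota; lia.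
Qed.

Lemma tens_linr (q m n : nat) (c : R) (A B : 'M[R]_(m, n)) :
  (1%:M : 'M[R]_q) *t (c *: A + B) = c *: (1%:M *t A) + 1%:M *t B.
Proof. by apply/matrixP => i j; rewrite !mxE; ring. Qed.

Lemma tens_linl (q m n : nat) (c : R) (A B : 'M[R]_(m, n)) :
  (c *: A + B) *t (1%:M : 'M[R]_q) = c *: (A *t 1%:M) + B *t 1%:M.
Proof. by apply/matrixP => i j; rewrite !mxE; ring. Qed.

Lemma left_basis_lin U j k (c : R) h h' : k \in iota 1 j ->
  left_basis (upd U (i := k) (c *: h + h')) j =
  c *: left_basis (upd U (i := k) h) j + left_basis (upd U (i := k) h') j.
Proof.
elim: j => // j IH; rewrite mem_iota => hk; rewrite !left_basisS /left_lift.
have [kj|kj] := eqVneq k j.+1.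
  subst k; rewrite !dfwith_in.
  have E h0 : left_basis (upd U (i := j.+1) h0) j = left_basis U j.
    by apply: left_basis_ext => l; rewrite mem_iota => hl; rewrite dfwith_out //; lia.
  by rewrite !E mulmxDr -scalemxAr mxreshapeD mxreshapeZ.
rewrite !dfwith_out // IH; last by rewrite mem_iota; lia.
by rewrite tens_linr mulmxDl -scalemxAl mxreshapeD mxreshapeZ.
Qed.

Lemma const1_opball m k : m = 1%N -> k = 1%N -> opball 1 (const_mx 1 : 'M[R]_(m, k)).
Proof. by move=> m1 k1; apply: opball_orth; exact: const1_orth. Qed.

Lemma left_basis_opball U j : r 0 = 1%N -> (forall k, k \in iota 1 j -> opball 1 (U k)) ->
  opball 1 (left_basis U j).
Proof.
move=> r0; elim: j => [|j IH] h.
  by apply: const1_opball; rewrite // /dimprod big_geq.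
apply: opball_cast; first exact/esym/dimprod_row.
apply: opball_mul; last by apply: (h j.+1); rewrite mem_iota; lia.
apply/opball_tens1/IH => k hk; apply: h; move: hk; rewrite !mem_iota; lia.
Qed.

Lemma right_basis_ext V V' j n : (forall k, k \in iota j.+1 n -> V k = V' k) ->
  right_basis d V j n = right_basis d V' j n.
Proof.
elim: n j => //= n IH j h; rewrite (IH j.+1) ?h //; first by rewrite mem_head.
by move=> k hk; apply: h; rewrite inE hk orbT.
Qed.

Lemma right_basis_lin V j n k (c : R) h h' : k \in iota j.+1 n ->
  right_basis d (upd V (i := k) (c *: h + h')) j n =
  c *: right_basis d (upd V (i := k) h) j n + right_basis d (upd V (i := k) h') j n.
Proof.
elim: n j => //= n IH j; rewrite inE => hk.
have [kj|kj] := eqVneq k j.+1.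
  subst k; rewrite !dfwith_in.
  have E h0 : right_basis d (upd V (i := j.+1) h0) j.+1 n = right_basis d V j.+1 n.
    by apply: right_basis_ext => l; rewrite mem_iota => hl; rewrite dfwith_out //; lia.
  by rewrite !E mulmxDr -scalemxAr mxreshapeD mxreshapeZ.
rewrite !dfwith_out // IH; last by move: hk; rewrite (negbTE kj).
by rewrite tens_linl mulmxDl -scalemxAl mxreshapeD mxreshapeZ.
Qed.

Lemma right_basis_opball V j n : r d = 1%N -> (j + n = d)%N ->
  (forall k, k \in iota j.+1 n -> opball 1 (V k)) -> opball 1 (right_basis d V j n).
Proof.
move=> rd; elim: n j => [|n IH] j jn h.
  have jE : j = d by rewrite -jn addn0.
  by subst j; apply: const1_opball; rewrite // /dimprod big_geq.
have jd : (j < d)%N by lia.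
apply: opball_cast; first exact/esym/dimprod_col.
apply: opball_mul; last by apply: (h j.+1); rewrite /= mem_head.
apply/opball_tensr1/IH; first by lia.
by move=> k hk; apply: h; rewrite /= inE hk orbT.
Qed.

End Multilinear.

(** * Finite families of tensors that control the noise *)

Section Noise.
Variables (R : realType) (d : nat) (p r : nat -> nat).
Hypothesis r0 : r 0 = 1%N.
Implicit Types (U : forall k, 'M[R]_(p k * r k.-1, r k))
               (V : forall k, 'M[R]_(r k * p k, r k.-1)) (Z : tensor R d p).

Lemma sqF_normalize m n (A : 'M[R]_(m, n)) : frobball 1 ((Num.sqrt (sqF A))^-1 *: A).
Proof.
split=> //; rewrite sqFZ exprVn sqr_sqrtr ?sqF_ge0 // expr1n.
have [->|A0] := eqVneq (sqF A) 0; first by rewrite mulr0.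
by rewrite mulVf.
Qed.

Lemma dotF_normalize m n (A : 'M[R]_(m, n)) :
  dotF ((Num.sqrt (sqF A))^-1 *: A) A = Num.sqrt (sqF A).
Proof.
rewrite dotFZl -/(sqF A).
have [->|A0] := eqVneq (sqF A) 0; first by rewrite sqrtr0 mulr0.
have s0 : Num.sqrt (sqF A) != 0 by rewrite sqrtr_eq0 -ltNge lt_def A0 sqF_ge0.
by rewrite -[X in _ * X](sqr_sqrtr (sqF_ge0 A)) expr2 mulrA mulVf // mul1r.
Qed.

(** The inner product of this matrix with an unfolding of the noise is the inner
    product of [N] with the contraction of the noise by the bases; its supremum
    over [N] in the unit ball is the Frobenius norm of that contraction. *)
Definition tt_probe j n U (N : 'M[R]_(p j.+1 * r j, r j.+1)) V :
    'M[R]_(p j.+1 * dimprod p 1 j, dimprod p j.+2 d) :=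
  left_lift U j *m N *m (right_basis d V j.+1 n)^T.

(** The analogue of [tt_probe] for an operator norm: the middle factor and the
    right basis are replaced by two vectors. *)
Definition init_probe j U (u : 'M[R]_(p j.+1 * r j, 1))
    (v : 'M[R]_(dimprod p j.+2 d, 1)) :
    'M[R]_(p j.+1 * dimprod p 1 j, dimprod p j.+2 d) :=
  left_lift U j *m u *m v^T.

Let left_lift_lin U j k (c : R) h h' : k \in iota 1 j ->
  left_lift (upd U (i := k) (c *: h + h')) j =
    c *: left_lift (upd U (i := k) h) j + left_lift (upd U (i := k) h') j.
Proof. by move=> hk; rewrite /left_lift left_basis_lin // tens_linr. Qed.

(** The exponent of 8 is the number of entries of all factors together: those of
    the left basis, of the middle matrix and of the right basis. *)
Lemma tt_probe_net j n : r d = 1%N -> (j.+1 + n = d)%N ->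
  exists (I : finType) (w : I -> tindex d p -> R),
  [/\ (#|I| <= 8 ^ (\sum_(1 <= k < d.+1) p k * r k.-1 * r k))%N,
      forall i, \sum_t w i t ^+ 2 <= 1 &
      forall Z c, 0 <= c -> (forall i, \sum_t Z t * w i t <= c) ->
        forall U V, orthU d U -> orthV d V ->
        sqF ((left_lift U j)^T *m rowsplit j Z *m right_basis d V j.+1 n) <=
          (4 ^+ d * c) ^+ 2].
Proof.
move=> rd jn; have jd : (j < d)%N by lia.
have [IU [wU [cU BU SU]]] := slots_net R (fun k => p k * r k.-1)%N r (iota_uniq 1 j).
have [IV [wV [cV BV SV]]] := slots_net R (fun k => r k * p k)%N
  (fun k => r k.-1) (iota_uniq j.+2 n).
have [IN [uN [cN BN SN]]] := net_linear (norm_balls_frobball R (p j.+1 * r j) (r j.+1)).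
exists (IU * IN * IV)%type, (fun x =>
  tensor_of_mx (tt_probe n (wU x.1.1) (uN x.1.2) (wV x.2))).
split.
- have -> : (\sum_(1 <= k < d.+1) p k * r k.-1 * r k =
     \sum_(k <- iota 1 j) p k * r k.-1 * r k + p j.+1 * r j * r j.+1 +
     \sum_(k <- iota j.+2 n) r k * p k * r k.-1)%N.
    rewrite (big_cat_nat (n := j.+1)) //; last by lia.
    rewrite [in LHS](big_ltn (m := j.+1)); last by lia.
    rewrite /= addnA /index_iota !subSS !subn0; congr (_ + _ + _)%N.
    have -> : (d - j.+1 = n)%N by lia.
    by apply: eq_bigr => k _; ring.
  by rewrite !card_prod !expnD !leq_mul.
- move=> [[iu iN] iv] /=; apply: le_trans (tensor_of_mx_sq _ _) _;
    first exact: dimprod_total.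
  rewrite /tt_probe -mulmxA; apply: le_trans (opball_mx _ (opball_tens1 _
    (left_basis_opball r0 _))) _ => //.
  rewrite -sqF_trmx trmx_mul trmxK;
    apply: le_trans (opball_mx _ (right_basis_opball rd _ _)) _ => //.
  by rewrite sqF_trmx; have [_] := BN iN; rewrite expr1n.
move=> Z c c0 hc U V hU hV.
pose S U N V := dotF (rowsplit j Z) (tt_probe n U N V).
have hc' iu iN iv : S (wU iu) (uN iN) (wV iv) <= c.
  by have := hc (iu, iN, iv); rewrite (tensor_of_mx_dot (k := j.+1)) //;
    exact: dimprod_total.
have s1 iu iN V' : (forall k, k \in iota j.+2 n -> opball 1 (V' k)) ->
    S (wU iu) (uN iN) V' <= 4 ^+ n * c.
  move=> hV'; rewrite -[X in 4 ^+ X](size_iota j.+2 n).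
  apply: (SV (fun V0 => S (wU iu) (uN iN) V0)) => //.
  - move=> W k hk a x y.
    by rewrite /S /tt_probe right_basis_lin // raddfD /= linearZ /= mulmxDr -scalemxAr
      dotFDr dotFZr.
  - by move=> W W' hW; rewrite /S /tt_probe (right_basis_ext d hW).
have s2 iu N V' : frobball 1 N -> (forall k, k \in iota j.+2 n -> opball 1 (V' k)) ->
    S (wU iu) N V' <= 4 * (4 ^+ n * c).
  move=> hN hV'; apply: (SN (fun N0 => S (wU iu) N0 V')) hN => //.
  - move=> a x y.
    by rewrite /S /tt_probe mulmxDr mulmxDl -scalemxAr -scalemxAl dotFDr dotFZr.
  - by move=> iN; exact: s1.
have s3 U' N V' : (forall k, k \in iota 1 j -> opball 1 (U' k)) -> frobball 1 N ->
    (forall k, k \in iota j.+2 n -> opball 1 (V' k)) ->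
    S U' N V' <= 4 ^+ d * c.
  move=> hU' hN hV'.
  have -> : 4 ^+ d * c = 4 ^+ size (iota 1 j) * (4 * (4 ^+ n * c)).
    by rewrite size_iota -jn addSnnS exprD exprS !mulrA.
  apply: (SU (fun U0 => S U0 N V')) => //.
  - move=> W k hk a x y.
    by rewrite /S /tt_probe left_lift_lin // !mulmxDl -!scalemxAl dotFDr dotFZr.
  - by move=> W W' hW; rewrite /S /tt_probe /left_lift (left_basis_ext hW).
  - by move=> iu; exact: s2.
set G := _ *m right_basis d V j.+1 n.
have hU1 k : k \in iota 1 j -> opball 1 (U k).
  by rewrite mem_iota => hk; apply/opball_orth/hU; lia.
have hV1 k : k \in iota j.+2 n -> opball 1 (V k).
  by rewrite mem_iota => hk; apply/opball_orth/hV; lia.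
have := s3 U _ V hU1 (sqF_normalize G) hV1.
rewrite /S /tt_probe dotFC dotF_mulr trmxK dotF_mull mulmxA -/G dotF_normalize => h.
rewrite -[X in X <= _](sqr_sqrtr (sqF_ge0 G)) ler_pXn2r ?nnegrE ?sqrtr_ge0 //.
by rewrite mulr_ge0 // exprn_ge0.
Qed.

(** The modes after [j.+1] are not compressed yet, whence their full dimension
    in the exponent of 8. *)
Lemma init_probe_net j : (j.+1 < d)%N ->
  exists (I : finType) (w : I -> tindex d p -> R),
  [/\ (#|I| <= 8 ^ (\sum_(1 <= k < j.+1) p k * r k.-1 * r k + p j.+1 * r j
                   + dimprod p j.+2 d))%N,
      forall i, \sum_t w i t ^+ 2 <= 1 &
      forall Z c, 0 <= c -> (forall i, \sum_t Z t * w i t <= c) ->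
        forall U, orthU d U -> forall x : 'M[R]_(_, 1),
        sqF ((left_lift U j)^T *m rowsplit j Z *m x) <= (4 ^+ d * c) ^+ 2 * sqF x].
Proof.
move=> jd; have jd' := ltnW jd.
have [IU [wU [cU BU SU]]] := slots_net R (fun k => p k * r k.-1)%N r (iota_uniq 1 j).
have [IN [uN [cN BN SN]]] := net_linear (norm_balls_frobball R (p j.+1 * r j) 1).
have [IM [uM [cM BM SM]]] := net_linear (norm_balls_frobball R (dimprod p j.+2 d) 1).
exists (IU * IN * IM)%type, (fun x =>
  tensor_of_mx (init_probe (wU x.1.1) (uN x.1.2) (uM x.2))).
split.
- rewrite !card_prod !expnD !leq_mul //; first by rewrite /index_iota subSS subn0.
  + by rewrite muln1 in cN.
  + by rewrite muln1 in cM.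
- move=> [[iu iN] iM] /=; apply: le_trans (tensor_of_mx_sq _ _) _;
    first exact: dimprod_total.
  rewrite /init_probe -mulmxA;
    apply: le_trans (opball_mx _ (opball_tens1 _ (left_basis_opball r0 _))) _ => //.
  apply: le_trans (sqF_mul _ _) _; rewrite sqF_trmx.
  have [_] := BN iN; have [_] := BM iM; rewrite expr1n => h1 h2.
  by rewrite -[X in _ <= X]mulr1; apply: ler_pM; rewrite ?sqF_ge0.
move=> Z c c0 hc U hU x.
pose S U u v := dotF (rowsplit j Z) (init_probe U u v).
have hc' iu iN iM : S (wU iu) (uN iN) (uM iM) <= c.
  by have := hc (iu, iN, iM); rewrite (tensor_of_mx_dot (k := j.+1)) //;
    exact: dimprod_total.
have s1 iu iN v : frobball 1 v -> S (wU iu) (uN iN) v <= 4 * c.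
  move=> hv; apply: (SM (fun v0 => S (wU iu) (uN iN) v0)) hv => //.
  move=> a v1 v2.
  by rewrite /S /init_probe raddfD /= linearZ /= mulmxDr -scalemxAr dotFDr dotFZr.
have s2 iu u v : frobball 1 u -> frobball 1 v -> S (wU iu) u v <= 4 * (4 * c).
  move=> hu hv; apply: (SN (fun u0 => S (wU iu) u0 v)) hu => //.
  - move=> a v1 v2.
    by rewrite /S /init_probe mulmxDr mulmxDl -scalemxAr -scalemxAl dotFDr dotFZr.
  - by move=> iN; exact: s1.
have s3 U' u v : (forall k, k \in iota 1 j -> opball 1 (U' k)) ->
    frobball 1 u -> frobball 1 v ->
    S U' u v <= 4 ^+ d * c.
  move=> hU' hu hv; apply: (@le_trans _ _ (4 ^+ size (iota 1 j) * (4 * (4 * c)))).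
    apply: (SU (fun U0 => S U0 u v)) => //.
    - move=> W k hk a x1 x2.
      by rewrite /S /init_probe left_lift_lin // !mulmxDl -!scalemxAl dotFDr dotFZr.
    - by move=> W W' hW; rewrite /S /init_probe /left_lift (left_basis_ext hW).
    - by move=> iu; exact: s2.
  rewrite size_iota !mulrA -!exprSr; apply: ler_wpM2r => //.
  by apply: ler_weXn2l => //; rewrite ler1n.
have hU1 k : k \in iota 1 j -> opball 1 (U k).
  by rewrite mem_iota => hk; apply/opball_orth/hU; lia.
set G := _ *m x.
have := s3 U _ _ hU1 (sqF_normalize G) (sqF_normalize x).
rewrite /S /init_probe dotFC dotF_mulr trmxK dotF_mull mulmxA -scalemxAr -/G.
rewrite dotFZr dotF_normalize => h.
have [x0|x0] := eqVneq (sqF x) 0.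
  by rewrite /G (sqF_eq0 x0) mulmx0 !sqF0 mulr0.
have sx : 0 < Num.sqrt (sqF x) by rewrite sqrtr_gt0 lt_def x0 sqF_ge0.
move: h; rewrite mulrC ler_pdivrMr // => h.
have c4 : 0 <= 4 ^+ d * c by rewrite mulr_ge0 // exprn_ge0.
rewrite -[X in X <= _](sqr_sqrtr (sqF_ge0 G)) -[X in _ <= _ * X](sqr_sqrtr (sqF_ge0 x)).
rewrite -exprMn ler_pXn2r ?nnegrE ?sqrtr_ge0 //.
by rewrite mulr_ge0 // ltW.
Qed.

End Noise.

(** * Expectations of products of independent variables *)

Section Indep.
Variables (dT : measure_display) (T : measurableType dT) (R : realType)
          (P : probability T R).

Lemma integral_step (K : finType) (c : K -> R) (A : K -> set T) :
  (forall k, 0 <= c k) -> (forall k, measurable (A k)) ->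
  (\int[P]_w (\sum_k c k * \1_(A k) w)%:E = (\sum_k c k * fine (P (A k)))%:E)%E.
Proof.
move=> c0 mA.
under eq_integral => w _ do rewrite -sumEFin.
rewrite ge0_integral_sum //; last 2 first.
- move=> k; apply/measurable_EFinP/measurable_funM => //.
- by move=> k w _; rewrite lee_fin mulr_ge0.
rewrite -sumEFin; apply: eq_bigr => k _.
under eq_integral => w _ do rewrite EFinM.
rewrite ge0_integralZl_EFin //; last exact/measurable_EFinP.
by rewrite integral_indic // setIT EFinM fineK // fin_num_measure.
Qed.

Variables (I : finType) (Z : I -> {RV P >-> R}).
Hypothesis indep : mutually_independent P Z.

(** Simple functions with values in a common finite list [L]: the product expands
    into indicators of joint events, to which independence applies. *)
Lemma expect_prod_simple (g : I -> {nnsfun R >-> R}) :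
  (\int[P]_w (\prod_i g i (Z i w))%:E = \prod_i \int[P]_w (g i (Z i w))%:E)%E.
Proof.
have /choice[s hs] i : exists s : seq R, range (g i) = [set` s].
  by apply/finite_seqP.
pose L := undup (flatten [seq s i | i <- enum I]).
have Lin i x : g i x \in L.
  rewrite mem_undup; apply/flattenP; exists (s i).
    by apply: map_f; rewrite mem_enum.
  have : range (g i) (g i x) by exists x.
  by rewrite hs.
have L0 (j : 'I_(size L)) : 0 <= L`_j.
  have : L`_j \in L by apply: mem_nth.
  rewrite mem_undup => /flattenP[_ /mapP[i _ ->]] h.
  have : range (g i) L`_j by rewrite hs.
  by case=> x _ <-.
pose A i (j : 'I_(size L)) : set T := Z i @^-1` (g i @^-1` [set L`_j]).
have mB i (j : 'I_(size L)) : measurable (g i @^-1` [set L`_j]) by [].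
have mA i j : measurable (A i j) by rewrite -[A i j]setTI; exact: measurable_funP.
have gE i w : g i (Z i w) = \sum_(j < size L) L`_j * \1_(A i j) w.
  have h : (index (g i (Z i w)) L < size L)%N by rewrite index_mem.
  rewrite (bigD1 (Ordinal h)) //= nth_index // indicE mem_set; last first.
    by rewrite /A /= nth_index.
  rewrite mulr1 big1 ?addr0 // => j jn.
  rewrite indicE memNset ?mulr0 //= => e; move/eqP: jn; apply; apply: val_inj => /=.
  by rewrite e index_uniq // undup_uniq.
pose q i j := fine (P (A i j)).
have single i : (\int[P]_w (g i (Z i w))%:E = (\sum_(j < size L) L`_j * q i j)%:E)%E.
  under eq_integral => w _ do rewrite gE.
  by rewrite integral_step.
under [in RHS]eq_bigr => i _ do rewrite single.
rewrite prodEFin bigA_distr_bigA /=.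
pose AA (f : {ffun I -> 'I_(size L)}) : set T :=
  \bigcap_(i in [set` [set: I]%SET]) A i (f i).
have mAA f : measurable (AA f).
  by apply: fin_bigcap_measurable; [exact: finite_finset|].
have prodE w : \prod_i g i (Z i w) =
    \sum_(f : {ffun I -> 'I_(size L)}) (\prod_i L`_(f i)) * \1_(AA f) w.
  under eq_bigr => i _ do rewrite gE.
  rewrite bigA_distr_bigA; apply: eq_bigr => f _; rewrite big_split /=; congr (_ * _).
  have [h|h] := pselect (AA f w).
    rewrite indicE mem_set // big1 // => i _; rewrite indicE mem_set //.
    by apply: h => /=; rewrite finset.inE.
  rewrite [RHS]indicE memNset //; apply/eqP/prodf_eq0.
  have /existsNP[i /not_implyP[_ hi]] := h.
  by exists i => //; rewrite indicE memNset.
under eq_integral => w _ do rewrite prodE.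
rewrite integral_step //; last by move=> f; apply: prodr_ge0.
congr (_%:E); apply: eq_bigr => f _; rewrite big_split /=; congr (_ * _).
have := indep [set: I]%SET (B := fun i => g i @^-1` [set L`_(f i)])
  (fun i => mB i (f i)).
rewrite -/(AA f) => ->.
have -> : (\prod_(i in [set: I]%SET) P (Z i @^-1` (g i @^-1` [set L`_(f i)])) =
    \prod_i (q i (f i))%:E)%E.
  apply: eq_big => [i|i _]; first by rewrite finset.inE.
  by rewrite /q fineK // fin_num_measure.
by rewrite prodEFin.
Qed.

(** Simple functions increase to each [f i], and the products of their
    expectations stay below the bound; monotone convergence concludes. *)
Lemma expect_prod_le (f : I -> R -> R) (b : I -> R) :
  (forall i x, 0 <= f i x) -> (forall i, measurable_fun setT (f i)) ->
  (forall i, \int[P]_w (f i (Z i w))%:E <= (b i)%:E)%E ->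
  (\int[P]_w (\prod_i f i (Z i w))%:E <= (\prod_i b i)%:E)%E.
Proof.
move=> f0 mf hb.
have mEf i : measurable_fun setT (EFin \o f i) by exact/measurable_EFinP.
pose g i := nnsfun_approx measurableT (mEf i).
have gcvg i x : g i n x @[n --> \oo] --> f i x.
  have := cvg_nnsfun_approx measurableT (mEf i) (fun x _ => f0 i x) (Logic.I : setT x).
  by move/fine_cvg.
have gnd i x : {homo (fun n => g i n x) : a b / (a <= b)%N >-> a <= b}.
  by move=> a b' /(nd_nnsfun_approx measurableT (mEf i))/lefP; exact.
have gle i n x : g i n x <= f i x.
  have cv : cvgn (fun n => g i n x) by apply: cvgP (gcvg i x).
  rewrite -(cvg_lim (@Rhausdorff R) (gcvg i x)).
  exact: (nondecreasing_cvgn_le (gnd i x) cv).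
pose h n w : \bar R := (\prod_i g i n (Z i w))%:E.
have hcvg w : h n w @[n --> \oo] --> (\prod_i f i (Z i w))%:E.
  apply: cvg_EFin; first exact: nearW.
  exact: (@cvg_big R I *%R 1 xpredT (@mul_continuous R) nat \oo (index_enum I)
    (fun i n => g i n (Z i w)) (fun i => f i (Z i w)) _ (fun i _ => gcvg i (Z i w))).
have hnd w : {homo h^~ w : a c / (a <= c)%N >-> (a <= c)%E}.
  move=> a c ac; rewrite lee_fin; apply: ler_prod => i _.
  by rewrite gnd // andbT.
have mh n : measurable_fun setT (h n).
  apply/measurable_EFinP/measurable_prod => i _.
  exact: measurableT_comp.
have h0 n w : (0 <= h n w)%E by rewrite lee_fin; apply: prodr_ge0.
have -> : (\int[P]_w (\prod_i f i (Z i w))%:E = \int[P]_w limn (h^~ w))%E.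
  by apply: eq_integral => w _; apply/esym/cvg_lim => //; exact: hcvg.
rewrite monotone_convergence //.
apply: lime_le.
  apply: ereal_nondecreasing_is_cvgn => a c ac; apply: ge0_le_integral => //.
  by move=> w _; exact: hnd.
apply: nearW => n; rewrite /h expect_prod_simple.
have b0 i : 0 <= b i.
  by rewrite -lee_fin; apply: le_trans (hb i); apply: integral_ge0 => w _;
    rewrite lee_fin.
have hs i : (\int[P]_w (g i n (Z i w))%:E <= (b i)%:E)%E.
  apply: le_trans (hb i); apply: ge0_le_integral => //.
  - by move=> w _; rewrite lee_fin.
  - exact/measurable_EFinP/(measurableT_comp (f := g i n)).
  - exact/measurable_EFinP/(measurableT_comp (mf i)).
  - by move=> w _; rewrite lee_fin.
have hs0 i : (0 <= \int[P]_w (g i n (Z i w))%:E)%E.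
  by apply: integral_ge0 => w _; rewrite lee_fin.
have E i : (\int[P]_w (g i n (Z i w))%:E = (fine (\int[P]_w (g i n (Z i w))%:E))%:E)%E.
  by rewrite fineK // ge0_fin_numE //; exact: le_lt_trans (hs i) (ltry _).
rewrite (eq_bigr _ (fun i _ => E i)) prodEFin lee_fin; apply: ler_prod => i _.
by apply/andP; split; [exact: fine_ge0|rewrite -lee_fin -(E i); exact: hs].
Qed.
End Indep.

(** * Sub-Gaussian tails *)

Section Tail.
Variables (dT : measure_display) (T : measurableType dT) (R : realType)
          (P : probability T R) (I : finType) (Z : I -> {RV P >-> R}) (sigma : R).
Hypothesis indep : mutually_independent P Z.
Hypothesis mean0 : forall i, ('E_P[Z i] = 0)%E.
Hypothesis subg : forall i, sub_gaussian P sigma (Z i).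
Hypothesis sigma0 : 0 <= sigma.

Definition lincomb (a : I -> R) (w : T) : R := \sum_i Z i w * a i.

Lemma measurable_lincomb a : measurable_fun setT (lincomb a).
Proof. by apply: measurable_sum => i; apply: measurable_funM. Qed.

HB.instance Definition _ a := isMeasurableFun.Build _ _ _ _ (lincomb a)
  (measurable_lincomb a).

Lemma mgf_lincomb a s : \sum_i a i ^+ 2 <= 1 ->
  (\int[P]_w (expR (s * lincomb a w))%:E <= (expR (sigma ^+ 2 * s ^+ 2 / 2))%:E)%E.
Proof.
move=> a1.
have E w : expR (s * lincomb a w) = \prod_i expR (s * a i * Z i w).
  by rewrite -expR_sum /lincomb mulr_sumr; congr expR; apply: eq_bigr => i _; ring.
under eq_integral => w _ do rewrite E.
apply: (@le_trans _ _ (\prod_i expR (sigma ^+ 2 * (s * a i) ^+ 2 / 2))%:E).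
  apply: (expect_prod_le indep (f := fun i x => expR (s * a i * x))).
  - by move=> i x; exact: expR_ge0.
  - move=> i; apply: measurableT_comp => //.
  - move=> i; have [_ /(_ (s * a i))] := subg i.
    rewrite mean0 /= unlock; apply: le_trans; rewrite le_eqVlt; apply/orP; left;
      apply/eqP.
    by apply: eq_integral => w _; rewrite subr0.
rewrite lee_fin -expR_sum ler_expR -mulr_suml.
rewrite ler_pM2r ?invr_gt0 //.
rewrite (eq_bigr (fun i => sigma ^+ 2 * s ^+ 2 * a i ^+ 2)); last by move=> i _; ring.
by rewrite -mulr_sumr -[X in _ <= X]mulr1 ler_wpM2l // mulr_ge0 ?sqr_ge0.
Qed.

Lemma tail_exp a s c : \sum_i a i ^+ 2 <= 1 -> 0 < s ->
  (P [set w | (c <= lincomb a w)%R] <= (expR (sigma ^+ 2 * s ^+ 2 / 2 - s * c))%:E)%E.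
Proof.
move=> a1 s0; apply: le_trans (chernoff (lincomb a : {RV P >-> R}) c s0) _.
rewrite expRD EFinM; apply: lee_wpmul2r; first by rewrite lee_fin expR_ge0.
rewrite /mmt_gen_fun unlock; apply: le_trans (mgf_lincomb s a1).
rewrite le_eqVlt; apply/orP; left; apply/eqP; apply: eq_integral => w _ /=.
by rewrite mulrC.
Qed.

(** Chernoff's bound with [s = y / sigma]. For [sigma = 0] the parameter [s] of
    [tail_exp] is arbitrary, and letting it grow shows that the linear combination
    is almost surely nonpositive. *)
Lemma tail a y : \sum_i a i ^+ 2 <= 1 -> 0 < y ->
  (P [set w | (sigma * y < lincomb a w)%R] <= (expR (- (y ^+ 2 / 2)))%:E)%E.
Proof.
move=> a1 y0.
have mge c : measurable [set w | c <= lincomb a w].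
  have -> : [set w | c <= lincomb a w] = setT `&` lincomb a @^-1` [set` `[c, +oo[].
    by rewrite setTI; apply/funext => w; rewrite /preimage /= in_itv /= andbT.
  exact: measurable_lincomb.
have mgt c : measurable [set w | c < lincomb a w].
  have -> : [set w | c < lincomb a w] = setT `&` lincomb a @^-1` [set` `]c, +oo[].
    by rewrite setTI; apply/funext => w; rewrite /preimage /= in_itv /= andbT.
  exact: measurable_lincomb.
have [s0|] := ltP 0 sigma.
  apply: le_trans (_ : P [set w | (sigma * y <= lincomb a w)%R] <= _)%E.
    by apply: le_measure; rewrite ?inE // => w /= /ltW.
  have := tail_exp (sigma * y) a1 (divr_gt0 y0 s0).
  rewrite (_ : _ - _ = - (y ^+ 2 / 2)) //; field; exact: lt0r_neq0.
move=> s0; have sz : sigma = 0 by apply/eqP; rewrite eq_le s0 sigma0.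
rewrite sz mul0r.
suff -> : P [set w | 0 < lincomb a w] = 0 by rewrite lee_fin expR_ge0.
have null (n : nat) : P [set w | n.+1%:R^-1 <= lincomb a w] = 0.
  apply/eqP; rewrite eq_le measure_ge0 andbT; apply/lee_addgt0Pr => e e0.
  rewrite add0e.
  have := tail_exp n.+1%:R^-1 a1 (s := n.+1%:R * e^-1).
  rewrite sz expr0n /= !mul0r add0r => h.
  have {}h := h ltac:(by rewrite mulr_gt0 ?invr_gt0).
  apply: le_trans h _; rewrite lee_fin.
  rewrite mulrAC mulfV ?mul1r //.
  have e1 := expR_ge1Dx e^-1.
  rewrite expRN -[X in _ <= X]invrK lef_pV2 ?posrE ?expR_gt0 ?invr_gt0 //.
  by lra.
have -> : [set w | 0 < lincomb a w] = \bigcup_n [set w | n.+1%:R^-1 <= lincomb a w].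
  apply/seteqP; split => [w /= w0|w [n _] /= h]; last by apply: lt_le_trans h;
    rewrite invr_gt0.
  exists (Num.bound (lincomb a w)^-1) => //=.
  rewrite invf_ple ?posrE //; apply: le_trans (ltW (archi_boundP _)) _.
    by rewrite invr_ge0 ltW.
  by rewrite ler_nat.
apply: measure_negligible; first by apply: bigcup_measurable.
apply: negligible_bigcup => n; exists [set w | n.+1%:R^-1 <= lincomb a w].
by split => //; exact: null.
Qed.
End Tail.

(** * Ranks of the unfoldings of a tensor train *)

Section TTRank.
Variables (R : realType) (d : nat) (p r : nat -> nat) (k : nat).
Hypothesis kd : (k < d)%N.
Variable G : forall l : 'I_d, 'I_(r l) -> 'I_(p l.+1) -> 'I_(r l.+1) -> R.
Local Notation At := {dffun forall j : 'I_d.+1, 'I_(r j)}.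
Variable dfl : forall j : 'I_d.+1, 'I_(r j).
Variable kk : 'I_d.+1.
Hypothesis kkE : kk = k :> nat.

(** A sequence of summation indices is cut at position [k]; each half is completed
    by the default indices [dfl], so that the halves have the type of full
    sequences. *)
Let tl (u : At) : At := [ffun j : 'I_d.+1 => if (j <= k)%N then u j else dfl j].
Let tr (u : At) : At := [ffun j : 'I_d.+1 => if (k <= j)%N then u j else dfl j].
Let glue (u v : At) : At := [ffun j : 'I_d.+1 => if (j <= k)%N then u j else v j].

Let term (u : At) (i : tindex d p) (l : 'I_d) : R :=
  @G l (u (widen_ord (leqnSn d) l)) (i l) (u (lift ord0 l)).
Let Phi (u : At) i := \prod_(l < d | (l < k)%N) term u i l.
Let Psi (u : At) i := \prod_(l < d | ~~ (l < k)%N) term u i l.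

Let PhiE u i : Phi (tl u) i = Phi u i.
Proof.
apply: eq_bigr => l lk; rewrite /term !ffunE.
have h1 : (widen_ord (leqnSn d) l <= k)%N by exact: ltnW.
have h2 : (lift ord0 l <= k)%N by rewrite lift0.
by rewrite h1 h2.
Qed.

Let PsiE u i : Psi (tr u) i = Psi u i.
Proof.
apply: eq_bigr => l; rewrite -leqNgt => kl; rewrite /term !ffunE.
have h1 : (k <= widen_ord (leqnSn d) l)%N by [].
have h2 : (k <= lift ord0 l)%N by rewrite lift0 leqW.
by rewrite h1 h2.
Qed.

Let F (b : 'I_(r kk)) i := \sum_(u : At | (u kk == b) && (tl u == u)) Phi u i.
Let H (b : 'I_(r kk)) i := \sum_(u : At | (u kk == b) && (tr u == u)) Psi u i.

(** For a fixed value [b] of the index at the cut, the pairs of halves correspond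
    to the full sequences of indices. *)
Let split_sum i : \sum_(u : At) \prod_(l < d) term u i l = \sum_b F b i * H b i.
Proof.
rewrite (partition_big (fun u : At => u kk) xpredT) //=; apply: eq_bigr => b _.
rewrite /F /H big_distrlr /= pair_big /=.
rewrite (reindex_onto (fun u : At => (tl u, tr u)) (fun q => glue q.1 q.2)) /=;
  last first.
  move=> [u v] /= /andP[/andP[/eqP ub /eqP tu] /andP[/eqP vb /eqP tv]].
  congr pair.
    rewrite -[RHS]tu; apply/ffunP => j; rewrite !ffunE.
    by case: leqP.
  rewrite -[RHS]tv; apply/ffunP => j; rewrite !ffunE; case: (leqP k j) => // kj.
  case: leqP => // jk; have jE : j = kk by apply: val_inj; rewrite /= kkE; apply/eqP;
    rewrite eqn_leq jk.
  by subst j; rewrite ub vb.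
apply: eq_big => [u|u _].
  have -> : glue (tl u) (tr u) == u.
    apply/eqP/ffunP => j; rewrite !ffunE; case: leqP => // jk.
    by rewrite ltnW.
  have h1 : (kk <= k)%N by rewrite kkE.
  have h2 : (k <= kk)%N by rewrite kkE.
  rewrite !ffunE h1 h2 andbT.
  have -> : tl (tl u) == tl u by apply/eqP/ffunP => j; rewrite !ffunE; case: leqP.
  have -> : tr (tr u) == tr u by apply/eqP/ffunP => j; rewrite !ffunE; case: leqP.
  by rewrite !andbT andbb.
by rewrite PhiE PsiE (bigID (fun l : 'I_d => (l < k)%N)).
Qed.

Let gluei (u v : tindex d p) : tindex d p :=
  [ffun j : 'I_d => if (j < k)%N then u j else v j].

Let agree_row (u v : tindex d p) : unfold_row k u = unfold_row k v ->
  forall j : 'I_d, (j < k)%N -> u j = v j.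
Proof.
move=> e; pose w := gluei u v.
have rw : unfold_row k w = unfold_row k u by apply: eq_bigr => l lk; rewrite ffunE lk.
have cw : unfold_col k w = unfold_col k v.
  by apply: eq_bigr => l kl; rewrite ffunE ltnNge kl.
have wv : w = v by apply: colmajor_index_inj;
  rewrite !(colmajor_indexE _ (ltnW kd)) rw cw e.
by move=> j jk; rewrite -[in RHS]wv ffunE jk.
Qed.

Let agree_col (u v : tindex d p) : unfold_col k u = unfold_col k v ->
  forall j : 'I_d, (k <= j)%N -> u j = v j.
Proof.
move=> e; pose w := gluei v u.
have rw : unfold_row k w = unfold_row k v by apply: eq_bigr => l lk; rewrite ffunE lk.
have cw : unfold_col k w = unfold_col k u.
  by apply: eq_bigr => l kl; rewrite ffunE ltnNge kl.
have wv : w = v by apply: colmajor_index_inj;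
  rewrite !(colmajor_indexE _ (ltnW kd)) rw cw e.
by move=> j jk; rewrite -[in RHS]wv ffunE ltnNge jk.
Qed.

(** The unfolding factors through the index at the cut, which takes [r k] values.
    A row or column number that is not reached by any multi-index gives a zero
    row or column. *)
Lemma rank_unfolding_le (X : tensor R d p) :
  (forall i, X i = \sum_(u : At) \prod_(l < d) term u i l) ->
  (\rank (unfolding k X) <= r k)%N.
Proof.
move=> hX.
pose A : 'M[R]_(dimprod p 1 k, r kk) := \matrix_(a, b)
  if [pick i : tindex d p | unfold_row k i == a] is Some i then F b i else 0.
pose B : 'M[R]_(r kk, dimprod p k.+1 d) := \matrix_(b, a)
  if [pick i : tindex d p | unfold_col k i == a] is Some i then H b i else 0.
suff -> : unfolding k X = A *m B.
  by apply: leq_trans (mxrankM_maxr _ _) _; rewrite -[X in (_ <= r X)%N]kkE;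
    exact: rank_leq_row.
apply/matrixP => a c; rewrite !mxE.
under [RHS]eq_bigr => b _ do rewrite /A /B !mxE.
case: pickP => [i /eqP ia|no]; last first.
  rewrite [LHS]big_pred0; last by move=> i; have /= -> := no i.
  by rewrite big1 // => b _; rewrite mul0r.
case: pickP => [i' /eqP ic|no]; last first.
  rewrite [LHS]big_pred0; last by move=> i0; have /= -> := no i0; rewrite andbF.
  by rewrite big1 // => b _; rewrite mulr0.
pose g := gluei i i'.
have rg : unfold_row k g = a by rewrite -ia; apply: eq_bigr => l lk; rewrite ffunE lk.
have cg : unfold_col k g = c.
  by rewrite -ic; apply: eq_bigr => l kl; rewrite ffunE ltnNge kl.
rewrite [LHS](big_pred1 g); last first.
  move=> u /=; apply/andP/eqP => [[/eqP ra /eqP ca]|->]; last by rewrite rg cg.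
  by apply: colmajor_index_inj; rewrite !(colmajor_indexE _ (ltnW kd)) ra ca rg cg.
rewrite hX split_sum; apply: eq_bigr => b _; congr (_ * _).
  apply: eq_bigr => u _; apply: eq_bigr => l lk; rewrite /term.
  by rewrite (agree_row (u := g) (v := i)) // rg ia.
apply: eq_bigr => u _; apply: eq_bigr => l; rewrite -leqNgt => kl; rewrite /term.
by rewrite (agree_col (u := g) (v := i')) // cg ic.
Qed.

End TTRank.

Lemma tt_rank_le (R : realType) (d : nat) (p r : nat -> nat) (X : tensor R d p)
    (k : nat) :
  (k < d)%N -> (forall j, (j <= d)%N -> (0 < r j)%N) -> tt_decomposable r X ->
  (\rank (unfolding k X) <= r k)%N.
Proof.
move=> kd r0 [G hG].
have kd' : (k < d.+1)%N by exact: ltnW.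
apply: (@rank_unfolding_le R d p r k kd G
  (fun j => Ordinal (r0 j (ltn_ord j))) (Ordinal kd') erefl X hG).
Qed.

(** * Union bound and spectral gap *)

Section Event.
Variables (dT : measure_display) (T : measurableType dT) (R : realType)
          (P : probability T R).

Lemma union_bound (K : finType) (E : K -> set T) (e : R) :
  (forall k, measurable (E k)) -> (forall k, (P (E k) <= e%:E)%E) ->
  exists F : set T, [/\ measurable F, (P F <= (#|K|%:R * e)%:E)%E &
    forall k, E k `<=` F].
Proof.
move=> mE hE; have mF (s : seq K) : measurable (\big[setU/set0]_(k <- s) E k).
  by apply: bigsetU_measurable.
exists (\big[setU/set0]_(k <- enum K) E k); split; first exact: mF.
  rewrite cardE; elim: (enum K) => [|k s IH].
    by rewrite big_nil measure0 mul0r.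
  rewrite big_cons /= -nat1r mulrDl mul1r EFinD.
  by apply: (le_trans (measureU2 P (mE k) (mF s))); apply: leeD; [exact: hE|exact: IH].
by move=> k w Ekw; rewrite -bigcup_seq; exists k => //=; rewrite mem_enum.
Qed.

Variables (I : finType) (Z : I -> {RV P >-> R}) (sigma : R).
Hypothesis indep : mutually_independent P Z.
Hypothesis mean0 : forall i, ('E_P[Z i] = 0)%E.
Hypothesis subg : forall i, sub_gaussian P sigma (Z i).
Hypothesis sigma0 : 0 <= sigma.

(** The level [sqrt (8 * D)] makes the tail [exp (- 4 * D)], which outweighs the
    [8 ^ D] elements of the net since [8 <= exp 3]. *)
Lemma net_event (J : finType) (a : J -> I -> R) (D : nat) :
  (0 < D)%N -> (#|J| <= 8 ^ D)%N -> (forall j, \sum_i a j i ^+ 2 <= 1) ->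
  exists E : set T, [/\ measurable E, (P E <= (expR (- D%:R))%:E)%E &
    forall w, ~ E w -> forall j,
      \sum_i Z i w * a j i <= sigma * Num.sqrt (8 * D%:R)].
Proof.
move=> D0 cJ a1; pose y : R := Num.sqrt (8 * D%:R).
have y0 : 0 < y by rewrite sqrtr_gt0 mulr_gt0 // ltr0n.
have y2 : y ^+ 2 = 8 * D%:R by rewrite sqr_sqrtr // mulr_ge0.
pose E j := [set w | sigma * y < lincomb Z (a j) w].
have mE j : measurable (E j).
  have -> : E j = setT `&` lincomb Z (a j) @^-1` [set` `]sigma * y, +oo[].
    by rewrite setTI; apply/funext => w; rewrite /preimage /= in_itv /= andbT.
  exact: measurable_lincomb.
have hE j : (P (E j) <= (expR (- (4 * D%:R)))%:E)%E.
  have := tail indep mean0 subg sigma0 (a1 j) y0.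
  by rewrite y2 (_ : 8 * D%:R / 2 = 4 * D%:R) //; field.
have [F [mF PF EF]] := union_bound mE hE.
exists F; split => //.
  apply: le_trans PF _; rewrite lee_fin.
  have h8 : (#|J|%:R : R) <= expR (3 * D%:R).
    apply: (@le_trans _ _ (8 ^+ D)); first by rewrite -natrX ler_nat.
    rewrite expRM_natr; apply: lerXn2r; rewrite ?nnegrE ?expR_ge0 //.
    have h1 := expR_ge1Dx (1 : R).
    rewrite -[X in expR X](mulr1 (3%:R)) expRM_natl.
    have -> : (8 : R) = 2 ^+ 3 by rewrite -natrX.
    by apply: lerXn2r; rewrite ?nnegrE ?expR_ge0 //; lra.
  apply: le_trans (ler_wpM2r (expR_ge0 _) h8) _.
  by rewrite -expRD ler_expR; lra.
move=> w nF j; rewrite leNgt; apply/negP => h; apply: nF.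
exact: (EF j).
Qed.
End Event.

Section GapSv.
Variable R : realType.

(** [singval] is 0 if there is no decomposition, so a positive lower bound
    provides one; for [lam = 0] the claim is trivial. *)
Lemma singval_gap m n (F : 'M[R]_(m, n)) k (lam : R) :
  (0 < k)%N -> (\rank F <= k)%N -> 0 <= lam -> lam <= singval F k ->
  spectral_gap (lam ^+ 2) F /\ spectral_gap (lam ^+ 2) F^T.
Proof.
move=> k0 rF; rewrite le_eqVlt => /predU1P[<- _|lam0].
  by split=> x; exists x => //; rewrite expr0n mul0r sqF_ge0.
rewrite /singval; case: xgetP => [s _ [U [V h]] hl|_ hl]; last first.
  by move: (lt_le_trans lam0 hl); rewrite ltxx.
have g m' n' (F' : 'M[R]_(m', n')) U' V' : is_svd F' U' s V' -> (\rank F' <= k)%N ->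
    spectral_gap (lam ^+ 2) F'.
  move=> h' r' x; have [x' e1 e2] := svd_gap h' k0 r' x; exists x' => //.
  apply: le_trans e2; apply: ler_wpM2r; first exact: sqF_ge0.
  have lam1 := ltW lam0; have sk0 := le_trans lam1 hl.
  by rewrite ler_sqr ?nnegrE.
split; first exact: g h rF.
by apply: g (is_svd_tr h) _; rewrite mxrank_tr.
Qed.
End GapSv.

(** * The theorem *)

Section NoiseEvents.
Variables (R : realType) (d : nat) (p r : nat -> nat).
Variables (dT : measure_display) (T : measurableType dT) (P : probability T R).
Variables (sigma : R) (Z : tindex d p -> {RV P >-> R}).
Implicit Types (U : forall k, 'M[R]_(p k * r k.-1, r k))
               (V : forall k, 'M[R]_(r k * p k, r k.-1)).
Hypotheses (r0 : r 0 = 1%N) (rd : r d = 1%N).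
Hypothesis indep : mutually_independent P Z.
Hypothesis mean0 : forall i, ('E_P[Z i] = 0)%E.
Hypothesis subg : forall i, sub_gaussian P sigma (Z i).
Hypothesis sigma0 : 0 <= sigma.

Let Zt w : tensor R d p := [ffun i => Z i w].

(** Square of the level [sigma * sqrt (8 * D)] of [net_event] times the price
    [4 ^ d] of passing to nets. *)
Definition noise_level (D : nat) : R := (4 ^+ d * (sigma * Num.sqrt (8 * D%:R))) ^+ 2.

Lemma noise_levelE D : noise_level D = 8 * 16 ^+ d * sigma ^+ 2 * D%:R.
Proof.
rewrite /noise_level !exprMn sqr_sqrtr ?mulr_ge0 // -exprM mulnC exprM.
by rewrite (_ : 4 ^+ 2 = 16 :> R) -?natrX //; ring.
Qed.

Let dim_tt : nat := (\sum_(1 <= k < d.+1) p k * r k.-1 * r k)%N.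
Let dim_init (j : nat) : nat :=
  (\sum_(1 <= k < j.+1) p k * r k.-1 * r k + p j.+1 * r j + dimprod p j.+2 d)%N.

Let c_ge0 D : 0 <= sigma * Num.sqrt (8 * D%:R).
Proof. by rewrite mulr_ge0 // sqrtr_ge0. Qed.

Lemma tt_noise_event j n (q : nat) : (j.+1 + n = d)%N -> (0 < q <= dim_tt)%N ->
  exists E : set T, [/\ measurable E, (P E <= (expR (- q%:R))%:E)%E &
    forall w, ~ E w -> forall U V, orthU d U -> orthV d V ->
      sqF ((left_lift U j)^T *m rowsplit j (Zt w) *m right_basis d V j.+1 n) <=
        noise_level dim_tt].
Proof.
move=> jn /andP[q0 qD]; have [J [a [cJ a1 hJ]]] := tt_probe_net R p r0 rd jn.
have [E [mE PE hE]] := net_event indep mean0 subg sigma0 (leq_trans q0 qD) cJ a1.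
exists E; split => //.
  by apply: le_trans PE _; rewrite lee_fin ler_expR lerN2 ler_nat.
move=> w nE U V hU hV; apply: (hJ (Zt w) _ (c_ge0 _)) => // i.
by apply: le_trans (hE w nE i); rewrite (eq_bigr (fun t => Z t w * a i t)) // => t _;
  rewrite ffunE.
Qed.

Lemma init_noise_event j (q : nat) : (j.+1 < d)%N -> (0 < q <= dim_init j)%N ->
  exists E : set T, [/\ measurable E, (P E <= (expR (- q%:R))%:E)%E &
    forall w, ~ E w -> forall U, orthU d U -> forall x : 'M[R]_(_, 1),
      sqF ((left_lift U j)^T *m rowsplit j (Zt w) *m x) <=
        noise_level (dim_init j) * sqF x].
Proof.
move=> jd /andP[q0 qD]; have [J [a [cJ a1 hJ]]] := init_probe_net R p r0 jd.
have [E [mE PE hE]] := net_event indep mean0 subg sigma0 (leq_trans q0 qD) cJ a1.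
exists E; split => //.
  by apply: le_trans PE _; rewrite lee_fin ler_expR lerN2 ler_nat.
move=> w nE U hU; apply: (hJ (Zt w) _ (c_ge0 _)) => // i.
by apply: le_trans (hE w nE i); rewrite (eq_bigr (fun t => Z t w * a i t)) // => t _;
  rewrite ffunE.
Qed.

Lemma noise_event (q : nat) : (0 < q <= dim_tt)%N ->
  (forall j, (j.+1 < d)%N -> (q <= dim_init j)%N) ->
  exists A : set T, [/\ measurable A,
    ((1 - (2 * d%:R) * expR (- q%:R))%:E <= P A)%E &
    forall w, A w ->
     (forall U V, orthU d U -> orthV d V -> forall j n, (j.+1 + n = d)%N ->
        sqF ((left_lift U j)^T *m rowsplit j (Zt w) *m right_basis d V j.+1 n) <=
          noise_level dim_tt) /\
     (forall U, orthU d U -> forall j, (j.+1 < d)%N -> forall x : 'M[R]_(_, 1),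
        sqF ((left_lift U j)^T *m rowsplit j (Zt w) *m x) <=
          noise_level (dim_init j) * sqF x)].
Proof.
move=> hq hq'; have q0 : (0 < q)%N by case/andP: hq.
have hj (j : 'I_d) : (j.+1 + (d - j.+1) = d)%N by rewrite subnKC.
have /choice[E1 hE1] (j : 'I_d) := tt_noise_event (hj j) hq.
have /choice[E2 hE2] (j : 'I_d) : exists E : set T,
    [/\ measurable E, (P E <= (expR (- q%:R))%:E)%E &
    (j.+1 < d)%N -> forall w, ~ E w -> forall U, orthU d U -> forall x : 'M[R]_(_, 1),
      sqF ((left_lift U j)^T *m rowsplit j (Zt w) *m x) <=
        noise_level (dim_init j) * sqF x].
  have [jd|jd] := ltnP j.+1 d; last first.
    by exists set0; split; rewrite ?measure0 ?lee_fin ?expR_ge0 // ltnNge jd.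
  have hqj : (0 < q <= dim_init j)%N by rewrite q0 hq'.
  by have [E [mE PE hE]] := init_noise_event jd hqj; exists E.
pose E (k : 'I_d + 'I_d) := match k with inl j => E1 j | inr j => E2 j end.
have mE k : measurable (E k) by case: k => j /=; [case: (hE1 j)|case: (hE2 j)].
have PE k : (P (E k) <= (expR (- q%:R))%:E)%E by case: k => j /=;
  [case: (hE1 j)|case: (hE2 j)].
have [F [mF PF EF]] := union_bound mE PE.
exists (~` F); split; first exact: measurableC.
  rewrite probability_setC // EFinB; apply: leeB => //.
  by apply: le_trans PF _; rewrite card_sum !card_ord addnn -mul2n natrM.
move=> w nF; split.
- move=> U V hU hV j n jn; have jd : (j < d)%N by rewrite -jn leq_addr.
  have [_ _ h] := hE1 (Ordinal jd).
  have -> : n = (d - j.+1)%N by rewrite -jn addKn.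
  by apply: h => // h; apply: nF; exact: (EF (inl (Ordinal jd))).
- move=> U hU j jd; have [_ _ h] := hE2 (Ordinal (ltnW jd)).
  by apply: h => // h; apply: nF; exact: (EF (inr (Ordinal (ltnW jd)))).
Qed.

End NoiseEvents.

Theorem corollary4p1 (R : realType) (d : nat) (hd : (2 <= d)%N) :
  exists Cgap C c Cd : R,
    [/\ 0 < Cgap, 0 < C, 0 < c & 0 < Cd] /\
    forall (p r : nat -> nat)
      (dT : measure_display) (T : measurableType dT) (P : probability T R)
      (sigma : R) (X : tensor R d p) (Z : tindex d p -> {RV P >-> R}),
      (forall k, (1 <= k <= d)%N -> (0 < p k)%N) ->
      (forall k, (1 <= k <= d.-1)%N -> (0 < r k)%N) ->
      r 0%N = 1%N -> r d = 1%N ->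
      (forall k, (1 <= k <= d)%N ->
         (r k <= r k.-1 * p k)%N /\ (r k.-1 <= p k * r k)%N) ->
      0 <= sigma ->
      tt_decomposable r X ->
      mutually_independent P Z ->
      (forall i, ('E_P[Z i] = 0)%E) ->
      (forall i, sub_gaussian P sigma (Z i)) ->
      (forall k, (1 <= k <= d.-1)%N ->
         Cgap * (Num.sqrt ((\sum_(1 <= i < d.+1) p i * r i.-1 * r i)%N%:R)
                 + Num.sqrt ((dimprod p k.+1 d)%:R)) * sigma
         <= singval (unfolding k X) (r k)) ->
      exists A : set T,
        [/\ measurable A,
            ((1 - C * expR (- c * (\big[minn/p 1%N]_(1 <= i < d.+1) p i)%:R))%:E
              <= P A)%E
          & forall w, A w ->
            forall Xhat : nat -> tensor R d p,
              ttoi_iterates r [ffun i => X i + Z i w] Xhat ->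
              forall t, (1 <= t)%N ->
                sqfrob (Xhat t - X)
                <= Cd * sigma ^+ 2
                   * (\sum_(1 <= i < d.+1) p i * r i * r i.-1)%N%:R].
Proof.
case: d hd => // d' hd; set d := d'.+1.
have d'0 : (0 < d')%N by [].
have dp : 0 < d%:R :> R by rewrite ltr0n.
have d1 : 1 <= d%:R :> R by rewrite ler1n.
(* [M] is the square of the price 4 ^ d of passing to nets *)
pose M : R := 16 ^+ d.
have M1 : 1 <= M by rewrite exprn_ege1 // ler1n.
have M0 : 0 < M by apply: lt_le_trans M1.
pose Cgap := 64 * d%:R * M.
have Cgap0 : 0 < Cgap by rewrite !mulr_gt0.
exists Cgap, (2 * d%:R), 1, ((2 + 4 * d%:R) * (8 * M)); split.
  by split; rewrite ?mulr_gt0 // addr_gt0 // mulr_gt0.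
move=> p r dT T P sigma X Z hp hr r0 rd hrp s0 hX indep mean0 subg hlam.
have rpos j : (j <= d)%N -> (0 < r j)%N.
  move=> jd; case: (posnP j) => [->|j0]; first by rewrite r0.
  move: jd; rewrite leq_eqVlt => /predU1P[->|jd]; first by rewrite rd.
  by apply: hr; rewrite j0.
set q := \big[minn/p 1%N]_(1 <= i < d.+1) p i.
have q1 : (q <= p 1)%N by rewrite /q big_ltn // geq_minl.
have q0 : (0 < q)%N.
  rewrite /q big_nat; apply: (big_ind (fun x => 0 < x)%N); first exact: hp.
    by move=> x y x0 y0; rewrite leq_min x0 y0.
  exact: hp.
set D := (\sum_(1 <= k < d.+1) p k * r k.-1 * r k)%N.
pose di j := (\sum_(1 <= k < j.+1) p k * r k.-1 * r k + p j.+1 * r j +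
  dimprod p j.+2 d)%N.
have p1r : (p 1 <= p 1 * r 0 * r 1)%N by rewrite r0 muln1 leq_pmulr // rpos.
have qD : (0 < q <= D)%N.
  by rewrite q0 (leq_trans q1) // /D big_ltn // (leq_trans p1r) // leq_addr.
have qdi j : (j.+1 < d)%N -> (q <= di j)%N.
  move=> jd; apply: leq_trans q1 _; rewrite /di -addnA; case: j jd => [|j] jd.
    by rewrite big_geq // add0n r0 muln1 leq_addr.
  by rewrite big_ltn // (leq_trans p1r) // -!addnA leq_addr.
have diD j : (j.+1 < d)%N -> (di j <= D + dimprod p j.+2 d)%N.
  move=> jd; rewrite /di leq_add2r /D [X in (_ <= X)%N](big_cat_nat (n := j.+2)) //=;
    last by lia.
  rewrite [X in (_ <= X + _)%N]big_nat_recr //= -addnA leq_add2l.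
  by apply: leq_trans (leq_addr _ _); rewrite leq_pmulr // rpos // ltnW.
have [A [mA PA hA]] := noise_event r0 rd indep mean0 subg s0 qD qdi.
exists A; split => //; first by rewrite mulN1r.
move=> w Aw Xhat [U [V [hsvd hodd heven]]] t t1.
have {hA}[hT hE] := hA w Aw.
pose Zt : tensor R d p := [ffun i => Z i w].
have YE : [ffun i => X i + Z i w] = X + Zt by apply/ffunP => i; rewrite !ffunE.
rewrite {}YE in hsvd hodd heven.
pose Pk k : R := (dimprod p k d)%:R.
pose lam k : R := Cgap * (Num.sqrt D%:R + Num.sqrt (Pk k.+1)) * sigma.
have lam0 k : 0 <= lam k by rewrite !mulr_ge0 ?addr_ge0 ?sqrtr_ge0 // ltW.
(* [Cgap] is large enough for every noise level in use to be a small fraction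
   of the squared singular values: this is 32 M N <= 2048 d M^2 (a + b)^2 *)
have key k N : (N <= D + dimprod p k.+1 d)%N ->
    4 * noise_level d sigma N <= (2 * d%:R)^-1 * lam k ^+ 2.
  move=> hN; rewrite noise_levelE -/M /lam.
  set a := Num.sqrt D%:R; set b := Num.sqrt (Pk k.+1).
  have a0 : 0 <= a by exact: sqrtr_ge0.
  have b0 : 0 <= b by exact: sqrtr_ge0.
  have hs : N%:R <= (a + b) ^+ 2.
    have : (N%:R : R) <= D%:R + Pk k.+1 by rewrite -natrD ler_nat.
    have <- : a ^+ 2 = D%:R by rewrite sqr_sqrtr.
    have <- : b ^+ 2 = Pk k.+1 by rewrite sqr_sqrtr // ler0n.
    have := mulr_ge0 a0 b0; rewrite sqrrD; lra.
  have -> : (2 * d%:R)^-1 * (Cgap * (a + b) * sigma) ^+ 2 =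
      2048 * d%:R * M ^+ 2 * (a + b) ^+ 2 * sigma ^+ 2.
    by rewrite /Cgap; field; exact: lt0r_neq0.
  have -> : 4 * (8 * M * sigma ^+ 2 * N%:R) = 32 * (M * N%:R) * sigma ^+ 2 by ring.
  apply: ler_wpM2r; first exact: sqr_ge0.
  have h1 : M * N%:R <= M * (a + b) ^+ 2 by rewrite ler_wpM2l // ltW.
  have h2 : M * (a + b) ^+ 2 <= d%:R * M ^+ 2 * (a + b) ^+ 2.
    have dM : 1 <= d%:R * M by rewrite -[X in X <= _]mulr1; apply: ler_pM.
    apply: ler_wpM2r; first exact: sqr_ge0.
    by rewrite expr2 mulrA; apply: ler_peMl => //; exact: ltW.
  have h3 : 0 <= d%:R * M ^+ 2 * (a + b) ^+ 2 by apply: mulr_ge0 (sqr_ge0 _);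
    apply: mulr_ge0 (sqr_ge0 _); exact: ltW.
  by rewrite -!(mulrA 2048); lra.
have nl0 N : 0 <= noise_level d sigma N by exact: sqr_ge0.
have rankX k : (0 < k < d)%N -> (\rank (unfolding k X) <= r k)%N.
  by case/andP=> k0 kd; exact: tt_rank_le.
have gaps k : (0 < k < d)%N ->
    spectral_gap (lam k ^+ 2) (unfolding k X) /\
    spectral_gap (lam k ^+ 2) (unfolding k X)^T.
  move=> kd; apply: (@singval_gap _ _ _ _ (r k)) => //.
  - by apply: rpos; case/andP: kd => _ /ltnW.
  - exact: rankX.
  - exact: hlam.
have fin : sqfrob (Xhat t - X) <= (2 + 4 * d%:R) * noise_level d sigma D.
  have lt k : (0 < k < d)%N -> 2 * noise_level d sigma D <= (2 * d%:R)^-1 * lam k ^+ 2.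
    by move=> kd; apply: le_trans (key k D (leq_addr _ _)); have := nl0 D; lra.
  have le k : (0 < k < d)%N ->
    4 * noise_level d sigma (di k.-1) <= (2 * d%:R)^-1 * lam k ^+ 2.
    by case: k => // k kd; exact: key (diD k kd).
  have [ot|ot] := boolP (odd t).
    exact: (odd_final d'0 r0 rd hrp hsvd (tau2 := noise_level d sigma D)
      (eta2 := fun k => noise_level d sigma (di k.-1)) (lam2 := fun k => lam k ^+ 2)
      (nl0 D) (fun k => nl0 _) hT hE
      (fun k kd => (gaps k kd).1) (fun k kd => (gaps k kd).2) rankX lt le ot (hodd t ot)).
  have t2 : (2 <= t)%N by case: (t) t1 ot => [|[]].
  exact: (even_final d'0 r0 rd hrp hsvd (tau2 := noise_level d sigma D)
      (eta2 := fun k => noise_level d sigma (di k.-1)) (lam2 := fun k => lam k ^+ 2)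
      (nl0 D) (fun k => nl0 _) hT hE
      (fun k kd => (gaps k kd).1) (fun k kd => (gaps k kd).2) rankX
      lt le t2 ot (heven t ot)).
apply: le_trans fin _; rewrite noise_levelE -/M.
have -> : (\sum_(1 <= i < d.+1) p i * r i * r i.-1 = D)%N.
  by apply: eq_bigr => i _; rewrite mulnAC.
by rewrite le_eqVlt; apply/orP; left; apply/eqP; ring.
Qed.
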